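(* Let $\omega$ be a locally bounded nonnegative function on $(0,\infty)$, and define functions $W^{(\omega)}_n$ on $[0,\infty)$ by \[W^{(\omega)}_0(x)=1,\qquad W^{(\omega)}_{n+1}(x)=\int_x^\infty W(z-x)\,\omega(z)\,W^{(\omega)}_n(z)\,\mathrm{d}z,\quad x\ge0,\ n\ge0.\] Let $b\ge0$. If $\sum_{n=0}^\infty W^{(\omega)}_n(b)<\infty$, then for all $x\ge b$, \[\mathbb{E}_x\left[\exp\left(-\int_0^{\tau_b^-}\omega(Z_s)\,\mathrm{d}s\right);\ \tau_b^-<\infty\right]=\frac{\sum_{n=0}^\infty W^{(\omega)}_n(x)}{\sum_{n=0}^\infty W^{(\omega)}_n(b)}.\]
   Context: Let $\Psi(\lambda)=\gamma\lambda+\frac{\sigma^2}{2}\lambda^2+\int_0^\infty(e^{-\lambda z}-1+\lambda z)\,\pi(\mathrm{d}z)$ for $\lambda\ge0$, with $\gamma\ge0$, $\sigma\ge0$, $\pi$ a measure on $(0,\infty)$ with $\int_0^\infty(z\wedge z^2)\pi(\mathrm{d}z)<\infty$. $Z$ is a spectrally positive Lévy process with $\mathbb{E}[e^{-\lambda Z_1}\mid Z_0=x]=e^{-\lambda x+\Psi(\lambda)}$, and $\mathbb{P}_x,\mathbb{E}_x$ refer to $Z_0=x$. $\tau_b^-=\inf\{t\ge0:Z_t<b\}$. $W$ is the scale function: $W(x)=0$ for $x<0$, $W$ continuous strictly increasing on $[0,\infty)$ with $\int_0^\infty e^{-qy}W(y)\,\mathrm{d}y=1/\Psi(q)$ for $q>0$.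 *)

(* Defs.v *)
From mathcomp Require Import all_boot all_order all_algebra.
From mathcomp Require Import all_classical all_reals all_analysis.
Set Implicit Arguments. Unset Strict Implicit. Unset Printing Implicit Defensive.
Import Order.TTheory GRing.Theory Num.Theory.
Import numFieldNormedType.Exports.
Local Open Scope classical_set_scope.
Local Open Scope ring_scope.

Section defs.
Context {R : realType}.
Local Notation leb := (@lebesgue_measure R).

Definition Psi (g s : R) (pi : {measure set R -> \bar R}) (l : R) : R :=
  g * l + s ^+ 2 / 2 * l ^+ 2 +
  fine (\int[pi]_(z in `]0%R, +oo[) (expR (- (l * z)) - 1 + l * z)%:E)%E.

Definition levy_triplet (g s : R) (pi : {measure set R -> \bar R}) : Prop :=
  0 <= g /\ 0 <= s /\
  (\int[pi]_(z in `]0%R, +oo[) (Num.min z (z ^+ 2))%:E < +oo)%E.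

Definition scale_function (Ps : R -> R) (W : R -> R) : Prop :=
  (forall x, x < 0 -> W x = 0) /\
  {within `[0%R, +oo[, continuous W} /\
  (forall a b, 0 <= a -> a < b -> W a < W b) /\
  (forall q, 0 < q ->
     (\int[leb]_(y in `[0%R, +oo[) (expR (- (q * y)) * W y)%:E)%E = ((Ps q)^-1)%:E).

Context {d : measure_display} {T : measurableType d}.

Definition incr (X : R -> T -> R) (u v : R) : T -> R := fun w => X v w - X u w.

(* X is a Levy process started at 0 on (T, P) with Laplace exponent Ps:
   E[exp(-l X_1)] = exp(Ps l) for l >= 0. The process started at x is x + X. *)
Definition levy_process (P : probability T R) (X : R -> T -> R) (Ps : R -> R) : Prop :=
  (forall t, measurable_fun setT (X t)) /\
  (forall w, X 0 w = 0) /\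
  (forall w t, 0 <= t -> (fun s => X s w) @ t^'+ --> X t w) /\
  (forall w t, 0 < t -> cvg ((fun s => X s w) @ t^'-)) /\
  (forall s t (B : set R), 0 <= s -> 0 <= t -> measurable B ->
     P ((fun w => X (s + t) w - X s w) @^-1` B) = P (X t @^-1` B)) /\
  (forall (n : nat) (t : nat -> R) (B : nat -> set R),
     0 <= t 0%N -> (forall i, t i < t i.+1) -> (forall i, measurable (B i)) ->
     P (\bigcap_(i in `I_n) (incr X (t i) (t i.+1) @^-1` B i)) =
     (\prod_(i < n) P (incr X (t i) (t i.+1) @^-1` B i))%E) /\
  (forall l, 0 <= l ->
     (\int[P]_w (expR (- (l * X 1 w)))%:E)%E = (expR (Ps l))%:E).

Definition tau_below (X : R -> T -> R) (x b : R) (w : T) : \bar R :=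
  ereal_inf (EFin @` [set t | 0 <= t /\ x + X t w < b]).

Definition occ_set (X : R -> T -> R) (x b : R) (w : T) : set R :=
  `[0%R, fine (tau_below X x b w)[.

Definition killed_laplace (P : probability T R) (X : R -> T -> R) (om : R -> R)
    (x b : R) : \bar R :=
  (\int[P]_(w in [set w | tau_below X x b w < +oo])
     expeR (- \int[leb]_(s in occ_set X x b w) (om (x + X s w))%:E))%E.
End defs.

Fixpoint Wom {R : realType} (W om : R -> R) (n : nat) (x : R) : \bar R :=
  match n with
  | 0%N => 1%E
  | n'.+1 => (\int[@lebesgue_measure R]_(z in `[x, +oo[)
                 ((W (z - x) * om z)%:E * Wom W om n' z))%E
  end.

(* Main.v *)
(* The law of Z - x is carried to the space of right-continuous paths, where stationary
   independent increments become the Markov property for concatenated independent paths.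
   Watching the path on the grid of mesh 4^-n, started from y >= 0 and killed at the first
   grid time spent below 0, gives a one-step recursion for E[exp (-l Z); alive]. The overshoot
   below 0 is controlled by comparing two Laplace exponents, so in the limit the killed
   potential integrates exp (-l z) to (1 - exp (-l y)) / Psi l. By uniqueness of Laplace
   transforms its density is W z - W (z - y). Hence v = S (b + .) / S b, where S is the sum
   of the W_n, solves v + G (om v) = 1 for the killed potential G. Along a path with killed
   rate a = om (Z) 1_alive and primitive B of a, 1 - exp (-B) is the integral of a exp (-B),
   and the Markov property turns this into E[exp (-B oo)] = v. *)
Require Import Defs.
From HB Require Import structures.
From mathcomp Require Import all_boot all_order all_algebra.
From mathcomp Require Import all_classical all_reals all_analysis.
From mathcomp Require Import measurable_realfun.
From mathcomp Require Import ring lra.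
Set Implicit Arguments. Unset Strict Implicit. Unset Printing Implicit Defensive.
Import Order.TTheory GRing.Theory Num.Theory.
Import numFieldNormedType.Exports.
Local Open Scope classical_set_scope.
Local Open Scope ring_scope.

(** * Grid times to the right of a given time *)

Section grid.
Context {R : realType}.
Implicit Types (h t : R) (p : R -> R).

(** [levy_process] speaks of increments between deterministic times only: there is no filtration and
    no strong Markov property at [tau_b^-]. The Markov property is therefore used at fixed times
    alone, and [tau_b^-] enters through the event that the path is still alive at time t. The grid
    recursion is an inequality in each direction, since the mass lost below 0 carries a weight exp
    (-l z) >= 1. The absence of negative jumps is visible only through the Laplace exponent, which
    is finite for every l >= 0 and grows at most quadratically; that growth bound is what keeps the
    lost weight close to 1. The function S satisfies S y = 1 + integral of W (z - y) om S. Comparing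
    this equation at y and at 0 produces the kernel W z - W (z - y), which is why the ratio solves
    an equation for the killed potential. No uniqueness theorem for v + G (om v) = 1 is invoked: the
    mean of 1 - exp (-B oo) is rewritten as G (om v) y, with the equation applied at the position of
    the path at each time s. *)

Definition gridup h t : R := (Num.truncn (t / h)).+1%:R * h.

Lemma gridup_gt h t : 0 < h -> t < gridup h t.
Proof. by move=> h0; rewrite /gridup -ltr_pdivrMr// truncnS_gt. Qed.

Lemma gridup_le h t : 0 < h -> 0 <= t -> gridup h t <= t + h.
Proof.
move=> h0 t0; rewrite /gridup -ler_pdivlMr// mulrDl divff ?gt_eqF// -natr1 lerD2r.
by rewrite truncn_le divr_ge0// ltW.
Qed.

(** Grid points lie strictly to the right of t, so they tend to t inside [t^'+] and right-continuity
    is enough. *)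
Lemma cvg_gridup (h : R^nat) t p : (forall n, 0 < h n) -> h @ \oo --> 0 ->
  0 <= t -> p s @[s --> t^'+] --> p t -> p (gridup (h n) t) @[n --> \oo] --> p t.
Proof.
move=> h0 hcvg t0 pt.
have : gridup (h n) t @[n --> \oo] --> t^'+.
  move=> A [/= e e0 eA]; suff : \forall n \near \oo, A (gridup (h n) t) by [].
    near=> n; apply: eA; last exact: gridup_gt.
  have tg := gridup_gt t (h0 n); rewrite /ball_ /= ltr0_norm ?subr_lt0// opprB ltrBlDl.
  rewrite (le_lt_trans (gridup_le (h0 n) t0))// ltrD2l.
  near: n; apply: (cvgr_lt _ hcvg); exact: e0.
by move=> /(cvg_comp _ p); apply.
Unshelve. all: end_near. Qed.

Lemma measurable_truncn_div_eq h (k : nat) : 0 < h ->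
  measurable [set t | Num.truncn (t / h) = k].
Proof.
(* Truncation sends negative numbers to 0, so the cell of index 0 is a half-line. *)
move=> h0; rewrite (_ : mkset _ = if k is 0%N then `]-oo, h[%classic
    else `[k%:R * h, k.+1%:R * h[%classic).
  by case: k => [|k]; exact: measurable_itv.
have E m t : (Num.truncn (t / h) <= m)%N = (t < m.+1%:R * h).
  by rewrite truncn_le_nat ltr_pdivrMr.
case: k => [|k]; apply/seteqP; split => t /=; rewrite in_itv/=.
- by move=> tk; rewrite -[h]mul1r -(E 0%N) tk.
- by rewrite -[X in _ < X]mul1r -(E 0%N) leqn0 => /eqP.
- by move=> tk; rewrite -E tk leqnn andbT leNgt -E tk ltnn.
- rewrite -E leNgt -E -ltnNge => /andP[a b]; apply/eqP; by rewrite eqn_leq b a.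
Qed.

(** On each of countably many cells the time argument is frozen, so measurability at every fixed
    time gives joint measurability. *)
Lemma measurable_gridup_comp d (T : measurableType d) (F : T -> R -> R) h :
  0 < h -> (forall t, measurable_fun setT (F ^~ t)) ->
  measurable_fun setT (fun z : T * R => F z.1 (gridup h z.2)).
Proof.
move=> h0 mF _ B mB; rewrite setTI.
rewrite (_ : _ @^-1` B = \bigcup_k (((F ^~ (k.+1%:R * h)) @^-1` B) `*`
    [set t | Num.truncn (t / h) = k])).
  apply: bigcupT_measurable => k; apply: measurableX.
  - by rewrite -[X in measurable X]setTI; exact: mF.
  - exact: measurable_truncn_div_eq.
apply/seteqP; split => [[w t] /= BF|[w t] [k _] /= [BF tk]].
- by exists (Num.truncn (t / h)).
- by rewrite /gridup tk.
Qed.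

End grid.

(** * The measurable space of right-continuous paths *)

Section path_space.
Context {R : realType}.

(* Negative times carry no information: a path vanishes on (-oo, 0]. *)
Record rcpath := RCPath {
  rcpath_fun :> R -> R ;
  rcpath_rc : forall t, rcpath_fun s @[s --> t^'+] --> rcpath_fun t ;
  rcpath_le0 : forall t, t <= 0 -> rcpath_fun t = 0 }.

HB.instance Definition _ := gen_eqMixin rcpath.
HB.instance Definition _ := gen_choiceMixin rcpath.

Lemma rcpath0_rc (t : R) : (fun=> 0 : R) s @[s --> t^'+] --> (0 : R).
Proof. exact: cvg_cst. Qed.

HB.instance Definition _ := isPointed.Build rcpath
  (@RCPath (fun=> 0) rcpath0_rc (fun _ _ => erefl)).

Lemma rcpathP (p q : rcpath) : (forall t, 0 < t -> p t = q t) -> p = q.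
Proof.
case: p => p prc p0; case: q => q qrc q0 /= pq.
have E : p = q.
  by apply/funext => t; have [t0|t0] := leP t 0; [rewrite p0// q0//|exact: pq].
by subst q; congr RCPath; exact: Prop_irrelevance.
Qed.

Definition cylinders : set (set rcpath) :=
  [set A | exists t (B : set R), measurable B /\ A = [set p : rcpath | B (p t)]].

Definition rcpathT := g_sigma_algebraType cylinders.
HB.instance Definition _ := Measurable.on rcpathT.

Lemma measurable_rcpath_eval t : measurable_fun setT (fun p : rcpathT => (p : rcpath) t).
Proof.
by move=> _ B mB; rewrite setTI; apply: sub_sigma_algebra; exists t, B.
Qed.

Lemma measurable_to_rcpath d (T : measurableType d) (f : T -> rcpathT) :
  (forall t, 0 < t -> measurable_fun setT (fun w => (f w : rcpath) t)) ->
  measurable_fun setT f.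
Proof.
move=> mf; apply: (@measurability _ _ T rcpathT setT f cylinders) => //.
move=> _ [_ [t [B [mB ->]]] <-]; rewrite setTI.
have [t0|t0] := leP t 0.
  rewrite (_ : _ @^-1` _ = [set _ | B 0]).
    by have [B0|B0] := pselect (B 0);
      [rewrite (_ : mkset _ = setT)|rewrite (_ : mkset _ = set0)] => //;
      apply/seteqP; split.
  by apply/seteqP; split => w /=; rewrite rcpath_le0.
by have := mf t t0 measurableT B mB; rewrite setTI.
Qed.

(** By right-continuity the evaluation is a pointwise limit of evaluations at grid times, which are
    jointly measurable. *)
Lemma measurable_rcpath_evalP :
  measurable_fun setT (fun z : rcpathT * R => (z.1 : rcpath) z.2).
Proof.
pose h n : R := 2^-1 ^+ n.
have h0 n : 0 < h n by rewrite exprn_gt0// invr_gt0.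
have hcvg : h @ \oo --> 0.
  by apply: cvg_expr; rewrite gtr0_norm// invf_lt1 ?ltr1n.
(* Convergence along the grid is available for nonnegative times; clipping at 0 changes nothing,
   since paths vanish on negative times. *)
apply: (@measurable_fun_cvg _ _ _ _ (fun n (z : rcpathT * R) =>
  (z.1 : rcpath) (gridup (h n) (Num.max z.2 0)))).
- move=> n.
  have m1 : measurable_fun setT (fun z : rcpathT * R => (z.1, Num.max z.2 0)).
    apply/measurable_fun_pairP; split; first exact: measurable_fst.
    by apply: measurable_maxr => //; exact: measurable_snd.
  have m2 := @measurable_gridup_comp _ _ rcpathT (fun p t => (p : rcpath) t) (h n)
     (h0 n) measurable_rcpath_eval.
  exact: (measurableT_comp m2 m1).
- move=> [p t] _; rewrite /=; have [t0|t0] := leP 0 t.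
  + apply: cvg_gridup => //; exact: rcpath_rc.
  + rewrite (rcpath_le0 _ (ltW t0)) -[X in _ --> X](rcpath_le0 p (lexx 0)).
    apply: cvg_gridup => //; exact: rcpath_rc.
Qed.

End path_space.
Arguments rcpath : clear implicits.
Arguments rcpathT : clear implicits.

Lemma integral_probability_cst d (T : measurableType d) (R : realType)
    (mu : probability T R) (c : \bar R) : (\int[mu]_x c = c)%E.
Proof. by rewrite integral_cst//= probability_setT mule1. Qed.

Lemma pushforward_measure_ex d d' (T : measurableType d) (U : measurableType d')
    (R : realType) (m : {measure set T -> \bar R}) (f : T -> U) :
  measurable_fun setT f ->
  exists nu : {measure set U -> \bar R}, forall A, nu A = m (f @^-1` A).
Proof.
by move=> mf; unshelve eexists (pushforward m f : {measure set U -> \bar R}).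
Qed.

(** * Concatenation of paths and the Markov property *)

Section markov.
Context {R : realType}.
Local Notation path := (rcpath R).
Local Notation pathT := (rcpathT R).
Implicit Types (s t h : R).

Lemma rcpath_cat_rc s (p q : path) t :
  (fun t => p (Num.min t s) + q (t - Num.max s 0)) u @[u --> t^'+] -->
  p (Num.min t s) + q (t - Num.max s 0).
Proof.
apply: cvgD.
- have [ts|st] := ltP t s.
  + apply: cvg_trans (@rcpath_rc _ p t); apply: near_eq_cvg.
    by near=> u; rewrite min_l//; apply/ltW; near: u; exact: nbhs_right_lt.
  + apply: cvg_near_cst; near=> u; rewrite min_r//.
    by rewrite (le_trans st)//; near: u; exact: nbhs_right_ge.
- set c := Num.max s 0; have qc := @rcpath_rc _ q (t - c).
  apply: cvg_comp qc => A [/= e e0 eA]; exists e => //= u tu ltu.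
  apply: eA; last by rewrite ltrD2r.
  by move: tu; rewrite /= opprB addrA subrK.
Unshelve. all: end_near. Qed.

Lemma rcpath_cat_le0 s (p q : path) t : t <= 0 ->
  p (Num.min t s) + q (t - Num.max s 0) = 0.
Proof.
move=> t0; rewrite !rcpath_le0 ?addr0//; last by rewrite ge_min t0.
by rewrite subr_le0 le_max t0 orbT.
Qed.

(** Follow p until s, then append q. The [Num.max s 0] keeps this a path for negative s, where it
    reduces to q. *)
Definition rcpath_cat s (p q : path) : pathT :=
  RCPath (@rcpath_cat_rc s p q) (@rcpath_cat_le0 s p q).

Lemma rcpath_catE s (p q : path) t : 0 <= s ->
  (rcpath_cat s p q : path) t = p (Num.min t s) + q (t - s).
Proof. by move=> s0 /=; rewrite (max_l s0). Qed.

Lemma rcpath_cat_lt s (p q : path) t : 0 <= s -> t <= s ->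
  (rcpath_cat s p q : path) t = p t.
Proof.
by move=> s0 ts; rewrite rcpath_catE// min_l// [q _]rcpath_le0 ?addr0// subr_le0.
Qed.

Lemma rcpath_cat_gt s (p q : path) t : 0 <= s -> 0 <= t ->
  (rcpath_cat s p q : path) (s + t) = p s + q t.
Proof. by move=> s0 t0; rewrite rcpath_catE// min_r ?lerDl// addrAC subrr add0r. Qed.

Lemma measurable_rcpath_cat s :
  measurable_fun setT (fun z : pathT * pathT => rcpath_cat s z.1 z.2).
Proof.
apply: measurable_to_rcpath => t _ /=; apply: measurable_funD.
- by apply: (measurableT_comp (measurable_rcpath_eval _)); exact: measurable_fst.
- by apply: (measurableT_comp (measurable_rcpath_eval _)); exact: measurable_snd.
Qed.

(** The identity map is measurable from the sigma-algebra generated by C as soon as all evaluations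
    at positive times are. *)
Lemma measurable_sub_rcpath (C : set (set path)) :
  (forall t, 0 < t -> measurable_fun (setT : set (g_sigma_algebraType C))
    (fun p : path => p t)) ->
  forall A : set pathT, measurable A -> <<s C >> A.
Proof.
move=> mC A mA.
have := @measurable_to_rcpath _ _ (g_sigma_algebraType C) (fun p => p) mC
  measurableT A mA.
by rewrite setTI.
Qed.

Definition incr_box h (N : nat) (B : nat -> set R) : set path :=
  [set p | forall i, (i < N)%N -> B i (p (i.+1%:R * h) - p (i%:R * h))].

Lemma incr_boxE h N B :
  incr_box h N B = \bigcap_(i in `I_N)
    (fun p : path => p (i.+1%:R * h) - p (i%:R * h)) @^-1` B i.
Proof. by []. Qed.

Lemma measurable_incr_box h N B : (forall i, measurable (B i)) ->
  measurable (incr_box h N B : set pathT).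
Proof.
move=> mB; rewrite incr_boxE; apply: bigcap_measurableType => i _.
rewrite -[X in measurable X]setTI; apply: (measurable_funB _ _ measurableT) => //;
exact: measurable_rcpath_eval.
Qed.

(** Constraining at least m increments, possibly by [setT], makes it possible to cut every box at
    time m h. *)
Definition incr_boxes h m : set (set path) :=
  [set A | exists k B, (forall i : nat, measurable (B i)) /\
     A = incr_box h (m + k) B].

Lemma incr_boxes_sub h m : incr_boxes h m `<=` (measurable : set (set pathT)).
Proof. by move=> _ [k [B [mB ->]]]; exact: measurable_incr_box. Qed.

Lemma incr_boxes_setI h m : setI_closed (incr_boxes h m).
Proof.
move=> _ _ [k [B [mB ->]]] [l [D [mD ->]]].
(* Past its own length a box imposes no condition, hence the two implications. *)
exists (maxn k l), (fun i => [set x | ((i < m + k)%N -> B i x) /\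
  ((i < m + l)%N -> D i x)]).
split.
  move=> i; case: ltnP => _; case: ltnP => _.
  - rewrite (_ : mkset _ = B i `&` D i); first exact: measurableI.
    by apply/seteqP; split => x /= [Bx Dx]; split; auto.
  - rewrite (_ : mkset _ = B i) //.
    by apply/seteqP; split => x /= => [[Bx Dx]|]; [auto|split].
  - rewrite (_ : mkset _ = D i) //.
    by apply/seteqP; split => x /= => [[Bx Dx]|]; [auto|split].
  - rewrite (_ : mkset _ = setT) //.
    by apply/seteqP; split => x /=.
apply/seteqP; split => p /= => [[pB pD] i ilt|pBD].
  by split => iN; [exact: pB|exact: pD].
split => i iN; have iM : (i < m + maxn k l)%N.
- by rewrite (leq_trans iN)// leq_add2l leq_maxl.
- exact: (pBD i iM).1.
- by rewrite (leq_trans iN)// leq_add2l leq_maxr.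
- exact: (pBD i iM).2.
Qed.

Lemma incr_boxes_eval h m i :
  measurable_fun (setT : set (g_sigma_algebraType (incr_boxes h m)))
    (fun p : path => p (i%:R * h)).
Proof.
elim: i => [|i ih].
  under eq_fun do rewrite mul0r rcpath_le0//; exact: measurable_cst.
rewrite (_ : (fun _ => _) = (fun p : path => p (i%:R * h) +
    (p (i.+1%:R * h) - p (i%:R * h)))); last first.
  by apply/funext => p; rewrite addrC subrK.
apply: measurable_funD => // _ B mB; rewrite setTI.
apply: sub_sigma_algebra; exists i.+1, (fun j => if j == i then B else setT).
split; first by move=> j; case: ifP.
apply/seteqP; split => p /=.
- by move=> Bp j _; case: eqP => [->|].
- by move=> /(_ i); rewrite eqxx addnS ltnS leq_addl; exact.
Qed.

Section uniqueness.
Variables (s : R) (s0 : 0 < s).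
(** Dyadic grids built from s: each refines the preceding one and has s as its point of index
    [m n]. *)
Let h n := s * 2^-1 ^+ n.
Let m n := (2 ^ n)%N.

Let h0 n : 0 < h n. Proof. by rewrite mulr_gt0// exprn_gt0. Qed.

Let hcvg : h @ \oo --> 0.
Proof.
rewrite -(mulr0 s); apply: cvgM; [exact: cvg_cst|apply: cvg_expr].
by rewrite gtr0_norm// invf_lt1 ?ltr1n.
Qed.

Let U := [set A | exists n, <<s incr_boxes (h n) (m n) >> A].

Let nested n k : <<s incr_boxes (h n) (m n) >> `<=`
  <<s incr_boxes (h (n + k)) (m (n + k)) >>.
Proof.
apply: smallest_sub; first exact: smallest_sigma_algebra.
move=> _ [l [B [mB ->]]]; rewrite incr_boxE.
set C := incr_boxes (h (n + k)) _.
have mp i : measurable_fun (setT : set (g_sigma_algebraType C))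
    (fun p : path => p (i%:R * h n)).
  have -> : i%:R * h n = (i * 2 ^ k)%:R * h (n + k).
    have k0 : (2 : R) ^+ k * 2^-1 ^+ k = 1 by rewrite -exprMn divff// expr1n.
    by rewrite /h exprD natrM natrX -[LHS]mulr1 -[X in _ * X = _]k0; ring.
  exact: incr_boxes_eval.
apply: (@bigcap_measurableType _ (g_sigma_algebraType C)) => i _.
have := measurable_funB (mp i.+1) (mp i) measurableT (mB i).
by rewrite setTI.
Qed.

(** Two pi-systems are stacked. The boxes of one grid form the first; the sigma-algebras they
    generate increase under refinement, so their union [U] is again stable under intersection. [U]
    generates all cylinders because p t is the limit of the values of p at dyadic times to its
    right. *)
Lemma rcpath_measure_unique (mu nu : {measure set pathT -> \bar R}) :
  (mu setT < +oo)%E ->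
  (forall n k B, (forall i, measurable (B i)) ->
    mu (incr_box (h n) (m n + k) B) = nu (incr_box (h n) (m n + k) B)) ->
  forall A, measurable A -> mu A = nu A.
Proof.
move=> muT munu A mA.
have step n D : <<s incr_boxes (h n) (m n) >> D -> mu D = nu D.
  apply: (@g_sigma_algebra_measure_unique _ R pathT (incr_boxes (h n) (m n))
    (@incr_boxes_sub _ _) (fun=> setT)) => //.
  - move=> _; exists 0%N, (fun=> setT); split => //.
    by apply/seteqP; split.
  - by rewrite bigcup_const.
  - exact: incr_boxes_setI.
  - by move=> _ [k [B [mB ->]]]; exact: munu.
have Um : U `<=` (measurable : set (set pathT)).
  move=> D [n]; apply: (smallest_sub (@sigma_algebra_measurable _ pathT)).
  exact: incr_boxes_sub.
apply: (@g_sigma_algebra_measure_unique _ R pathT U Um (fun=> setT)) => //.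
- by move=> _; exists 0%N; exact: (@measurableT _ (g_sigma_algebraType _)).
- by rewrite bigcup_const.
- move=> D1 D2 [n1 D1n] [n2 D2n]; exists (n1 + n2)%N.
  apply: (@measurableI _ (g_sigma_algebraType _)); first exact: nested.
  by rewrite addnC; exact: nested.
- by move=> D [n]; exact: step.
apply: measurable_sub_rcpath mA => t t0.
apply: (@measurable_fun_cvg _ (g_sigma_algebraType U) R setT
  (fun n (p : path) => p (gridup (h n) t))).
- move=> n _ B mB; rewrite setTI; apply: sub_sigma_algebra; exists n.
  by have := @incr_boxes_eval (h n) (m n) (Num.truncn (t / h n)).+1 measurableT B mB;
    rewrite setTI.
- by move=> p _; apply: cvg_gridup => //; [exact: ltW|exact: rcpath_rc].
Qed.

End uniqueness.

(* Independence and stationarity of the increments along every regular grid. *)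
Definition sii (mu : set pathT -> \bar R) := forall h, 0 < h -> forall N B,
  (forall i : nat, measurable (B i)) ->
  mu (incr_box h N B) = (\prod_(i < N) mu [set p | B i ((p : path) h)])%E.

(** Along a grid that contains s, an increment box is the product of a box before s and a box after
    s. Under both measures its mass is the same product of one-step probabilities. *)
Lemma markov_of_sii (mu : probability pathT R) s : sii mu -> 0 < s ->
  forall A, measurable A ->
  mu A = (mu \x mu)%E ((fun z => rcpath_cat s z.1 z.2) @^-1` A).
Proof.
move=> smu s0 A mA.
pose c (z : pathT * pathT) := rcpath_cat s z.1 z.2.
have mc : measurable_fun setT c := measurable_rcpath_cat s.
have [nu nuE] := pushforward_measure_ex (mu \x mu)%E mc.
rewrite -[RHS]/((mu \x mu)%E (c @^-1` A)).
rewrite -nuE; apply: (@rcpath_measure_unique s s0 mu nu) => //.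
  by rewrite (le_lt_trans (probability_le1 mu measurableT))// ltry.
move=> n k B mB; pose h := s * 2^-1 ^+ n; pose m := (2 ^ n)%N.
rewrite -[LHS]/(mu (incr_box h (m + k) B)) -[RHS]/(nu (incr_box h (m + k) B)).
have h0 : 0 < h by rewrite mulr_gt0// exprn_gt0.
have mh : m%:R * h = s.
  by rewrite /m /h natrX mulrCA -exprMn divff// expr1n mulr1.
rewrite nuE; apply: (eq_trans (smu h h0 _ _ mB)).
rewrite (_ : _ @^-1` _ = incr_box h m B `*` incr_box h k (fun i => B (m + i)%N)).
  have E := product_measure1E mu mu (measurable_incr_box h m mB)
    (measurable_incr_box h k (fun i => mB (m + i)%N)).
  apply: (eq_trans _ (esym E)).
  rewrite big_split_ord/=; congr (_ * _)%E; first exact/esym/(smu h h0 _ _ mB).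
  exact/esym/(smu h h0 _ _ (fun i => mB (m + i)%N)).
have E1 i (p q : path) : (i <= m)%N ->
    (rcpath_cat s p q : path) (i%:R * h) = p (i%:R * h).
  by move=> im; apply: rcpath_cat_lt; rewrite ?(ltW s0)// -[leRHS]mh ler_pM2r// ler_nat.
have E2 i (p q : path) :
    (rcpath_cat s p q : path) ((m + i)%:R * h) = p s + q (i%:R * h).
  by rewrite natrD mulrDl mh rcpath_cat_gt// ?(ltW s0)// mulr_ge0 ?ler0n// ltW.
apply/seteqP; split => [[p q] /= pq|[p q] /= [pB qB] i im].
- split => i im.
  + by have := pq i; rewrite !E1 ?(ltnW im)//; apply; rewrite (leq_trans im)// leq_addr.
  + have := pq (m + i)%N; rewrite -addnS !E2 leq_add2l => /(_ im).
    by rewrite opprD addrACA subrr add0r.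
- have [im'|mi] := ltnP i m; first by rewrite !E1 ?(ltnW im')//; exact: pB.
  have ik : (i - m < k)%N by rewrite ltn_subLR.
  have ei : i = (m + (i - m))%N by rewrite subnKC.
  have := qB _ ik; move: ei; move: (i - m)%N => j ->.
  by rewrite -addnS !E2 opprD addrACA subrr add0r.
Qed.

Lemma markov_integral (mu : probability pathT R) s (F : pathT -> \bar R) :
  sii mu -> 0 <= s -> measurable_fun setT F -> (forall p, (0 <= F p)%E) ->
  (\int[mu]_p F p = \int[mu]_p \int[mu]_q F (rcpath_cat s p q))%E.
Proof.
move=> smu; rewrite le_eqVlt => /predU1P[<-|s0] mF F0.
  (* Concatenation at time 0 returns q, so the outer integral is that of a constant. *)
  rewrite [RHS](_ : _ = \int[mu]_p (\int[mu]_q F q))%E; last first.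
    apply: eq_integral => p _; apply: eq_integral => q _; congr F.
    apply: rcpathP => t t0; rewrite rcpath_catE// min_r ?ltW// rcpath_le0// add0r.
    by rewrite subr0.
  by rewrite integral_probability_cst.
pose c (z : pathT * pathT) := rcpath_cat s z.1 z.2.
have mc : measurable_fun setT c := measurable_rcpath_cat s.
rewrite -[RHS](@fubini_tonelli1 _ _ _ _ _ mu mu (fun z => F (c z)))//; last first.
  by apply: measurableT_comp => //; exact: measurable_rcpath_cat.
rewrite [LHS](@eq_measure_integral _ _ _ _ (pushforward (mu \x mu)%E c)).
  by rewrite ge0_integral_pushforward//; exact: measurable_rcpath_cat.
by move=> A mA _; apply: markov_of_sii.
Qed.

End markov.

(** * The law of the Levy process on path space *)

Section levy_path_law.
Context {R : realType} {d : measure_display} {T : measurableType d}.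
Local Notation path := (rcpath R).
Local Notation pathT := (rcpathT R).

Lemma levy_path_law (P : probability T R) (X : R -> T -> R) (Ps : R -> R) :
  levy_process P X Ps ->
  exists (phi : T -> pathT) (mu : probability pathT R),
  [/\ measurable_fun setT phi,
      forall w t, 0 <= t -> (phi w : path) t = X t w,
      forall F : pathT -> \bar R, measurable_fun setT F -> (forall p, (0 <= F p)%E) ->
        (\int[P]_w F (phi w) = \int[mu]_p F p)%E,
      sii mu &
      forall l, 0 <= l ->
        (\int[mu]_p (expR (- (l * (p : path) 1)))%:E = (expR (Ps l))%:E)%E].
Proof.
move=> [mX [X0 [Xrc [_ [Xstat [Xind XL]]]]]].
(* The path hypotheses concern times t >= 0; before 0 the process is frozen at its initial value
   0. *)
have prc w t : (fun t => X (Num.max t 0) w) s @[s --> t^'+] --> X (Num.max t 0) w.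
  have [t0|t0] := ltP t 0.
    apply: cvg_near_cst; near=> s; rewrite max_r//; apply/ltW.
    near: s; exact: nbhs_right_lt.
  apply: cvg_trans (Xrc w t t0); apply: near_eq_cvg.
  by near=> s; rewrite max_l// (le_trans t0)//; near: s; exact: nbhs_right_ge.
have p0 w t : t <= 0 -> X (Num.max t 0) w = 0 by move=> t0; rewrite max_r// X0.
pose phi w : pathT := RCPath (prc w) (p0 w).
have phiE w t : 0 <= t -> (phi w : path) t = X t w by move=> t0 /=; rewrite max_l.
have mphi : measurable_fun setT phi by apply: measurable_to_rcpath => t _; exact: mX.
pose phim : {mfun T >-> pathT} := HB.pack phi (isMeasurableFun.Build _ _ _ _ phi mphi).
exists phi, (distribution P phim); split => //.
- by move=> F mF F0; rewrite ge0_integral_distribution.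
- move=> h h0 N B mB.
  have t0 i : 0 <= i%:R * h by rewrite mulr_ge0// ltW.
  have := Xind N (fun i => i%:R * h) B (t0 0%N) _ mB.
  have lt i : i%:R * h < i.+1%:R * h by rewrite ltr_pM2r// ltr_nat.
  move=> /(_ lt) E.
  transitivity (P (\bigcap_(i in `I_N) (incr X (i%:R * h) (i.+1%:R * h) @^-1` B i))).
    congr (P _); rewrite incr_boxE; apply/seteqP; split => w /= wB i iN;
      by have := wB i iN; rewrite /= !max_l.
  rewrite E; apply: eq_bigr => i _.
  rewrite -[LHS]/(P ((fun w => X (i.+1%:R * h) w - X (i%:R * h) w) @^-1` B i)).
  rewrite -natr1 mulrDl mul1r Xstat ?t0// 1?ltW//.
  by congr (P _); apply/seteqP; split => w /=; rewrite max_l// ltW.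
- move=> l l0; rewrite -(XL l l0) ge0_integral_distribution//.
  + by apply: eq_integral => w _ /=; rewrite max_l.
  + apply/measurable_EFinP; apply: measurableT_comp => //.
    by apply: measurableT_comp => //; apply: measurable_funM => //;
      exact: measurable_rcpath_eval.
Unshelve. all: end_near. Qed.

End levy_path_law.

(** * The path on a grid, killed at its first negative grid value *)

Section skeleton.
Context {R : realType}.
Local Notation path := (rcpath R).
Local Notation pathT := (rcpathT R).
Implicit Types (y h l t : R) (p : R -> R).

Fixpoint galive y h p (k : nat) : bool :=
  if k is k'.+1 then galive y h p k' && (0 <= y + p (k%:R * h)) else 0 <= y.

Lemma galive_ge0 y h p k : p 0 = 0 -> galive y h p k -> 0 <= y + p (k%:R * h).
Proof. by move=> p0; case: k => [|k] /=; [rewrite mul0r p0 addr0|case/andP]. Qed.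

Lemma galive_le y h p k j : (j <= k)%N -> galive y h p k -> galive y h p j.
Proof.
elim: k => [|k ih]; first by rewrite leqn0 => /eqP ->.
by rewrite leq_eqVlt ltnS => /predU1P[->//|/ih {}ih] /= /andP[/ih].
Qed.

Lemma galiveP y h p k : p 0 = 0 ->
  (galive y h p k <-> forall i, (i <= k)%N -> 0 <= y + p (i%:R * h)).
Proof.
move=> p0; split=> [pk i ik|]; first by apply: galive_ge0 => //; exact: galive_le pk.
elim: k => [/(_ 0%N isT)|k ih H] /=; first by rewrite mul0r p0 addr0.
by rewrite H// andbT; apply: ih => i ik; apply: H; exact: leqW.
Qed.

Lemma eq_galive y h p q k :
  (forall i, (i <= k)%N -> p (i%:R * h) = q (i%:R * h)) ->
  galive y h p k = galive y h q k.
Proof.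
elim: k => //= k ih pq; rewrite pq//; congr (_ && _).
by apply: ih => i ik; apply: pq; exact: leqW.
Qed.

Lemma measurable_galive y h k :
  measurable_fun setT (fun p : pathT => galive y h (p : path) k).
Proof.
elim: k => [|k ih] /=; first exact: measurable_cst.
apply: measurable_and => //; apply: measurable_fun_ler => //.
by apply: measurable_funD => //; exact: measurable_rcpath_eval.
Qed.

(** Two indices, because the recursion looks at the position at step k + 1 while survival is tested
    only up to step k. *)
Definition galive_exp y h l k i (p : pathT) : R :=
  (galive y h (p : path) k)%:R * expR (- (l * (y + (p : path) (i%:R * h)))).

Lemma galive_exp_ge0 y h l k i (p : pathT) : 0 <= galive_exp y h l k i p.
Proof. by rewrite /galive_exp mulr_ge0 ?expR_ge0. Qed.

Lemma galive_exp_le1 y h l k (p : pathT) : 0 <= l -> galive_exp y h l k k p <= 1.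
Proof.
move=> l0; rewrite /galive_exp; case: (boolP (galive _ _ _ _)) => [pk|_]; last first.
  by rewrite mul0r.
rewrite mul1r -[leRHS]expR0 ler_expR oppr_le0 mulr_ge0//.
exact: (galive_ge0 (rcpath_le0 p (lexx 0)) pk).
Qed.

Lemma galive_exp0 y h k i (p : pathT) :
  galive_exp y h 0 k i p = (galive y h (p : path) k)%:R.
Proof. by rewrite /galive_exp mul0r oppr0 expR0 mulr1. Qed.

Lemma measurable_galive_exp y h l k i :
  measurable_fun setT (galive_exp y h l k i).
Proof.
apply: measurable_funM.
  apply: (@measurableT_comp _ _ _ _ _ _ (fun b : bool => b%:R : R)) => //.
  exact: measurable_galive.
apply: measurableT_comp => //; apply: measurableT_comp => //.
apply: measurable_funM => //; apply: measurable_funD => //.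
exact: measurable_rcpath_eval.
Qed.

Variables (mu : probability pathT R) (smu : sii mu).

(** For l = 0 this is the probability of surviving k steps; its decrease measures the mass killed at
    each step. *)
Definition ralive y h l k : R := fine (\int[mu]_p (galive_exp y h l k k p)%:E)%E.

Lemma raliveE y h l k : 0 <= l ->
  (\int[mu]_p (galive_exp y h l k k p)%:E = (ralive y h l k)%:E)%E.
Proof.
move=> l0; rewrite fineK// ge0_fin_numE; last first.
  by apply: integral_ge0 => p _; rewrite lee_fin galive_exp_ge0.
apply: (@le_lt_trans _ _ (\int[mu]_p 1)%E); last first.
  by rewrite integral_probability_cst ltry.
apply: ge0_le_integral => //.
- by move=> p _; rewrite lee_fin galive_exp_ge0.
- by apply/measurable_EFinP; exact: measurable_galive_exp.
- by move=> p _; rewrite lee_fin galive_exp_le1.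
Qed.

Lemma ralive_ge0 y h l k : 0 <= ralive y h l k.
Proof.
by apply: fine_ge0; apply: integral_ge0 => p _; rewrite lee_fin galive_exp_ge0.
Qed.

Lemma ralive_le y h l k : 0 <= l -> ralive y h l k <= ralive y h 0 k.
Proof.
move=> l0; rewrite -lee_fin -!raliveE//; apply: ge0_le_integral => //.
- by move=> p _; rewrite lee_fin galive_exp_ge0.
- by apply/measurable_EFinP; exact: measurable_galive_exp.
- by apply/measurable_EFinP; exact: measurable_galive_exp.
move=> p _; rewrite lee_fin galive_exp0.
have := galive_exp_le1 y h k p l0.
by rewrite /galive_exp; case: (galive _ _ _ _) => //; rewrite !mul0r.
Qed.

Lemma ralive_decr y h k : ralive y h 0 k.+1 <= ralive y h 0 k.
Proof.
rewrite -lee_fin -!raliveE//; apply: ge0_le_integral => //.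
- by move=> p _; rewrite lee_fin galive_exp_ge0.
- by apply/measurable_EFinP; exact: measurable_galive_exp.
- by apply/measurable_EFinP; exact: measurable_galive_exp.
move=> p _; rewrite lee_fin !galive_exp0/=.
by case: (galive _ _ _ _) => //=; rewrite lern1 leq_b1.
Qed.

Lemma ralive0 y h l : 0 <= y -> ralive y h l 0 = expR (- (l * y)).
Proof.
move=> y0; rewrite /ralive (eq_integral (fun=> (expR (- (l * y)))%:E)).
  by rewrite integral_probability_cst.
by move=> p _; rewrite /galive_exp /= y0 mul1r mul0r rcpath_le0 ?addr0.
Qed.

Lemma ralive_le1 y h k : 0 <= y -> ralive y h 0 k <= 1.
Proof.
move=> y0; elim: k => [|k ih]; last exact: le_trans (ralive_decr _ _ _) ih.
by rewrite ralive0// mul0r oppr0 expR0.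
Qed.

Variables (psi : R -> R).

Definition laplace_at t :=
  forall l, 0 <= l ->
    (\int[mu]_p (expR (- (l * (p : path) t)))%:E = (expR (t * psi l))%:E)%E.

(** Markov property at time k h: the last increment is independent of survival up to step k and
    contributes the factor [expR (h * psi l)]. *)
Lemma galive_exp_step y h l k : 0 < h -> 0 <= l -> laplace_at h ->
  (\int[mu]_p (galive_exp y h l k k.+1 p)%:E =
   (expR (h * psi l) * ralive y h l k)%:E)%E.
Proof.
move=> h0 l0 lap; have kh0 : 0 <= k%:R * h by rewrite mulr_ge0// ltW.
rewrite (markov_integral smu kh0); first last.
- by move=> p; rewrite lee_fin galive_exp_ge0.
- by apply/measurable_EFinP; exact: measurable_galive_exp.
under eq_integral => p _.
  under eq_integral => q _.
    rewrite (_ : galive_exp _ _ _ _ _ _ =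
      galive_exp y h l k k p * expR (- (l * (q : path) h))); last first.
      rewrite /galive_exp (@eq_galive y h _ p k); last first.
        by move=> i ik; apply: rcpath_cat_lt => //; rewrite ler_pM2r// ler_nat.
      rewrite -mulrA -expRD -natr1 mulrDl mul1r rcpath_cat_gt ?(ltW h0)//.
      by congr (_ * expR _); ring.
    rewrite EFinM; over.
  rewrite ge0_integralZl//; first last.
  - by rewrite lee_fin galive_exp_ge0.
  - apply/measurable_EFinP; apply: measurableT_comp => //.
    by apply: measurableT_comp => //; apply: measurable_funM => //;
      exact: measurable_rcpath_eval.
  rewrite lap// muleC; over.
rewrite ge0_integralZl//.
- by rewrite raliveE.
- by apply/measurable_EFinP; exact: measurable_galive_exp.
- by move=> p _; rewrite lee_fin galive_exp_ge0.
Qed.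

(** On paths killed exactly at step k + 1 the position is negative, so their weight is at least 1.
    This pays for the drop in survival probability. *)
Lemma skeleton_step_lower y h l k : 0 < h -> 0 <= l -> laplace_at h ->
  ralive y h l k.+1 + ralive y h 0 k <=
  expR (h * psi l) * ralive y h l k + ralive y h 0 k.+1.
Proof.
move=> h0 l0 lap; rewrite -lee_fin [leLHS]EFinD [leRHS]EFinD.
rewrite -(galive_exp_step y k h0 l0 lap) -!raliveE//.
rewrite -!ge0_integralD//; do ?[by move=> p _; rewrite lee_fin galive_exp_ge0
  |by apply/measurable_EFinP; exact: measurable_galive_exp].
apply: ge0_le_integral => //.
- by move=> p _; rewrite -EFinD lee_fin addr_ge0 ?galive_exp_ge0.
- by apply: emeasurable_funD; apply/measurable_EFinP; exact: measurable_galive_exp.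
- by apply: emeasurable_funD; apply/measurable_EFinP; exact: measurable_galive_exp.
move=> p _; rewrite -!EFinD lee_fin !galive_exp0 /galive_exp [galive _ _ _ k.+1]/=.
case: (galive y h _ k) => /=; last by rewrite !mul0r.
case: (leP 0 (y + _)) => [z0|z0]; first by rewrite lexx.
by rewrite mul0r add0r addr0 mul1r -[leLHS]expR0 ler_expR oppr_ge0 mulr_ge0_le0// ltW.
Qed.

(** Split at z = - e: above it the weight is at most [expR (l * e)], below it the larger exponent l'
    dominates with the gain [expR (- ((l' - l) * e))]. *)
Lemma expR_overshoot (l l' e z : R) : 0 <= l -> l <= l' -> 0 <= e ->
  expR (- (l * z)) <= expR (l * e) + expR (- ((l' - l) * e)) * expR (- (l' * z)).
Proof.
move=> l0 ll e0; have [ze|ze] := leP (- e) z.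
  rewrite (@le_trans _ _ (expR (l * e)))//.
    by rewrite ler_expR -mulrN ler_wpM2l// lerNl.
  by rewrite lerDl mulr_ge0 ?expR_ge0.
rewrite -expRD (@le_trans _ _ (expR (- ((l' - l) * e) - l' * z)))//.
  rewrite ler_expR -subr_ge0.
  have -> : - ((l' - l) * e) - l' * z - - (l * z) = (l' - l) * (- e - z) by ring.
  by rewrite mulr_ge0 ?subr_ge0// ltW.
by rewrite lerDr expR_ge0.
Qed.

(* The overshoot below the barrier is controlled by a second exponent l'. *)
Lemma skeleton_step_upper y h l l' e k : 0 < h -> 0 <= y -> 0 <= l -> l <= l' -> 0 <= e ->
  laplace_at h ->
  expR (h * psi l) * ralive y h l k + expR (l * e) * ralive y h 0 k.+1 <=
  ralive y h l k.+1 + expR (l * e) * ralive y h 0 k +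
  expR (h * psi l' - (l' - l) * e).
Proof.
move=> h0 y0 l0 ll e0 lap; have l'0 := le_trans l0 ll.
(* The l'-moment is kept for the pathwise comparison; here it is bounded by 1, since surviving walks
   have nonnegative positions. *)
apply: (@le_trans _ _ (ralive y h l k.+1 + expR (l * e) * ralive y h 0 k +
  expR (- ((l' - l) * e)) * (expR (h * psi l') * ralive y h l' k))); last first.
  rewrite lerD2l mulrA -expRD [X in expR X * _]addrC ger_pMr ?expR_gt0//.
  by rewrite (le_trans (ralive_le _ _ _ l'0))// ralive_le1.
have mg a i j : measurable_fun setT (fun p : pathT => (galive_exp y h a i j p)%:E).
  by apply/measurable_EFinP; exact: measurable_galive_exp.
have g0 a i j (p : pathT) : (0 <= (galive_exp y h a i j p)%:E)%E.
  by rewrite lee_fin galive_exp_ge0.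
have mZ (c : R) a i j : measurable_fun setT (fun p : pathT => c%:E * (galive_exp y h a i j p)%:E)%E.
  by apply: emeasurable_funM.
have Z0 (c : R) a i j (p : pathT) : 0 <= c -> (0 <= c%:E * (galive_exp y h a i j p)%:E)%E.
  by move=> c0; rewrite mule_ge0// lee_fin.
rewrite -lee_fin EFinD (EFinM (expR (l * e)) (ralive y h 0 k.+1)).
rewrite [leRHS]EFinD [X in (_ <= X + _)%E]EFinD (EFinM (expR (l * e)) (ralive y h 0 k)).
rewrite (EFinM (expR (- ((l' - l) * e)))).
rewrite -(galive_exp_step y k h0 l0 lap) -(galive_exp_step y k h0 l'0 lap).
rewrite -!raliveE// -!ge0_integralZl ?lee_fin ?expR_ge0//.
rewrite -?ge0_integralD//; do ?[by move=> *; rewrite ?Z0 ?expR_ge0//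
  | by apply: emeasurable_funD | by move=> *; rewrite adde_ge0 ?Z0 ?expR_ge0].
apply: ge0_le_integral => //.
- by move=> p _; rewrite adde_ge0 ?Z0 ?expR_ge0.
- by apply: emeasurable_funD.
- by do 2 apply: emeasurable_funD => //.
move=> p _; rewrite -!EFinM -!EFinD lee_fin !galive_exp0 /galive_exp [galive _ _ _ k.+1]/=.
case: (galive y h _ k) => /=; last by rewrite !mul0r !mulr0 !addr0.
have := expR_overshoot (y + (p : path) (k.+1%:R * h)) l0 ll e0.
set E1 := expR (- (l * _)); set E2 := expR (- (l' * _)); move=> HE.
have E20 : 0 <= E2 by exact: expR_ge0.
case: (leP 0 (y + _)) => [z0|z0].
  by rewrite !mul1r !mulr1 lerDl mulr_ge0 ?expR_ge0.
by rewrite !mul1r mul0r mulr0 mulr1 addr0 add0r.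
Qed.

(** Summing the one-step bounds telescopes and leaves a sum over time with the factor
    [expR (h * psi l) - 1], close to [h * psi l]: up to that factor, a Riemann sum of the
    potential. *)
Lemma skeleton_lower y h l m : 0 < h -> 0 <= y -> 0 <= l -> laplace_at h ->
  ralive y h l m + (1 - ralive y h 0 m) <=
  expR (- (l * y)) + (expR (h * psi l) - 1) * \sum_(k < m) ralive y h l k.
Proof.
move=> h0 y0 l0 lap; elim: m => [|m ih].
  by rewrite big_ord0 mulr0 addr0 !ralive0// mul0r oppr0 expR0 subrr addr0.
have := skeleton_step_lower y m h0 l0 lap; rewrite big_ord_recr/=.
move: ih; move: (\sum_(_ < _) _) (ralive y h l m.+1) (ralive y h 0 m.+1) (ralive y h l m)
  (ralive y h 0 m) (expR (- (l * y))) (expR (h * psi l)) => S c1 a1 c0 a0 E0 E1 ? ?; lra.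
Qed.

Lemma skeleton_upper y h l l' e m : 0 < h -> 0 <= y -> 0 <= l -> l <= l' -> 0 <= e ->
  laplace_at h ->
  expR (- (l * y)) + (expR (h * psi l) - 1) * \sum_(k < m) ralive y h l k <=
  ralive y h l m + expR (l * e) * (1 - ralive y h 0 m) +
  m%:R * expR (h * psi l' - (l' - l) * e).
Proof.
move=> h0 y0 l0 ll e0 lap; elim: m => [|m ih].
  by rewrite big_ord0 mulr0 mul0r !addr0 !ralive0// mul0r oppr0 expR0 subrr mulr0 addr0.
have := skeleton_step_upper m h0 y0 l0 ll e0 lap; rewrite big_ord_recr/=.
move: ih; rewrite -natr1.
move: (\sum_(_ < _) _) (ralive y h l m.+1) (ralive y h 0 m.+1) (ralive y h l m)
  (ralive y h 0 m) (expR (- (l * y))) (expR (h * psi l)) (expR (l * e))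
  (expR (h * psi l' - _)) m%:R => S c1 a1 c0 a0 E0 E1 E2 E3 M ? ?; lra.
Qed.

(** A terminal value is controlled by every earlier one. Averaged over a unit of time, it is
    controlled by an increment of the potential. *)
Lemma ralive_tail y h l k j : 0 < h -> 0 <= l -> 0 <= psi l -> laplace_at h ->
  ralive y h l (k + j) <= expR (j%:R * h * psi l) * ralive y h l k.
Proof.
move=> h0 l0 psi0 lap; elim: j => [|j ih].
  by rewrite addn0 !mul0r expR0 mul1r.
have := skeleton_step_lower y (k + j) h0 l0 lap; have := ralive_decr y h (k + j).
rewrite addnS => ad H.
apply: (@le_trans _ _ (expR (h * psi l) * ralive y h l (k + j))).
  move: ad H; move: (ralive y h l (k + j).+1) (ralive y h 0 (k + j).+1) (ralive y h 0 (k + j)).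
  by move: (_ * _) => ? ? ? ?; clear; lra.
rewrite (_ : j.+1%:R * h * psi l = h * psi l + j%:R * h * psi l); last first.
  by rewrite -natr1; ring.
by rewrite expRD -mulrA ler_wpM2l ?expR_ge0.
Qed.

Lemma laplace_atD s t : 0 <= s -> 0 <= t -> forall l,
  (\int[mu]_p (expR (- (l * (p : path) (s + t))))%:E =
   (\int[mu]_p (expR (- (l * (p : path) s)))%:E) *
   (\int[mu]_p (expR (- (l * (p : path) t)))%:E))%E.
Proof.
move=> s0 t0 l.
have mE u : measurable_fun setT (fun p : pathT => (expR (- (l * (p : path) u)))%:E).
  apply/measurable_EFinP; apply: measurableT_comp => //.
  by apply: measurableT_comp => //; apply: measurable_funM => //;
      exact: measurable_rcpath_eval.
have E0 u (p : path) : (0 <= (expR (- (l * p u)))%:E)%E by rewrite lee_fin expR_ge0.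
rewrite (markov_integral smu s0) //.
under eq_integral => p _.
  under eq_integral => q _.
    rewrite rcpath_cat_gt// mulrDr opprD expRD EFinM; over.
  rewrite ge0_integralZl//; over.
rewrite ge0_integralZr//.
by apply: integral_ge0.
Qed.

(** The transform at time 1/m is an m-th root of the transform at time 1, and all meshes used later
    are of this form. *)
Lemma laplace_at_inv m : (0 < m)%N -> laplace_at 1 -> laplace_at m%:R^-1.
Proof.
move=> m0 lap l l0; have m0' : (0 : R) < m%:R by rewrite ltr0n.
set h := m%:R^-1; set e := (\int[mu]_p _)%E.
have h0 : 0 <= h by rewrite invr_ge0.
have e0 : (0 <= e)%E by apply: integral_ge0 => p _; rewrite lee_fin expR_ge0.
have eX k : (\int[mu]_p (expR (- (l * (p : path) (k%:R * h))))%:E = e ^+ k)%E.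
  elim: k => [|k ih].
    under eq_integral do rewrite mul0r rcpath_le0// mulr0 oppr0 expR0.
    by rewrite integral_probability_cst expe0.
  rewrite -natr1 mulrDl mul1r laplace_atD ?mulr_ge0// ih -/e muleC.
  by case: (k) => [|k']; rewrite ?expe0 ?mule1// expeS.
have hX : expR (h * psi l) ^+ m = expR (psi l).
  by rewrite -expRM_natl /h mulrA mulfV ?mul1r// gt_eqF.
have := eX m; rewrite /h divff ?gt_eqF// lap// mul1r.
case: e e0 {eX} => [r|_|//].
  rewrite lee_fin => r0; rewrite -EFin_expe => -[E]; congr EFin.
  apply/eqP; rewrite -(@eqrXn2 _ m _ _ m0 r0 (expR_ge0 _)).
  by rewrite -E -hX.
(* An infinite transform at time 1/m would make the one at time 1 infinite. *)
have yX n : ((+oo : \bar R) ^+ n.+1 = +oo)%E.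
  by elim: n => [|n ih]; rewrite expeS ?expe0 ?mule1// ih mulyy.
by case: m m0 {m0' h h0 hX} => // m _; rewrite yX.
Qed.

End skeleton.

Lemma bounded_cvg_integral d (T : measurableType d) (R : realType)
    (mu : {measure set T -> \bar R}) (D : set T) (f_ : (T -> R)^nat) (f : T -> R) (M : R) :
  measurable D -> (mu D < +oo)%E ->
  (forall n, measurable_fun D (f_ n)) -> measurable_fun D f ->
  (forall n x, D x -> `|f_ n x| <= M) ->
  {ae mu, forall x, D x -> f_ ^~ x @ \oo --> f x} ->
  (\int[mu]_(x in D) (f_ n x)%:E)%E @[n --> \oo] --> (\int[mu]_(x in D) (f x)%:E)%E.
Proof.
move=> mD muD mf_ mf fM ff.
have [] := @dominated_convergence _ _ _ mu D mD (fun n x => (f_ n x)%:E)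
  (fun x => (f x)%:E) (fun=> M%:E).
- by move=> n; exact/measurable_EFinP.
- exact/measurable_EFinP.
- apply: filterS ff => x fx Dx; apply: cvg_EFin; [exact: nearW|exact: fx].
- apply/integrableP; split; first exact/measurable_EFinP.
  by rewrite /= integral_cst// lte_mul_pinfty.
- by apply/aeW => x n Dx; rewrite /= lee_fin fM.
- by [].
Qed.

Lemma integral_step (R : realType) (h : R) (F : nat -> R) (m : nat) :
  0 < h -> (forall k, 0 <= F k) ->
  (\int[@lebesgue_measure R]_(t in `[0%R, (m%:R * h)%R[) (F (Num.truncn (t / h)))%:E =
   (h * \sum_(k < m) F k)%:E)%E.
Proof.
move=> h0 F0.
have mF (D : set R) : measurable_fun D (fun t : R => (F (Num.truncn (t / h)))%:E).
  apply/measurable_EFinP; apply: measurable_funTS => _ B mB; rewrite setTI.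
  rewrite (_ : _ @^-1` B = \bigcup_(k in [set k | B (F k)])
      [set t | Num.truncn (t / h) = k]).
    by apply: bigcup_measurable => k _; exact: measurable_truncn_div_eq.
  apply/seteqP; split => [t /= BF|t [k /= BF tk]]; first by exists (Num.truncn (t / h)).
  by rewrite tk.
elim: m => [|m ih].
  by rewrite mul0r set_itvco0 integral_set0 big_ord0 mulr0.
have mh : 0 <= m%:R * h by rewrite mulr_ge0// ltW.
have lt : m%:R * h < m.+1%:R * h by rewrite ltr_pM2r// ltr_nat.
have U : `[0, (m.+1%:R * h)[%classic = `[0, (m%:R * h)[%classic `|`
    `[(m%:R * h), (m.+1%:R * h)[%classic :> set R.
  by rewrite -itv_bndbnd_setU// bnd_simp// ltW.
rewrite U ge0_integral_setU//; first last.
- apply/disj_setPS => t [] /=; rewrite !in_itv/= => /andP[_ a] /andP[b _].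
  by move: (lt_le_trans a b); rewrite ltxx.
- by move=> t _; rewrite lee_fin.
- exact: mF.
rewrite ih (eq_integral (fun=> (F m)%:E)); last first.
  move=> t; rewrite inE/= in_itv/= => /andP[a b].
  by rewrite (@truncn_def _ _ m)// ler_pdivlMr// a ltr_pdivrMr.
rewrite integral_cst//= lebesgue_measure_itv/= lte_fin lt -!EFinB -EFinM -EFinD.
by rewrite big_ord_recr/= -natr1; congr EFin; ring.
Qed.

(** * Survival in continuous time *)

Section continuous_time.
Context {R : realType}.
Local Notation path := (rcpath R).
Local Notation pathT := (rcpathT R).
Local Notation leb := (@lebesgue_measure R).
Implicit Types (y h l t : R).

(** Negative times count as dead, so integrals over the whole line see only t >= 0. *)
Definition calive y (p : R -> R) t : bool :=
  `[< 0 <= t /\ forall q, 0 <= q -> q <= t -> 0 <= y + p q >].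

Lemma caliveP y p t :
  reflect (0 <= t /\ forall q, 0 <= q -> q <= t -> 0 <= y + p q) (calive y p t).
Proof. exact: asboolP. Qed.

Lemma calive_le y p s t : 0 <= s -> s <= t -> calive y p t -> calive y p s.
Proof.
move=> s0 st /caliveP[_ H]; apply/caliveP; split => // q q0 qs.
by apply: H => //; exact: le_trans st.
Qed.

Lemma calive_ge0 y p t : calive y p t -> 0 <= y + p t.
Proof. by move=> /caliveP[t0]; exact. Qed.

Lemma rcpath_neg_near y (p : path) q : y + p q < 0 ->
  exists2 e, 0 < e & forall u, q <= u -> u < q + e -> y + p u < 0.
Proof.
move=> neg; have : \forall u \near q^'+, p u < - y.
  by apply: (cvgr_lt (p q)); [exact: rcpath_rc|lra].
move=> [/= e e0 H]; exists e => // u; rewrite le_eqVlt => /predU1P[<-//|qu ue].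
have := H u; rewrite /ball_/= ltr0_norm ?subr_lt0// opprB => H'.
have : p u < - y by apply: H' => //; lra.
by lra.
Qed.

(** Right-continuity carries a negative value to a rational time just after it. The endpoint t is
    tested separately, since its right neighbourhood lies outside [0, t]. *)
Lemma calive_rat y (p : path) t : calive y p t <->
  [/\ 0 <= t, 0 <= y + p t & forall q : rat, 0 <= ratr q :> R -> ratr q < t ->
    0 <= y + p (ratr q)].
Proof.
split=> [/caliveP[t0 H]|[t0 pt H]].
  by split => // [|q q0 /ltW qt]; apply: H.
apply/caliveP; split => // q q0; rewrite le_eqVlt => /predU1P[->//|qt].
rewrite leNgt; apply/negP => /rcpath_neg_near[e e0 neg].
have [r] : exists r : rat, ratr r \in `]q, Num.min t (q + e)[.
  by apply: rat_in_itvoo; rewrite lt_min qt ltrDl.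
rewrite in_itv/= lt_min => /and3P[qr rt re].
have := H r (ltW (le_lt_trans q0 qr)) rt.
by rewrite leNgt neg// ltW.
Qed.

Lemma measurable_calive y :
  measurable_fun setT (fun z : pathT * R => calive y (z.1 : path) z.2).
Proof.
apply: (measurable_fun_bool true); rewrite setTI.
pose bad (q : rat) := [set z : pathT * R | (0 <= (ratr q : R)) && (ratr q < z.2)
  && (y + (z.1 : path) (ratr q) < 0)].
rewrite (_ : _ @^-1` _ = [set z : pathT * R | 0 <= z.2] `&`
    [set z : pathT * R | 0 <= y + (z.1 : path) z.2] `&` ~` (\bigcup_q bad q)).
  have mb (b : pathT * R -> bool) : measurable_fun setT b -> measurable [set z | b z].
    by move=> mb; rewrite -[X in measurable X]setTI; exact: (mb measurableT [set true]).
  apply: measurableI; first apply: measurableI.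
  - by apply: mb; apply: measurable_fun_ler => //; exact: measurable_snd.
  - apply: mb; apply: measurable_fun_ler => //; apply: measurable_funD => //.
    exact: measurable_rcpath_evalP.
  - apply: measurableC; apply: bigcupT_measurable_rat => q; apply: mb.
    apply: measurable_and; first apply: measurable_and => //.
      by apply: measurable_fun_ltr => //; exact: measurable_snd.
    apply: measurable_fun_ltr => //; apply: measurable_funD => //.
    apply: (measurableT_comp (measurable_rcpath_eval _)); exact: measurable_fst.
apply/seteqP; split => -[p t] /=.
- move=> /calive_rat[t0 pt H]; split => // -[q _ /= /andP[/andP[q0 qt]]].
  by rewrite ltNge H.
- move=> [[t0 pt] H]; apply/calive_rat; split => // q q0 qt.
  rewrite leNgt; apply/negP => neg; apply: H; exists q; first by [].
  by rewrite /bad /= q0 qt neg.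
Qed.

Definition calive_exp y l (p : R -> R) t : R :=
  (calive y p t)%:R * expR (- (l * (y + p t))).

Lemma calive_exp_ge0 y l (p : R -> R) t : 0 <= calive_exp y l p t.
Proof. by rewrite mulr_ge0 ?expR_ge0. Qed.

Lemma calive_exp_le1 y l (p : R -> R) t : 0 <= l -> calive_exp y l p t <= 1.
Proof.
move=> l0; rewrite /calive_exp; case: (boolP (calive _ _ _)) => [pt|_]; last first.
  by rewrite mul0r.
by rewrite mul1r -[leRHS]expR0 ler_expR oppr_le0 mulr_ge0//; exact: calive_ge0 pt.
Qed.

Lemma measurable_calive_exp y l :
  measurable_fun setT (fun z : pathT * R => calive_exp y l (z.1 : path) z.2).
Proof.
apply: measurable_funM.
  apply: (@measurableT_comp _ _ _ _ _ _ (fun b : bool => b%:R : R)) => //.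
  exact: measurable_calive.
apply: measurableT_comp => //; apply: measurableT_comp => //.
apply: measurable_funM => //; apply: measurable_funD => //.
exact: measurable_rcpath_evalP.
Qed.

Section riemann.
Variables (h : R^nat) (h0 : forall n, 0 < h n) (hcvg : h @ \oo --> 0).

(** The exceptional time is the killing time. Before it the path survives with a margin larger than
    the mesh; after it some earlier negative value persists to the right and is met by every fine
    grid. At the killing time itself the grid looks slightly beyond t, and nothing is claimed. *)
Lemma galive_calive_cvg y (p : path) : exists t0 : R, forall t, 0 <= t -> t != t0 ->
  \forall n \near \oo,
    galive y (h n) p (Num.truncn (t / h n)).+1 = calive y p t.
Proof.
have gp n t i : (i <= (Num.truncn (t / h n)).+1)%N -> i%:R * h n <= gridup (h n) t.
  by move=> ik; rewrite ler_pM2r// ler_nat.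
have good1 t s : 0 <= t -> t < s -> calive y p s ->
    \forall n \near \oo, galive y (h n) p (Num.truncn (t / h n)).+1 = calive y p t.
  move=> t0 ts ps; have pt := calive_le t0 (ltW ts) ps.
  near=> n; rewrite pt; apply/galiveP; first exact: rcpath_le0.
  move=> i ik; move/caliveP : ps => [_]; apply; first by rewrite mulr_ge0// ltW.
  rewrite (le_trans (gp _ _ _ ik))// (le_trans (gridup_le (h0 n) t0))//.
  rewrite -lerBrDl ltW//; near: n.
  by apply: (cvgr_lt _ hcvg); rewrite subr_gt0.
have good2 t q : 0 <= q -> q < t -> y + p q < 0 ->
    \forall n \near \oo, galive y (h n) p (Num.truncn (t / h n)).+1 = calive y p t.
  move=> q0 qt pq; have /negbTE -> : ~~ calive y p t.
    by apply/caliveP => -[_ /(_ q q0 (ltW qt))]; rewrite leNgt pq.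
  have [e e0 neg] := rcpath_neg_near pq.
  near=> n; apply/negP => /galiveP-/(_ (rcpath_le0 p (lexx 0))).
  move=> /(_ (Num.truncn (q / h n)).+1).
  have -> : ((Num.truncn (q / h n)).+1 <= (Num.truncn (t / h n)).+1)%N.
    rewrite ltnS truncn_ge_nat; last by rewrite divr_ge0// ltW// (le_lt_trans q0).
    rewrite (@le_trans _ _ (q / h n))//; last by rewrite ler_pM2r ?invr_gt0// ltW.
    by rewrite truncn_le divr_ge0// ltW.
  move=> /(_ isT); rewrite leNgt neg//; first exact/ltW/gridup_gt.
  rewrite (le_lt_trans (gridup_le (h0 n) q0))// ltrD2l.
  by near: n; apply: (cvgr_lt _ hcvg).
(* The killing time is described without an infimum: dead strictly after [tau], nonnegative strictly
   before. *)
have [[tau [tau0 bad1 bad2]]|nobad] := pselect (exists tau, [/\ 0 <= tau,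
    forall s, tau < s -> ~~ calive y p s &
    forall q, 0 <= q -> q < tau -> 0 <= y + p q]).
  exists tau => t t0; case: (ltgtP t tau) => // [ttau|taut] _.
  - apply: (@good1 _ ((t + tau) / 2)) => //; first by lra.
    apply/caliveP; split; first by lra.
    by move=> q q0 qt; apply: bad2 => //; lra.
  - have /caliveP H : ~~ calive y p ((t + tau) / 2) by apply: bad1; lra.
    have [q [q0 qt pq]] : exists q, [/\ 0 <= q, q <= (t + tau) / 2 & y + p q < 0].
      apply: contrapT => nq; apply: H; split; first by lra.
      move=> q q0 qt; rewrite leNgt; apply/negP => pq; apply: nq.
      by exists q.
    by apply: (@good2 _ q) => //; lra.
(* A dummy exceptional time outside [0, oo). A time t neither followed by a time of survival nor
   preceded by a negative value would itself be such a [tau]. *)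
exists (-1) => t t0 _.
have [[s ts ps]|n1] := pselect (exists2 s, t < s & calive y p s); first exact: good1 ps.
have [[q [q0 qt pq]]|n2] := pselect (exists q, [/\ 0 <= q, q < t & y + p q < 0]).
  exact: good2 pq.
exfalso; apply: nobad; exists t; split => // [s ts|q q0 qt].
- by apply/negP => ps; apply: n1; exists s.
- by rewrite leNgt; apply/negP => pq; apply: n2; exists q.
Unshelve. all: end_near. Qed.

End riemann.
End continuous_time.

(** * From grid sums to occupation integrals *)

Section resolvent.
Context {R : realType}.
Local Notation path := (rcpath R).
Local Notation pathT := (rcpathT R).
Local Notation leb := (@lebesgue_measure R).
Implicit Types (y l t : R).

(** The reciprocal of an integer, so that [laplace_at_inv] applies and every integer horizon N is a
    grid time. *)
Definition mesh (n : nat) : R := (4 ^ n)%:R^-1.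
Local Notation h := mesh.

Lemma mesh_gt0 n : 0 < h n. Proof. by rewrite invr_gt0 ltr0n expn_gt0. Qed.
Local Hint Resolve mesh_gt0 : core.

Lemma meshK N n : (N * 4 ^ n)%:R * h n = N%:R :> R.
Proof. by rewrite natrM /mesh mulfK// pnatr_eq0 expn_eq0. Qed.

Lemma cvg_mesh : h @ \oo --> 0.
Proof.
have -> : h = (fun n => (4^-1 : R) ^+ n) by apply/funext => n; rewrite /mesh natrX exprVn.
by apply: cvg_expr; rewrite gtr0_norm// invf_lt1 ?ltr1n.
Qed.

Definition occ_exp y l N (p : path) : \bar R :=
  (\int[leb]_(t in `[0%R, N%:R[) (calive_exp y l p t)%:E)%E.

Lemma measurable_calive_exp_path y l (p : path) (D : set R) :
  measurable_fun D (calive_exp y l p).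
Proof.
apply: measurable_funTS.
exact: (measurableT_comp (measurable_calive_exp y l) (measurable_pair1 (p : pathT))).
Qed.

Lemma riemann_path y l N (p : path) : 0 <= l ->
  (h n * \sum_(k < N * 4 ^ n) galive_exp y (h n) l k.+1 k.+1 p)%:E @[n --> \oo] -->
  occ_exp y l N p.
Proof.
move=> l0; pose F n k := galive_exp y (h n) l k.+1 k.+1 p.
under eq_cvg => n.
  rewrite -(@integral_step _ (h n) (F n))//; last by move=> k; exact: galive_exp_ge0.
  rewrite meshK; over.
apply: (@bounded_cvg_integral _ _ _ _ _ _ _ 1) => //.
- by rewrite /= lebesgue_measure_itv/=; case: ifP => _; rewrite ?ltry.
- move=> n; apply: measurable_funTS => _ B mB; rewrite setTI.
  rewrite (_ : _ @^-1` B = \bigcup_(k in [set k | B (F n k)])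
      [set t | Num.truncn (t / h n) = k]).
    by apply: bigcup_measurable => k _; exact: measurable_truncn_div_eq.
  apply/seteqP; split => [t /= BF|t [k /= BF tk]].
    by exists (Num.truncn (t / h n)).
  by rewrite tk.
- exact: measurable_calive_exp_path.
- by move=> n t _; rewrite ger0_norm ?galive_exp_ge0// galive_exp_le1.
have [t0 H] := galive_calive_cvg mesh_gt0 cvg_mesh y p.
exists [set t0]; split => //; first exact: lebesgue_measure_set1.
move=> t /= /not_implyP[]; rewrite in_itv/= => /andP[tge0 _] ncvg.
apply: contrapT => /eqP tt0; apply: ncvg.
have {}H := H t tge0 tt0.
have : (calive y p t)%:R * expR (- (l * (y + p (gridup (h n) t)))) @[n --> \oo] -->
    calive_exp y l p t.
  rewrite /calive_exp; apply: cvgM; [exact: cvg_cst|].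
  apply: continuous_cvg; first exact: continuous_expR.
  apply: cvgN; apply: cvgM; [exact: cvg_cst|apply: cvgD]; first exact: cvg_cst.
  by apply: (cvg_gridup mesh_gt0 cvg_mesh) => //; exact: rcpath_rc.
move=> HH; apply: cvg_trans HH; apply: near_eq_cvg; near=> n.
have E : galive y (h n) p (Num.truncn (t / h n)).+1 = calive y p t by near: n; exact: H.
by rewrite /F /galive_exp E.
Unshelve. all: end_near. Qed.

Variable mu : probability pathT R.

(** Right endpoints are used, because right-continuity gives convergence there; the skeleton bounds
    involve left endpoints, and [rsum_shift] compares the two sums. *)
Definition rsum y l N n : R := h n * \sum_(k < N * 4 ^ n) ralive mu y (h n) l k.+1.

Lemma occ_exp_ge0 y l N p : (0 <= occ_exp y l N p)%E.
Proof. by apply: integral_ge0 => t _; rewrite lee_fin calive_exp_ge0. Qed.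

Lemma occ_exp_le y l N p : 0 <= l -> (occ_exp y l N p <= N%:R%:E)%E.
Proof.
move=> l0; apply: (@le_trans _ _ (\int[leb]_(t in `[0%R, N%:R[) 1)%E).
  apply: ge0_le_integral => //.
  - by move=> t _; rewrite lee_fin calive_exp_ge0.
  - by apply/measurable_EFinP; exact: measurable_calive_exp_path.
  - by move=> t _; rewrite lee_fin calive_exp_le1.
rewrite integral_cst//= mul1e lebesgue_measure_itv/= lte_fin.
by case: ifP => // _; rewrite oppr0 adde0.
Qed.

Lemma fine_occ_exp y l N p : 0 <= l -> (fine (occ_exp y l N p))%:E = occ_exp y l N p.
Proof.
move=> l0; rewrite fineK// ge0_fin_numE ?occ_exp_ge0//.
by rewrite (le_lt_trans (occ_exp_le _ _ _ l0))// ltry.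
Qed.

Lemma measurable_rsum_path y l N n : measurable_fun setT (fun p : pathT =>
  h n * \sum_(k < N * 4 ^ n) galive_exp y (h n) l k.+1 k.+1 p).
Proof.
apply: measurable_funM => //; apply: measurable_sum => k.
exact: measurable_galive_exp.
Qed.

Lemma measurable_occ_exp y l N : 0 <= l ->
  measurable_fun setT (fun p : pathT => occ_exp y l N p).
Proof.
move=> l0; apply: (@emeasurable_fun_cvg _ _ _ _ (fun n (p : pathT) =>
  (h n * \sum_(k < N * 4 ^ n) galive_exp y (h n) l k.+1 k.+1 p)%:E)).
- by move=> n; apply/measurable_EFinP; exact: measurable_rsum_path.
- by move=> p _; exact: riemann_path.
Qed.

Definition mocc y l N : R := fine (\int[mu]_p occ_exp y l N p)%E.

Lemma moccE y l N : 0 <= l -> (\int[mu]_p occ_exp y l N p)%E = (mocc y l N)%:E.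
Proof.
move=> l0; rewrite fineK// ge0_fin_numE; last first.
  by apply: integral_ge0 => p _; exact: occ_exp_ge0.
apply: (@le_lt_trans _ _ (\int[mu]_p N%:R%:E)%E).
  apply: ge0_le_integral => //.
  - by move=> p _; exact: occ_exp_ge0.
  - exact: measurable_occ_exp.
  - by move=> p _; exact: occ_exp_le.
by rewrite integral_probability_cst ltry.
Qed.

Lemma rsum_cvg y l N : 0 <= l -> rsum y l N n @[n --> \oo] --> mocc y l N.
Proof.
move=> l0.
suff : (rsum y l N n)%:E @[n --> \oo] --> (mocc y l N)%:E by move=> /fine_cvg.
have rsumE n : (rsum y l N n)%:E = (\int[mu]_p
    (h n * \sum_(k < N * 4 ^ n) galive_exp y (h n) l k.+1 k.+1 p)%:E)%E.
  under eq_integral do rewrite EFinM -sumEFin.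
  rewrite ge0_integralZl//; first last.
  - by rewrite lee_fin ltW.
  - by move=> p _; apply: sume_ge0 => k _; rewrite lee_fin galive_exp_ge0.
  - apply: emeasurable_sum => k; apply/measurable_EFinP.
    exact: measurable_galive_exp.
  rewrite ge0_integral_sum//; first last.
  - by move=> k p _; rewrite lee_fin galive_exp_ge0.
  - by move=> k; apply/measurable_EFinP; exact: measurable_galive_exp.
  rewrite /rsum EFinM -sumEFin; congr (_ * _)%E; apply: eq_bigr => k _.
  by rewrite raliveE.
rewrite (funext rsumE).
rewrite -moccE// (eq_integral (fun p : pathT => (fine (occ_exp y l N p))%:E)); last first.
  by move=> p _; rewrite fine_occ_exp.
apply: (@bounded_cvg_integral _ _ _ _ _ _ _ N%:R) => //.
- by rewrite (le_lt_trans (probability_le1 mu measurableT))// ltry.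
- by move=> n; exact: measurable_rsum_path.
- apply: measurableT_comp => //; exact: measurable_occ_exp.
- move=> n p _; rewrite ger0_norm; last first.
    by rewrite mulr_ge0 ?sumr_ge0// ?ltW// => k _; exact: galive_exp_ge0.
  apply: (@le_trans _ _ (h n * \sum_(k < N * 4 ^ n) 1)).
    apply: ler_wpM2l; first exact: ltW.
    by apply: ler_sum => k _; exact: galive_exp_le1.
  by rewrite sumr_const card_ord mulrC meshK.
- apply: aeW => p _; have := @riemann_path y l N p l0.
  by rewrite -fine_occ_exp// => /fine_cvg.
Qed.

End resolvent.

(** * Bounds for the killed potential of an exponential *)

Section killed_resolvent.
Context {R : realType}.
Local Notation path := (rcpath R).
Local Notation pathT := (rcpathT R).
Local Notation leb := (@lebesgue_measure R).
Local Notation h := (@mesh R).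
Implicit Types (y l t : R).
Variables (mu : probability pathT R) (smu : sii mu) (psi : R -> R).
Hypothesis lap1 : laplace_at mu psi 1.
Hypothesis psi_gt0 : forall l, 0 < l -> 0 < psi l.
Variable C : R.
Hypothesis psi_le : forall l, 1 <= l -> psi l <= C * l ^+ 2.

Local Notation c y l N n := (ralive mu y (h n) l (N * 4 ^ n)).

Lemma laplace_at_mesh n : laplace_at mu psi (h n).
Proof. by apply: laplace_at_inv => //; rewrite expn_gt0. Qed.

(** The difference telescopes to two boundary terms, both in [0, 1]. *)
Lemma rsum_shift y l N n : 0 <= y -> 0 <= l ->
  `|h n * \sum_(k < N * 4 ^ n) ralive mu y (h n) l k - rsum mu y l N n| <= h n.
Proof.
move=> y0 l0; rewrite /rsum -mulrBr normrM gtr0_norm ?mesh_gt0//.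
rewrite ger_pMr ?mesh_gt0//.
have S m : \sum_(k < m) ralive mu y (h n) l k - \sum_(k < m) ralive mu y (h n) l k.+1
    = ralive mu y (h n) l 0 - ralive mu y (h n) l m.
  elim: m => [|m ih]; first by rewrite !big_ord0 !subrr.
  by rewrite !big_ord_recr/= opprD addrACA ih addrA subrK.
rewrite S ler_norml; have H k : 0 <= ralive mu y (h n) l k <= 1.
  by rewrite ralive_ge0/= (le_trans (ralive_le _ _ _ _ _))// ralive_le1.
move: (H 0%N) (H (N * 4 ^ n)%N).
move: (ralive mu y (h n) l 0) (ralive mu y (h n) l (N * 4 ^ n)) => r0 r1; clear.
by move=> /andP[? ?] /andP[? ?]; apply/andP; split; lra.
Qed.

(* The second Laplace exponent is taken to be 2^n: since psi grows at most
   quadratically, [4^-n * psi (2^n)] stays bounded while the weight of the large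
   overshoots, of order [expR (- 2^n * e)], beats the number N * 4^n of steps. *)
Definition overshoot_err l e N n : R :=
  (N * 4 ^ n)%:R * expR (h n * psi (2 ^+ n) - (2 ^+ n - l) * e).

Lemma cvg_overshoot_err l e N : 0 < e -> overshoot_err l e N n @[n --> \oo] --> 0.
Proof.
move=> e0.
(* [C] bounds [h n * psi (2 ^+ n)]. The bound [expR x >= x ^+ 3 / 6] at x = 2^n e beats the factor
   4^n = (2^n)^2 and leaves 2^-n. *)
pose B := N%:R * expR (C + l * e) * (6 / e ^+ 3).
apply: (@squeeze_cvgr _ _ _ _ (fun=> 0) (fun n => B * 2^-1 ^+ n)); last 2 first.
- exact: cvg_cst.
- rewrite -(mulr0 B); apply: cvgM; [exact: cvg_cst|apply: cvg_expr].
  by rewrite gtr0_norm// invf_lt1 ?ltr1n.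
near=> n; apply/andP; split; first by rewrite mulr_ge0 ?expR_ge0.
have x0 : 0 < (2 : R) ^+ n by rewrite exprn_gt0.
have psiC : h n * psi (2 ^+ n) <= C.
  rewrite /mesh natrX (_ : (4 : R) = 2 ^+ 2); last by rewrite expr2 -natrM.
  by rewrite exprAC mulrC ler_pdivrMr ?exprn_gt0// psi_le// exprn_ege1// ler1n.
have X3 : (2 ^+ n * e) ^+ 3 / 6 <= expR (2 ^+ n * e).
  have z0 : 0 <= 2 ^+ n * e by rewrite mulr_ge0// ltW.
  have f6 : (3`!)%:R = 6 :> R by [].
  by have := expR_ge1Dxn 2 z0; rewrite f6; move: (_ / 6) => ? ?; lra.
rewrite /overshoot_err (@le_trans _ _ (N%:R * (2 ^+ n) ^+ 2 *
   (expR (C + l * e) * expR (- (2 ^+ n * e)))))//.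
  rewrite natrM natrX (_ : (4 : R) = 2 ^+ 2); last by rewrite expr2 -natrM.
  rewrite exprAC ler_wpM2l ?mulr_ge0 ?sqr_ge0// -expRD ler_expR.
  by rewrite mulrBl; lra.
rewrite expRN /B.
have -> : N%:R * expR (C + l * e) * (6 / e ^+ 3) * 2^-1 ^+ n =
   N%:R * (2 ^+ n) ^+ 2 * (expR (C + l * e) * ((2 ^+ n * e) ^+ 3 / 6)^-1).
  rewrite exprVn; field; rewrite !gt_eqF//.
rewrite ler_wpM2l ?mulr_ge0 ?sqr_ge0// ler_wpM2l ?expR_ge0// lef_pV2//.
- by rewrite posrE expR_gt0.
- by rewrite posrE divr_gt0// exprn_gt0// mulr_gt0.
Unshelve. all: end_near. Qed.

(** Uses [expR x - 1 >= x] at [x = h n * psi l]; passing to right endpoints costs [psi l * h n]. *)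
Lemma skeleton_upper_mesh y l e N n : 0 <= y -> 0 < l -> l <= 2 ^+ n -> 0 <= e ->
  c y 0 N n + psi l * rsum mu y l N n <=
  c y l N n + expR (l * e) - expR (- (l * y)) + overshoot_err l e N n + psi l * h n.
Proof.
move=> y0 l0 ll e0; have l0' := ltW l0.
have := skeleton_upper smu (N * 4 ^ n) (mesh_gt0 n) y0 l0' ll e0 (laplace_at_mesh n).
rewrite -/(overshoot_err l e N n).
have := rsum_shift N n y0 l0'; rewrite ler_norml => /andP[sh _].
have a0 : 0 <= c y 0 N n by exact: ralive_ge0.
have E1 : 1 <= expR (l * e) by rewrite -expR0 ler_expR mulr_ge0.
set S := \sum_(_ < _) _ in sh *.
have S0 : 0 <= S by apply: sumr_ge0 => k _; exact: ralive_ge0.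
have E2 : psi l * (h n * S) <= (expR (h n * psi l) - 1) * S.
  rewrite mulrA ler_wpM2r// mulrC lerBrDl; exact: expR_ge1Dx.
have E3 : psi l * (rsum mu y l N n - h n) <= psi l * (h n * S).
  by rewrite ler_wpM2l ?(ltW (psi_gt0 _))//; lra.
have E4 : c y 0 N n <= expR (l * e) * c y 0 N n by rewrite ler_peMl.
rewrite mulrBr mulr1 => H; rewrite mulrBr in E3.
move: E2 E3 E4 H.
move: (psi l * _) (psi l * _) (_ * S) (expR (l * e) * _) => A1 A2 A3 A4.
by move: (overshoot_err _ _ _ _) (c y l N n) (psi l * h n) => ? ? ? ? ? ? ?; lra.
Qed.

(** Uses [expR x - 1 <= x * expR x] at [x = h n * psi l], whose extra factor tends to 1 with the
    mesh. *)
Lemma skeleton_lower_mesh y l N n : 0 <= y -> 0 < l ->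
  1 - expR (- (l * y)) - c y 0 N n <=
  psi l * expR (h n * psi l) * (rsum mu y l N n + h n).
Proof.
move=> y0 l0; have l0' := ltW l0; have h0 := mesh_gt0 n : 0 < h n.
have := skeleton_lower smu (N * 4 ^ n) h0 y0 l0' (laplace_at_mesh n).
have := rsum_shift N n y0 l0'; rewrite ler_norml => /andP[_ sh].
set S := \sum_(_ < _) _ in sh *.
have S0 : 0 <= S by apply: sumr_ge0 => k _; exact: ralive_ge0.
have c0 : 0 <= c y l N n by exact: ralive_ge0.
have E0 : expR (h n * psi l) - 1 <= h n * psi l * expR (h n * psi l).
  have := expR_ge1Dx (- (h n * psi l)); rewrite expRN.
  have := expR_gt0 (h n * psi l); move: (h n * psi l) (expR (h n * psi l)) => z E Ep.
  by rewrite -(ler_pM2r Ep) mulVf ?gt_eqF// mulrDl mul1r mulNr; lra.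
have E1 : (expR (h n * psi l) - 1) * S <= psi l * expR (h n * psi l) * (h n * S).
  rewrite (_ : psi l * _ * _ = h n * psi l * expR (h n * psi l) * S); last by ring.
  by rewrite ler_wpM2r.
have E2 : psi l * expR (h n * psi l) * (h n * S) <=
    psi l * expR (h n * psi l) * (rsum mu y l N n + h n).
  by rewrite ler_wpM2l ?mulr_ge0 ?expR_ge0 ?(ltW (psi_gt0 _))//; lra.
move: E1 E2; move: (_ * S) (_ * (h n * S)) (_ * (_ + _)) (c y l N n) c0.
by move=> ? ? ? ? ? ? ? ?; lra.
Qed.

(** By [ralive_tail], the value at time N + 1 is at most [expR (psi l)] times the value at each grid
    time in the preceding unit interval; then average over that interval. *)
Lemma ralive_tail_mesh y l N n : 0 < l ->
  c y l N.+1 n <= expR (psi l) * (rsum mu y l N.+1 n - rsum mu y l N n).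
Proof.
move=> l0; set M := (4 ^ n)%N; have M0 : (0 < M)%N by rewrite expn_gt0.
have -> : rsum mu y l N.+1 n - rsum mu y l N n =
    h n * \sum_(k < M) ralive mu y (h n) l (N * M + k.+1).
  rewrite /rsum -mulrBr mulSnr big_split_ord/= addrAC subrr add0r.
  by congr (_ * _); apply: eq_bigr => k _; rewrite addnS.
have -> : c y l N.+1 n = h n * \sum_(k < M) c y l N.+1 n.
  by rewrite sumr_const card_ord -mulr_natr mulrCA mulVf ?mulr1// pnatr_eq0 -lt0n.
rewrite mulrCA ler_wpM2l ?(ltW (mesh_gt0 n))// mulr_sumr.
apply: ler_sum => k _.
have -> : (N.+1 * M = (N * M + k.+1) + (M - k.+1))%N.
  by rewrite -addnA subnKC// mulSnr.
apply: (le_trans (ralive_tail smu y _ _ (mesh_gt0 n) (ltW l0) _ (laplace_at_mesh n))).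
  exact/ltW/psi_gt0.
rewrite ler_wpM2r ?ralive_ge0// ler_expR ger_pMl ?psi_gt0//.
rewrite /mesh ler_pdivrMr ?ltr0n// mul1r ler_nat; exact: leq_subr.
Qed.

(** The mesh is refined at fixed e, which removes [overshoot_err]; only afterwards does e tend to
    0. *)
Lemma mocc_le y l N : 0 <= y -> 0 < l ->
  psi l * mocc mu y l N <= 1 - expR (- (l * y)).
Proof.
move=> y0 l0; have l0' := ltW l0.
have H e : 0 < e -> psi l * mocc mu y l N <= expR (l * e) - expR (- (l * y)).
  move=> e0; rewrite -[leRHS]addr0 -[leRHS]addr0.
  have cvl : psi l * rsum mu y l N n @[n --> \oo] --> psi l * mocc mu y l N.
    by apply: cvgM; [exact: cvg_cst|exact: rsum_cvg].
  have cvr : expR (l * e) - expR (- (l * y)) + overshoot_err l e N n + psi l * h n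
      @[n --> \oo] --> expR (l * e) - expR (- (l * y)) + 0 + 0.
    apply: cvgD; first by apply: cvgD; [exact: cvg_cst|exact: cvg_overshoot_err].
    by rewrite -(mulr0 (psi l)); apply: cvgM; [exact: cvg_cst|exact: cvg_mesh].
  apply: (ler_cvg_to cvl cvr); near=> n.
  have ll : l <= 2 ^+ n.
    near: n; exists (Num.truncn l).+1 => // n /= ln.
    rewrite (le_trans (ltW (truncnS_gt l)))// -natrX ler_nat (leq_trans ln)//.
    exact/ltnW/ltn_expl.
  have := skeleton_upper_mesh N y0 l0 ll (ltW e0); have := ralive_le mu y (h n) (N * 4 ^ n) l0'.
  by move: (psi l * h n) (psi l * rsum _ _ _ _ _) (overshoot_err _ _ _ _) => ? ? ? ? ?; lra.
have cv : expR (l * h n) - expR (- (l * y)) @[n --> \oo] --> 1 - expR (- (l * y)).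
  apply: cvgB; last exact: cvg_cst.
  rewrite -[X in _ --> X]expR0; apply: continuous_cvg; first exact: continuous_expR.
  by rewrite -(mulr0 l); apply: cvgM; [exact: cvg_cst|exact: cvg_mesh].
apply: (ler_cvg_to (cvg_cst _) cv); apply: nearW => n; exact/H/mesh_gt0.
Unshelve. all: end_near. Qed.

End killed_resolvent.

(** * Long horizons: certain killing and the value of the potential *)

Section killed_resolvent_limit.
Context {R : realType}.
Local Notation path := (rcpath R).
Local Notation pathT := (rcpathT R).
Local Notation leb := (@lebesgue_measure R).
Local Notation h := (@mesh R).
Implicit Types (y l t : R).
Variables (mu : probability pathT R) (smu : sii mu) (psi : R -> R).
Hypothesis lap1 : laplace_at mu psi 1.
Hypothesis psi_gt0 : forall l, 0 < l -> 0 < psi l.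
Variable C : R.
Hypothesis psi_le : forall l, 1 <= l -> psi l <= C * l ^+ 2.

Local Notation c y l N n := (ralive mu y (h n) l (N * 4 ^ n)).

Lemma mocc_ndecr y l N : 0 < l -> mocc mu y l N <= mocc mu y l N.+1.
Proof.
move=> l0; apply: (ler_cvg_to (@rsum_cvg R mu y l N (ltW l0)) (@rsum_cvg R mu y l N.+1 (ltW l0))).
apply: nearW => n; rewrite -subr_ge0 -(pmulr_rge0 _ (expR_gt0 (psi l))).
apply: le_trans (ralive_tail_mesh smu lap1 psi_gt0 y N n l0); exact: ralive_ge0.
Qed.

Lemma mocc_incr_cvg0 y l : 0 <= y -> 0 < l ->
  mocc mu y l N.+1 - mocc mu y l N @[N --> \oo] --> 0.
Proof.
move=> y0 l0; have cv : cvgn (mocc mu y l).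
  apply: nondecreasing_is_cvgn; first by apply/nondecreasing_seqP => N; exact: mocc_ndecr.
  exists ((1 - expR (- (l * y))) / psi l) => _ [N _ <-].
  rewrite ler_pdivlMr ?psi_gt0// mulrC.
  exact: (mocc_le smu lap1 psi_gt0 psi_le N y0 l0).
rewrite -(subrr (limn (mocc mu y l))); apply: cvgB; last exact: cv.
by rewrite (cvg_shiftS (mocc mu y l)); exact: cv.
Qed.

(** For fixed l the sequence [mocc] converges, so its increments vanish and with them the terminal
    values at l. For small l the upper bound then leaves almost nothing for the survival
    probability. The horizon is fixed first, and the mesh is refined afterwards. *)
Lemma ralive_vanish y e : 0 <= y -> 0 < e ->
  exists N0, forall N, (N0 <= N)%N -> \forall n \near \oo, c y 0 N n <= e.
Proof.
(* The budget is split into shares of e / 6: l makes 1 - exp (-l y) at most one share (y + 1 covers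
   y = 0), [del] makes exp (l del) - 1 exactly one, and the terminal value, the overshoot error and
   [psi l * h n] take one each. *)
move=> y0 e0; pose l := e / 6 / (y + 1).
have y1 : 0 < y + 1 by rewrite ltr_wpDl.
have l0 : 0 < l by rewrite !divr_gt0.
have ly : l * y <= e / 6.
  by rewrite /l mulrAC ler_pdivrMr// ler_wpM2l ?lerDl// divr_ge0// ltW.
have ely : 1 - e / 6 <= expR (- (l * y)).
  by apply: (le_trans _ (expR_ge1Dx _)); rewrite lerD2l lerN2.
pose del := ln (1 + e / 6) / l.
have e6 : 0 < e / 6 by rewrite divr_gt0.
have del0 : 0 < del by rewrite divr_gt0// ln_gt0// ltrDl.
have edel : expR (l * del) = 1 + e / 6.
  by rewrite /del mulrCA divff ?gt_eqF// mulr1 lnK// posrE ltr_wpDr// ltW.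
have [N0 _ HN0] : \forall N \near \oo, expR (psi l) * (mocc mu y l N.+1 - mocc mu y l N) < e / 6.
  apply: (cvgr_lt (expR (psi l) * 0)); last by rewrite mulr0.
  by apply: cvgM; [exact: cvg_cst|exact: mocc_incr_cvg0].
exists N0.+1 => -[//|N]; rewrite ltnS => /HN0 {}HN0.
near=> n.
have ll : l <= 2 ^+ n.
  near: n; exists (Num.truncn l).+1 => // n /= ln.
  rewrite (le_trans (ltW (truncnS_gt l)))// -natrX ler_nat (leq_trans ln)//.
  exact/ltnW/ltn_expl.
have U := skeleton_upper_mesh smu lap1 psi_gt0 N.+1 y0 l0 ll (ltW del0).
have T := ralive_tail_mesh smu lap1 psi_gt0 y N n l0.
have err : overshoot_err psi l del N.+1 n < e / 6.
  near: n; apply: (cvgr_lt 0) => //; exact: (cvg_overshoot_err psi_le).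
have Ph : psi l * h n < e / 6.
  near: n; apply: (cvgr_lt (psi l * 0)); last by rewrite mulr0.
  by apply: cvgM; [exact: cvg_cst|exact: cvg_mesh].
have D : expR (psi l) * (rsum mu y l N.+1 n - rsum mu y l N n) < e / 6.
  near: n; apply: (cvgr_lt (expR (psi l) * (mocc mu y l N.+1 - mocc mu y l N))) => //.
  by apply: cvgM; [exact: cvg_cst|apply: cvgB; apply: rsum_cvg; exact: ltW].
have S0 : 0 <= psi l * rsum mu y l N.+1 n.
  rewrite mulr_ge0 ?(ltW (psi_gt0 l0))// mulr_ge0 ?(ltW (mesh_gt0 n))//.
  by apply: sumr_ge0 => k _; exact: ralive_ge0.
rewrite edel in U; move: U T D S0 Ph err ely e0; clear.
move: (psi l * h n) (psi l * rsum _ _ _ _ _) (expR (psi l) * _) => A1 A2 A3.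
by move: (overshoot_err _ _ _ _ _) (expR _) (c y 0 _ _) (c y l _ _) => A4 A5 A6 A7 *; lra.
Unshelve. all: end_near. Qed.

(** [mocc_le] is the upper half. For the lower half the only loss in [skeleton_lower_mesh] that
    outlives mesh refinement is the survival probability, which vanishes at long horizons. *)
Lemma mocc_cvg y l : 0 <= y -> 0 < l ->
  mocc mu y l N @[N --> \oo] --> (1 - expR (- (l * y))) / psi l.
Proof.
move=> y0 l0; have p0 := psi_gt0 l0; set v := 1 - _.
suff H : psi l * mocc mu y l N @[N --> \oo] --> v.
  have -> : mocc mu y l = (fun N => psi l * mocc mu y l N * (psi l)^-1).
    by apply/funext => N; rewrite mulrAC mulfV ?mul1r// gt_eqF.
  by apply: cvgM => //; exact: cvg_cst.
apply/cvgrPdist_le => e e0.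
have [N0 HN0] := ralive_vanish y0 e0.
exists N0 => // N /= NN0; have up : psi l * mocc mu y l N <= v.
  exact: (mocc_le smu lap1 psi_gt0 psi_le).
rewrite ger0_norm ?subr_ge0// lerBlDl -lerBlDr.
have cv : psi l * expR (h n * psi l) * (rsum mu y l N n + h n) @[n --> \oo] -->
    psi l * mocc mu y l N.
  have := @cvgM _ _ _ _ (fun n => psi l * expR (h n * psi l)) (fun n => rsum mu y l N n + h n)
    (psi l * expR (0 * psi l)) (mocc mu y l N + 0).
  rewrite mul0r expR0 mulr1 addr0; apply; last first.
    by rewrite -[X in _ --> X]addr0; apply: cvgD; [apply: rsum_cvg; exact: ltW|exact: cvg_mesh].
  rewrite -[X in _ --> X]mulr1; apply: cvgM; first exact: cvg_cst.
  rewrite -expR0; apply: continuous_cvg; first exact: continuous_expR.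
  by rewrite -(mul0r (psi l)); apply: cvgM; [exact: cvg_mesh|exact: cvg_cst].
apply: (ler_cvg_to (cvg_cst _) cv).
move: (HN0 _ NN0); apply: filterS => n cn.
apply: le_trans (skeleton_lower_mesh smu lap1 psi_gt0 N n y0 l0).
by rewrite lerB.
Qed.

Definition killed_occ y (f : R -> \bar R) (p : pathT) : \bar R :=
  (\int[leb]_t ((calive y (p : path) t)%:R%:E * f (y + (p : path) t)%R))%E.

Definition killed_potential y (f : R -> \bar R) : \bar R :=
  (\int[mu]_p killed_occ y f p)%E.

Lemma occ_exp_cvg y l (p : pathT) : 0 <= l ->
  occ_exp y l N p @[N --> \oo] --> killed_occ y (fun z : R => (expR (- (l * z)))%:E) p.
Proof.
move=> l0.
have -> : killed_occ y (fun z : R => (expR (- (l * z)))%:E) p =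
    (\int[leb]_(t in \bigcup_N [set` `[0%R, N%:R[]) (calive_exp y l (p : path) t)%:E)%E.
  rewrite [RHS]integral_mkcond; apply: eq_integral => t _; rewrite patchE -EFinM.
  case: ifPn => //; rewrite notin_setE => nt.
  have -> : calive y (p : path) t = false; last by rewrite mul0r.
  apply/negP => /caliveP[t0 _]; apply: nt; exists (Num.truncn t).+1 => //=.
  by rewrite in_itv/= t0 truncnS_gt.
apply: ge0_nondecreasing_set_cvg_integral => //.
- by move=> m n mn; apply/subsetPset; apply: subset_itvl; rewrite bnd_simp ler_nat.
- by move=> N; apply/measurable_EFinP; exact: measurable_calive_exp_path.
- by move=> N t _; rewrite lee_fin calive_exp_ge0.
Qed.

Lemma killed_potential_exp y l : 0 <= y -> 0 < l ->
  killed_potential y (fun z : R => (expR (- (l * z)))%:E) =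
  ((1 - expR (- (l * y))) / psi l)%:E.
Proof.
move=> y0 l0; have l0' := ltW l0.
have c1 : (\int[mu]_p occ_exp y l N p)%E @[N --> \oo] -->
    killed_potential y (fun z : R => (expR (- (l * z)))%:E).
  rewrite /killed_potential.
  rewrite (_ : killed_occ _ _ = fun p => limn (fun N => occ_exp y l N (p : path))).
    apply: cvg_monotone_convergence => //.
    - by move=> N; exact: measurable_occ_exp.
    - by move=> N p _; exact: occ_exp_ge0.
    - move=> p _ m n mn; apply: ge0_subset_integral => //.
      + by apply/measurable_EFinP; exact: measurable_calive_exp_path.
      + by move=> t _; rewrite lee_fin calive_exp_ge0.
      + by apply: subset_itvl; rewrite bnd_simp ler_nat.
  by apply/funext => p; apply/esym/cvg_lim => //; exact: occ_exp_cvg.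
rewrite -(cvg_lim _ c1)//; apply/cvg_lim => //.
rewrite (_ : (fun N => _) = (fun N => (mocc mu y l N)%:E)); last first.
  by apply/funext => N; exact: moccE.
by apply: cvg_EFin; [exact: nearW|exact: mocc_cvg].
Qed.

Lemma measurable_calive_forever y :
  measurable [set p : pathT | forall t, 0 <= t -> calive y (p : path) t].
Proof.
rewrite (_ : mkset _ = \bigcap_N [set p : pathT | calive y (p : path) N%:R]).
  apply: bigcap_measurableType => N _.
  have := measurableT_comp (@measurable_calive R y) (@measurable_pair2 _ _ pathT R N%:R).
  by move=> /(_ measurableT [set true]); rewrite setTI; apply.
apply/seteqP; split => [p pt N _|p H t t0]; first exact: pt.
by apply: (@calive_le _ _ _ _ (Num.truncn t).+1%:R) (H _ I) => //; exact/ltW/truncnS_gt.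
Qed.

(** A path that is alive forever survives every number of steps on every grid, so [ralive_vanish]
    bounds its probability. *)
Lemma calive_forever_null y : 0 <= y ->
  mu [set p : pathT | forall t, 0 <= t -> calive y (p : path) t] = 0%E.
Proof.
move=> y0; apply/eqP; rewrite eq_le measure_ge0 andbT; apply/lee_addgt0Pr => e e0.
rewrite add0e; have [N0 /(_ N0 (leqnn _)) [n0 _ /(_ n0 (leqnn _))]] := ralive_vanish y0 e0.
rewrite -lee_fin -raliveE//; apply: le_trans.
set A := mkset _; have mA : measurable A := measurable_calive_forever y.
rewrite -[leLHS](_ : (\int[mu]_p (\1_A p)%:E)%E = _); last first.
  by rewrite integral_indic// setIT.
apply: ge0_le_integral => //.
- by apply/measurable_EFinP; exact: measurable_indic.
- by apply/measurable_EFinP; exact: measurable_galive_exp.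
move=> p _; rewrite lee_fin galive_exp0 indicE.
have [|] := boolP (p \in A); last by rewrite ler0n.
rewrite inE => pA; rewrite (_ : galive _ _ _ _)//.
apply/galiveP => [|i _]; first exact: rcpath_le0.
by apply: calive_ge0; apply: pA; rewrite mulr_ge0// ltW// mesh_gt0.
Qed.

End killed_resolvent_limit.

(** * Weighted integrals and exponential approximations of half-lines *)

Section weighted_integral.
Context {R : realType} {d : measure_display} {T : measurableType d}.
Variables (m : {measure set T -> \bar R}) (k g : T -> R).
Hypothesis k0 : forall w, 0 <= k w.
Hypothesis mk : measurable_fun setT k.
Hypothesis mg : measurable_fun setT g.
Hypothesis kg : forall w, k w != 0 -> 0 <= g w.
Implicit Types (a b c z : R).

(** Integration against the image under g of the measure with density k, without forming that
    measure. Both the killed potential on path times time and a density on the line have this shape;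
    the hypothesis [kg] places the image on [0, oo). *)
Definition wint (f : R -> \bar R) : \bar R := (\int[m]_w ((k w)%:E * f (g w)))%E.

(** Expanding the power gives a finite combination of exponentials, so its integral is determined by
    Laplace transforms. *)
Definition exp_binom a b M z : R := expR (- (a * z)) * (1 - expR (- (b * z))) ^+ M.

Lemma exp_binom_bound a b M z : 0 <= b -> 0 <= z ->
  0 <= exp_binom a b M z <= expR (- (a * z)).
Proof.
move=> b0 z0; have bz : 0 <= expR (- (b * z)) <= 1.
  by rewrite expR_ge0/= -[leRHS]expR0 ler_expR oppr_le0 mulr_ge0.
rewrite /exp_binom mulr_ge0 ?expR_ge0 ?exprn_ge0//=; last lra.
by rewrite ger_pMr ?expR_gt0// exprn_ile1//; lra.
Qed.

Lemma measurable_exp_binom a b M : measurable_fun setT (exp_binom a b M).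
Proof.
apply: measurable_funM; last apply: measurable_funX.
  by apply: measurableT_comp => //; apply: measurableT_comp => //; exact: measurable_funM.
apply: measurable_funB => //.
by apply: measurableT_comp => //; apply: measurableT_comp => //; exact: measurable_funM.
Qed.

Lemma wint_exp_binom_ge0 a b M w : 0 <= b -> 0 <= k w * exp_binom a b M (g w).
Proof.
move=> b0; have [->|kw] := eqVneq (k w) 0; first by rewrite mul0r.
by rewrite mulr_ge0//; case/andP: (exp_binom_bound a M b0 (kg kw)).
Qed.

Lemma measurable_wint (f : R -> \bar R) : measurable_fun setT f ->
  measurable_fun setT (fun w => (k w)%:E * f (g w))%E.
Proof.
move=> mf; apply: emeasurable_funM; first exact/measurable_EFinP.
exact: measurableT_comp.
Qed.

Lemma measurable_wint_EFin (f : R -> R) : measurable_fun setT f ->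
  measurable_fun setT (fun w => (k w)%:E * (f (g w))%:E)%E.
Proof.
by move=> mf; apply: (@measurable_wint (fun z => (f z)%:E)); exact/measurable_EFinP.
Qed.

(** One factor of the binomial expansion, in additive form so that every integrand stays
    nonnegative. *)
Lemma wint_exp_binomS a b M : 0 <= b ->
  (wint (fun z => (exp_binom a b M.+1 z)%:E) + wint (fun z => (exp_binom (a + b) b M z)%:E) =
   wint (fun z => (exp_binom a b M z)%:E))%E.
Proof.
move=> b0; rewrite /wint -ge0_integralD//; first last.
- exact: measurable_wint_EFin (measurable_exp_binom _ _ _).
- by move=> w _; rewrite -EFinM lee_fin wint_exp_binom_ge0.
- exact: measurable_wint_EFin (measurable_exp_binom _ _ _).
- by move=> w _; rewrite -EFinM lee_fin wint_exp_binom_ge0.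
apply: eq_integral => w _; rewrite -!EFinM -EFinD -mulrDr /exp_binom.
by rewrite mulrDl opprD expRD exprS; congr (_ * _)%:E; ring.
Qed.

Lemma wint_exp_binom0 a b :
  wint (fun z => (exp_binom a b 0 z)%:E) = wint (fun z => (expR (- (a * z)))%:E).
Proof. by apply: eq_integral => w _; rewrite /exp_binom expr0 mulr1. Qed.

(** With l = ln 2 / c, u = exp (-n l z) and M = n 2^n one has M u = n exp (n l (c - z)). The power
    (1 - u)^M therefore tends to 1 for z > c and to 0 for z <= c; the factor n settles the case z =
    c. *)
Lemma exp_binom_cvg_ray c z : 0 < c -> 0 <= z ->
  exp_binom 1 (n%:R * (ln 2 / c)) (n * 2 ^ n) z @[n --> \oo] -->
  expR (- z) * (c < z)%R%:R.
Proof.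
move=> c0 z0; rewrite /exp_binom mul1r; apply: cvgM; first exact: cvg_cst.
pose l : R := ln 2 / c; have l0 : 0 < l by rewrite divr_gt0// ln_gt0// ltr1n.
have lc : expR (l * c) = 2 by rewrite /l divfK ?gt_eqF// lnK// posrE.
pose u n := expR (- (n%:R * l * z)).
have u01 n : 0 <= u n <= 1.
  by rewrite /u expR_ge0/= -[leRHS]expR0 ler_expR oppr_le0 mulr_ge0// mulr_ge0// ltW.
have Mu n : (n * 2 ^ n)%:R * u n = n%:R * expR (n%:R * (l * (c - z))).
  rewrite natrM natrX -lc -expRM_natl -mulrA -expRD; congr (_ * expR _); ring.
have [cz|zc] := ltP c z.
  pose a := l * (z - c); have a0 : 0 < a by rewrite mulr_gt0// subr_gt0.
  (* Since exp (n a) >= (n a)^2 / 2, the product M u = n exp (-n a) is at most 2 / (a^2 n). *)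
  apply: (@squeeze_cvgr _ _ _ _ (fun n => 1 - 2 / a ^+ 2 * n%:R^-1) (fun=> 1)); last 2 first.
  - rewrite -[X in _ --> X]subr0 -(mulr0 (2 / a ^+ 2)); apply: cvgB; first exact: cvg_cst.
    apply: cvgM; first exact: cvg_cst.
    rewrite -(cvg_shiftS (fun n => n%:R^-1 : R)); exact: cvg_harmonic.
  - exact: cvg_cst.
  near=> n; have /andP[un0 un1] := u01 n; apply/andP; split; last first.
    by apply: exprn_ile1; rewrite -/l -/(u n); lra.
  (* Bernoulli's inequality. *)
  have bern : 1 - (n * 2 ^ n)%:R * u n <= (1 - u n) ^+ (n * 2 ^ n).
    elim: (n * 2 ^ n)%N => [|M ih]; first by rewrite mul0r subr0 expr0.
    rewrite exprS (@le_trans _ _ ((1 - u n) * (1 - M%:R * u n)))//; last first.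
      by rewrite ler_wpM2l// subr_ge0.
    rewrite -natr1; have : 0 <= M%:R * u n * u n by rewrite !mulr_ge0.
    by move: (M%:R : R) => m' ?; lra.
  apply: le_trans bern; rewrite lerD2l lerN2 Mu.
  have n0 : 0 < n%:R :> R by rewrite ltr0n; near: n; exists 1%N.
  have -> : n%:R * (l * (c - z)) = - (n%:R * a) by rewrite /a; ring.
  have na : 0 < n%:R * a by rewrite mulr_gt0.
  have := expR_ge1Dxn 1 (ltW na); rewrite expRN => H.
  rewrite ler_pdivrMr ?expR_gt0// (@le_trans _ _ (2 / a ^+ 2 / n%:R * ((n%:R * a) ^+ 2 / 2)))//.
    by rewrite le_eqVlt; apply/orP; left; apply/eqP; field; rewrite !gt_eqF.
  rewrite ler_wpM2l//; first by rewrite !divr_ge0 ?sqr_ge0 ?ltW.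
  apply: le_trans H; rewrite [2`!%:R](_ : _ = 2)// lerDr//.
(* For z <= c one has M u >= n, and (1 - u)^M <= exp (- M u). *)
apply: (@squeeze_cvgr _ _ _ _ (fun n => 0) (fun n => expR (-1) ^+ n)); last 2 first.
- exact: cvg_cst.
- by apply: cvg_expr; rewrite gtr0_norm ?expR_gt0// -expR0 ltr_expR; lra.
apply: nearW => n; rewrite -/l -/(u n); have /andP[un0 un1] := u01 n.
rewrite exprn_ge0 ?subr_ge0//=.
rewrite (@le_trans _ _ (expR (- u n) ^+ (n * 2 ^ n)))//.
  by rewrite lerXn2r ?nnegrE ?subr_ge0 ?expR_ge0//; exact: expR_ge1Dx.
rewrite -!expRM_natl ler_expR mulrN Mu mulrN1 lerN2 ler_peMr//.
by rewrite -[leLHS]expR0 ler_expR mulr_ge0// mulr_ge0 ?subr_ge0// ltW.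
Unshelve. all: end_near. Qed.

Lemma exp_binom_cvg_ray0 z : 0 <= z ->
  exp_binom 1 n%:R 1 z @[n --> \oo] --> expR (- z) * (0 < z)%R%:R.
Proof.
move=> z0; rewrite /exp_binom mul1r; apply: cvgM; first exact: cvg_cst.
move: z0; rewrite le_eqVlt => /predU1P[<-|z0].
  rewrite ltxx; apply: cvg_near_cst; apply: nearW => n.
  by rewrite mulr0 oppr0 expR0 subrr expr1.
rewrite z0 -[X in _ --> X]subr0; apply: cvgB; first exact: cvg_cst.
rewrite (_ : (fun n => _) = (fun n => expR (- z) ^+ n)).
  by apply: cvg_expr; rewrite gtr0_norm ?expR_gt0// -expR0 ltr_expR oppr_lt0.
by apply/funext => n; rewrite -mulrN expRM_natl.
Qed.

Lemma wint_dct (q : nat -> R -> R) (f : R -> R) :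
  (wint (fun z => (expR (- z))%:E) < +oo)%E ->
  (forall n, measurable_fun setT (q n)) -> measurable_fun setT f ->
  (forall n z, 0 <= z -> 0 <= q n z <= expR (- z)) ->
  (forall z, 0 <= z -> q n z @[n --> \oo] --> f z) ->
  wint (fun z => (q n z)%:E) @[n --> \oo] --> wint (fun z => (f z)%:E).
Proof.
move=> fin mq mf qb qf.
have [] := @dominated_convergence _ _ _ m setT measurableT
  (fun n w => ((k w)%:E * (q n (g w))%:E)%E) (fun w => ((k w)%:E * (f (g w))%:E)%E)
  (fun w => ((k w)%:E * (expR (- g w))%:E)%E).
- by move=> n; exact: measurable_wint_EFin.
- exact: measurable_wint_EFin.
- apply: aeW => w _; rewrite -EFinM; apply: cvg_EFin; first exact: nearW.
  have [kw|kw] := eqVneq (k w) 0.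
    by rewrite kw mul0r; apply: cvg_near_cst; apply: nearW => n /=; rewrite mul0r.
  by apply: cvgM; [exact: cvg_cst|exact/qf/kg].
- apply/integrableP; split.
    by apply: (@measurable_wint_EFin (fun z => expR (- z))); exact: measurableT_comp.
  rewrite (eq_integral (fun w => ((k w)%:E * (expR (- g w))%:E)%E))//.
  by move=> w _; rewrite gee0_abs// mule_ge0 ?lee_fin ?expR_ge0.
- apply: aeW => w n _; rewrite -!EFinM lee_fin.
  have [->|kw] := eqVneq (k w) 0; first by rewrite !mul0r normr0.
  have /andP[q0 q1] := qb n _ (kg kw).
  by rewrite ger0_norm ?mulr_ge0// ler_wpM2l.
- by [].
Qed.

End weighted_integral.

(** * Uniqueness of Laplace transforms *)

Section laplace_uniqueness.
Context {R : realType} {d1 d2 : measure_display}.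
Context {T1 : measurableType d1} {T2 : measurableType d2}.
Variables (m1 : {measure set T1 -> \bar R}) (k1 g1 : T1 -> R).
Variables (m2 : {measure set T2 -> \bar R}) (k2 g2 : T2 -> R).
Hypotheses (k10 : forall w, 0 <= k1 w) (mk1 : measurable_fun setT k1)
  (mg1 : measurable_fun setT g1) (kg1 : forall w, k1 w != 0 -> 0 <= g1 w).
Hypotheses (k20 : forall w, 0 <= k2 w) (mk2 : measurable_fun setT k2)
  (mg2 : measurable_fun setT g2) (kg2 : forall w, k2 w != 0 -> 0 <= g2 w).
Local Notation I1 := (wint m1 k1 g1).
Local Notation I2 := (wint m2 k2 g2).
Hypothesis lapE : forall l : R, 0 < l ->
  I1 (fun z => (expR (- (l * z)))%:E) = I2 (fun z => (expR (- (l * z)))%:E).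
Hypothesis lapF : forall l : R, 0 < l -> (I1 (fun z => (expR (- (l * z)))%:E) < +oo)%E.
Implicit Types (a b c z : R) (A : set R).

(** Finiteness is carried through the induction because the step cancels a summand; a is generalized
    because the step raises it to a + b. *)
Lemma wint_exp_binom_unique M a b : 0 < a -> 0 <= b ->
  I1 (fun z => (exp_binom a b M z)%:E) = I2 (fun z => (exp_binom a b M z)%:E) /\
  (I1 (fun z => (exp_binom a b M z)%:E) < +oo)%E.
Proof.
elim: M a b => [|M ih] a b a0 b0.
  by rewrite !wint_exp_binom0; split; [exact: lapE|exact: lapF].
have ge0 M' a' : (0 <= I1 (fun z => (exp_binom a' b M' z)%:E))%E.
  by apply: integral_ge0 => w _; rewrite -EFinM lee_fin wint_exp_binom_ge0.
have [e1 f1] := ih a b a0 b0.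
have [e2 f2] := ih (a + b) b (ltr_wpDr b0 a0) b0.
have H1 := wint_exp_binomS m1 k10 mk1 mg1 kg1 a M b0.
have H2 := wint_exp_binomS m2 k20 mk2 mg2 kg2 a M b0.
split; last by rewrite (le_lt_trans _ f1)// -H1 leeDl.
have fin : I1 (fun z => (exp_binom (a + b) b M z)%:E) \is a fin_num.
  by rewrite ge0_fin_numE.
by rewrite -[LHS](addeK _ fin) H1 e1 -H2 -e2 addeK.
Qed.

Lemma laplace1_lt : (I1 (fun z => (expR (- z))%:E) < +oo)%E.
Proof.
rewrite (_ : wint _ _ _ _ = I1 (fun z => (expR (- (1 * z)))%:E)); first exact: lapF.
by apply: eq_integral => w _; rewrite mul1r.
Qed.

Lemma laplace1E : I1 (fun z => (expR (- z))%:E) = I2 (fun z => (expR (- z))%:E).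
Proof.
have := lapE ltr01; rewrite (_ : (fun z => _) = fun z => (expR (- z))%:E)//.
by apply/funext => z; rewrite mul1r.
Qed.

Lemma measurable_exp_indic A : measurable A ->
  measurable_fun setT (fun z => expR (- z) * \1_A z).
Proof. by move=> mA; apply: measurable_funM => //; exact: measurableT_comp. Qed.

Lemma wint_limit_unique (q : nat -> R -> R) (f : R -> R) :
  (forall n, measurable_fun setT (q n)) -> measurable_fun setT f ->
  (forall n z, 0 <= z -> 0 <= q n z <= expR (- z)) ->
  (forall z, 0 <= z -> q n z @[n --> \oo] --> f z) ->
  (forall n, I1 (fun z => (q n z)%:E) = I2 (fun z => (q n z)%:E)) ->
  I1 (fun z => (f z)%:E) = I2 (fun z => (f z)%:E).
Proof.
move=> mq mf qb qf qE.
have c1 := wint_dct k10 mk1 mg1 kg1 laplace1_lt mq mf qb qf.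
have f2 : (I2 (fun z => (expR (- z))%:E) < +oo)%E by rewrite -laplace1E laplace1_lt.
have c2 := wint_dct k20 mk2 mg2 kg2 f2 mq mf qb qf.
by rewrite -(cvg_lim _ c1)// -(cvg_lim _ c2)//; congr (lim _); rewrite (funext qE).
Qed.

Lemma wint_ray_unique c :
  I1 (fun z => (expR (- z) * \1_(`]c, +oo[%classic) z)%:E) =
  I2 (fun z => (expR (- z) * \1_(`]c, +oo[%classic) z)%:E).
Proof.
have iE z : \1_(`]c, +oo[%classic) z = (c < z)%R%:R :> R.
  by rewrite indicE mem_setE in_itv/= andbT.
have mi := measurable_exp_indic (measurable_itv `]c, +oo[).
have [c0|c0|c0] := ltgtP c 0.
(* For c < 0 the half-line carries all the mass, since g >= 0 wherever k is nonzero. *)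
- have H d (T : measurableType d) (m : {measure set T -> \bar R}) (k g : T -> R) :
      (forall w, k w != 0 -> 0 <= g w) ->
      wint m k g (fun z => (expR (- z) * \1_(`]c, +oo[%classic) z)%:E) =
      wint m k g (fun z => (expR (- z))%:E).
    move=> kg; apply: eq_integral => w _; rewrite -!EFinM iE.
    have [->|kw] := eqVneq (k w) 0; first by rewrite !mul0r.
    by rewrite (lt_le_trans c0 (kg _ kw)) mulr1.
  by rewrite !H// laplace1E.
- apply: (@wint_limit_unique (fun n => exp_binom 1 (n%:R * (ln 2 / c)) (n * 2 ^ n))) => //.
  + by move=> n; exact: measurable_exp_binom.
  + move=> n z z0; rewrite -[in expR (- z)](mul1r z); apply: exp_binom_bound => //.
    by rewrite mulr_ge0// divr_ge0 ?ltW// ln_gt0// ltr1n.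
  + by move=> z z0; rewrite iE; exact: exp_binom_cvg_ray.
  + move=> n; apply: (wint_exp_binom_unique _ _ _).1 => //.
    by rewrite mulr_ge0// divr_ge0 ?ltW// ln_gt0// ltr1n.
- apply: (@wint_limit_unique (fun n => exp_binom 1 n%:R 1)) => //.
  + by move=> n; exact: measurable_exp_binom.
  + by move=> n z z0; rewrite -[in expR (- z)](mul1r z); apply: exp_binom_bound.
  + by move=> z z0; rewrite iE c0; exact: exp_binom_cvg_ray0.
  + by move=> n; apply: (wint_exp_binom_unique _ _ _).1.
Qed.

Lemma wint_indic_le d (T : measurableType d) (m : {measure set T -> \bar R}) (k g : T -> R) A :
  (forall w, 0 <= k w) -> measurable_fun setT k -> measurable_fun setT g ->
  measurable A ->
  (wint m k g (fun z => (expR (- z) * \1_A z)%:E) <= wint m k g (fun z => (expR (- z))%:E))%E.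
Proof.
move=> k0 mk mg mA; apply: ge0_le_integral => //.
- by move=> w _; rewrite -EFinM lee_fin !mulr_ge0 ?expR_ge0.
- exact: (measurable_wint_EFin mk mg (measurable_exp_indic mA)).
- apply: (@measurable_wint_EFin _ _ _ _ _ mk mg (fun z => expR (- z))).
  exact: measurableT_comp.
- by move=> w _; rewrite -!EFinM lee_fin ler_wpM2l// ger_pMr ?expR_gt0// indicE.
Qed.

(** The weight exp (-z) makes both measures finite, so the complement step of the Dynkin argument
    may subtract. *)
Lemma wint_indic_unique A : measurable A ->
  I1 (fun z => (expR (- z) * \1_A z)%:E) = I2 (fun z => (expR (- z) * \1_A z)%:E).
Proof.
move=> mA; pose P := [set A | I1 (fun z => (expR (- z) * \1_A z)%:E) =
  I2 (fun z => (expR (- z) * \1_A z)%:E)].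
have ge0 d (T : measurableType d) (m : {measure set T -> \bar R}) (k g : T -> R) B :
    (forall w, 0 <= k w) -> (0 <= wint m k g (fun z => (expR (- z) * \1_B z)%:E))%E.
  by move=> k0; apply: integral_ge0 => w _; rewrite -EFinM lee_fin !mulr_ge0 ?expR_ge0.
have sum d (T : measurableType d) (m : {measure set T -> \bar R}) (k g : T -> R) B :
    (forall w, 0 <= k w) -> measurable_fun setT k -> measurable_fun setT g ->
    measurable B ->
    (wint m k g (fun z => (expR (- z) * \1_(~` B) z)%:E) +
     wint m k g (fun z => (expR (- z) * \1_B z)%:E) =
     wint m k g (fun z => (expR (- z))%:E))%E.
  move=> k0 mk mg mB; rewrite /wint -ge0_integralD//.
  - apply: eq_integral => w _; rewrite -!EFinM -EFinD -!mulrDr !indicE in_setC.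
    by case: (_ \in B); rewrite /= ?addr0 ?add0r mulr1.
  - by move=> w _; rewrite -EFinM lee_fin !mulr_ge0 ?expR_ge0.
  - by apply: (measurable_wint_EFin mk mg (measurable_exp_indic (measurableC mB))).
  - by move=> w _; rewrite -EFinM lee_fin !mulr_ge0 ?expR_ge0.
  - by apply: (measurable_wint_EFin mk mg (measurable_exp_indic mB)).
suff : P A by [].
apply: (@dynkin_induction _ R (@RGenOInfty.G R) P (RGenOInfty.measurableE R)).
- move=> _ _ [x ->] [y ->]; exists (Num.max x y).
  apply/seteqP; split => z /=; rewrite !in_itv/= !andbT gt_max.
    by move=> [-> ->].
  by move=> /andP[].
- have H d (T : measurableType d) (m : {measure set T -> \bar R}) (k g : T -> R) :
      wint m k g (fun z => (expR (- z) * \1_[set: R] z)%:E) =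
      wint m k g (fun z => (expR (- z))%:E).
    by apply: eq_integral => w _; rewrite indicT mulr1.
  by rewrite /P /= !H laplace1E.
- by move=> _ [x ->]; exact: wint_ray_unique.
- move=> B mB; rewrite /P /= => PB.
  have fin : I1 (fun z => (expR (- z) * \1_B z)%:E) \is a fin_num.
    rewrite ge0_fin_numE ?ge0//; apply: (le_lt_trans _ laplace1_lt).
    exact: wint_indic_le.
  rewrite -[LHS](addeK _ fin) sum// laplace1E -(sum _ _ _ _ _ B k20)//.
  by rewrite PB addeK// -PB.
- move=> F mF tF PF; rewrite /P /=.
  have H d (T : measurableType d) (m : {measure set T -> \bar R}) (k g : T -> R) :
      (forall w, 0 <= k w) -> measurable_fun setT k -> measurable_fun setT g ->
      wint m k g (fun z => (expR (- z) * \1_(\bigcup_i F i) z)%:E) =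
      (\sum_(i <oo) wint m k g (fun z => (expR (- z) * \1_(F i) z)%:E))%E.
    move=> k0 mk mg; rewrite -integral_nneseries//.
    + apply: eq_integral => w _; rewrite -EFinM.
      under eq_eseriesr do rewrite -EFinM mulrA EFinM.
      rewrite nneseriesZl//.
      by rewrite mulrA EFinM indic_bigcup.
    + by move=> n; apply: (measurable_wint_EFin mk mg (measurable_exp_indic (mF n))).
    + by move=> n w _; rewrite -EFinM lee_fin !mulr_ge0 ?expR_ge0.
  rewrite !H//; apply: eq_eseriesr => i _; exact: PF.
- have /(congr1 (fun X => X A)) E := RGenOInfty.measurableE R.
  by move: mA; rewrite -[X in _ -> X]E.
Qed.

Import HBNNSimple.

Lemma wint_unique (f : R -> \bar R) : measurable_fun setT f -> (forall z, (0 <= f z)%E) ->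
  I1 f = I2 f.
Proof.
(* Sets are compared with the weight exp (-z), so the simple functions approximate exp (z) f instead
   of f. *)
move=> mf f0; pose F z := ((expR z)%:E * f z)%E.
have mF : measurable_fun setT F by apply: emeasurable_funM => //; exact/measurable_EFinP.
have F0 z : (0 <= F z)%E by rewrite mule_ge0// lee_fin expR_ge0.
pose G := nnsfun_approx measurableT mF.
have step d (T : measurableType d) (m : {measure set T -> \bar R}) (k g : T -> R) :
    (forall w, 0 <= k w) -> measurable_fun setT k -> measurable_fun setT g ->
    wint m k g (fun z => (expR (- z) * G n z)%:E) @[n --> \oo] --> wint m k g f.
  move=> k0 mk mg.
  rewrite (_ : wint m k g f = (\int[m]_w limn (fun n =>
     ((k w)%:E * (expR (- g w) * G n (g w))%:E)))%E).
    apply: cvg_monotone_convergence => //.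
    - move=> n; apply: (@measurable_wint_EFin _ _ _ _ _ mk mg (fun z => expR (- z) * G n z)).
      by apply: measurable_funM => //; exact: measurableT_comp.
    - by move=> n w _; rewrite -EFinM lee_fin !mulr_ge0 ?expR_ge0.
    - move=> w _ i j ij; rewrite -!EFinM lee_fin !ler_wpM2l ?expR_ge0//.
      exact/lefP/nd_nnsfun_approx.
  apply: eq_integral => w _; apply/esym/cvg_lim => //.
  apply: cvgeZl => //.
  rewrite (_ : f (g w) = (expR (- g w))%:E * F (g w))%E; last first.
    by rewrite /F muleA -EFinM -expRD addNr expR0 mul1e.
  under eq_cvg do rewrite EFinM.
  by apply: cvgeZl => //; apply: cvg_nnsfun_approx.
have simple d (T : measurableType d) (m : {measure set T -> \bar R}) (k g : T -> R) n :
    (forall w, 0 <= k w) -> measurable_fun setT k -> measurable_fun setT g ->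
    wint m k g (fun z => (expR (- z) * G n z)%:E) =
    (\sum_(r \in range (G n)) r%:E *
       wint m k g (fun z => (expR (- z) * \1_(G n @^-1` [set r]) z)%:E))%E.
  move=> k0 mk mg.
  have mE r : measurable_fun setT (fun w =>
      ((k w)%:E * (expR (- g w) * \1_(G n @^-1` [set r]) (g w))%:E)%E).
    by apply: (measurable_wint_EFin mk mg (measurable_exp_indic _)).
  transitivity (\int[m]_w (\sum_(r \in range (G n)) r%:E *
       ((k w)%:E * (expR (- g w) * \1_(G n @^-1` [set r]) (g w))%:E)))%E.
    apply: eq_integral => w _; rewrite -EFinM.
    transitivity (\sum_(r \in range (G n))
       (r * (k w * (expR (- g w) * \1_(G n @^-1` [set r]) (g w))))%:E)%E; last first.
      by apply: eq_fsbigr => r _; rewrite !EFinM.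
    rewrite fsumEFin// (fimfunE (G n)); congr EFin; rewrite mulrA !mulr_fsumr//.
    by apply: eq_fsbigr => r _; ring.
  rewrite ge0_integral_fsum//.
  - apply: eq_fsbigr => r; rewrite inE => -[z _ <-].
    by rewrite ge0_integralZl ?lee_fin// => w _; rewrite -EFinM lee_fin !mulr_ge0 ?expR_ge0.
  - by move=> r; apply: emeasurable_funM.
  - move=> r w _; rewrite -!EFinM lee_fin.
    have := nnfun_muleindic_ge0 (G n) r (g w); rewrite -EFinM lee_fin => ind0.
    rewrite [leRHS](_ : _ = (k w * expR (- g w)) * (r * \1_(G n @^-1` [set r]) (g w))).
      by apply: mulr_ge0; [apply: mulr_ge0; [exact: k0|exact: expR_ge0]|exact: ind0].
    by ring.
have c1 := step _ _ m1 _ _ k10 mk1 mg1; have c2 := step _ _ m2 _ _ k20 mk2 mg2.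
rewrite -(cvg_lim _ c1)// -(cvg_lim _ c2)//.
rewrite (_ : (fun n => I1 _) = fun n => I2 (fun z => (expR (- z) * G n z)%:E))//.
apply/funext => n; rewrite !simple//; apply: eq_fsbigr => r _.
by rewrite wint_indic_unique.
Qed.

End laplace_uniqueness.

(** * Translation invariance of Lebesgue measure *)

Section lebesgue_shift.
Context {R : realType}.
Local Notation leb := (@lebesgue_measure R).

Lemma lebesgue_measure_shift (y : R) (A : set R) : measurable A ->
  leb A = leb ((fun z => z + y) @^-1` A).
Proof.
move=> mA; have ms : measurable_fun setT (fun z : R => z + y) by exact: measurable_funD.
have [nu nuE] := @pushforward_measure_ex _ _ (measurableTypeR R) (measurableTypeR R) R
  leb (fun z => z + y) ms.
rewrite -nuE; apply: (@lebesgue_measure_unique R nu) => // _ [[a b] _ <-]; rewrite nuE.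
rewrite (_ : _ @^-1` _ = `](a - y), (b - y)]%classic).
  rewrite /= !lebesgue_measure_itv/= !lte_fin ltrD2r; case: ifP => // _.
  by rewrite -!EFinD; congr EFin; ring.
by apply/seteqP; split => z /=; rewrite !in_itv/= ltrBlDr lerBrDr.
Qed.

Lemma ge0_integral_shift (y : R) (f : R -> \bar R) :
  measurable_fun setT f -> (forall z, (0 <= f z)%E) ->
  (\int[leb]_z f (z + y)%R = \int[leb]_z f z)%E.
Proof.
move=> mf f0; have ms : measurable_fun setT (fun z : R => z + y) by exact: measurable_funD.
rewrite [RHS](@eq_measure_integral _ (measurableTypeR R) R setT
  (@pushforward _ _ (measurableTypeR R) (measurableTypeR R) R leb (fun z => z + y))).
  by rewrite ge0_integral_pushforward.
by move=> A mA _; exact: lebesgue_measure_shift.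
Qed.

End lebesgue_shift.

(** * Sign, monotonicity and transforms of the scale function *)

Section scale_function.
Context {R : realType}.
Local Notation leb := (@lebesgue_measure R).
Variables (psi W : R -> R).
Hypothesis psi_ge0 : forall l, 0 < l -> 0 <= psi l.
Hypothesis HW : scale_function psi W.

Let W_lt0 x : x < 0 -> W x = 0. Proof. by case: HW => H _; exact: H. Qed.

Let W_incr a b : 0 <= a -> a < b -> W a < W b.
Proof. by case: HW => _ [_ [H _]]; exact: H. Qed.

Let W_laplace q : 0 < q ->
  (\int[leb]_(y in `[0%R, +oo[) (expR (- (q * y)) * W y)%:E = (psi q)^-1%:E)%E.
Proof. by case: HW => _ [_ [_ H]]; exact: H. Qed.

Let W_le a b : 0 <= a -> a <= b -> W a <= W b.
Proof.
by move=> a0; rewrite le_eqVlt => /predU1P[->//|ab]; exact/ltW/W_incr.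
Qed.

Let mW0 : measurable_fun (`[0, +oo[ : set R) W.
Proof.
apply: (@eq_measurable_fun _ _ R R (`[0, +oo[ : set R) (fun x => W (Num.max x 0))).
  by move=> x; rewrite inE/= in_itv/= andbT => x0; rewrite max_l.
apply: nondecreasing_measurable => // a b ab.
by apply: W_le; [rewrite le_max lexx orbT|rewrite ge_max !le_max ab lexx !orbT].
Qed.

Let mWe q : measurable_fun (`[0, +oo[ : set R) (fun y => expR (- (q * y)) * W y).
Proof.
apply: measurable_funM => //; apply: measurable_funTS; apply: measurableT_comp => //.
by apply: measurableT_comp => //; exact: measurable_funM.
Qed.

Let Ip q : \bar R := (\int[leb]_(y in `[0%R, +oo[) (expR (- (q * y)) * Num.max (W y) 0)%:E)%E.
Let In q : \bar R := (\int[leb]_(y in `[0%R, +oo[) (expR (- (q * y)) * Num.max (- W y) 0)%:E)%E.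

Let mWm q : measurable_fun (`[0, +oo[ : set R)
  (fun y => (expR (- (q * y)) * Num.max (- W y) 0)%:E).
Proof.
apply/measurable_EFinP; apply: measurable_funM.
  apply: measurable_funTS; apply: measurableT_comp => //.
  by apply: measurableT_comp => //; exact: measurable_funM.
by apply: measurable_maxr => //; exact: measurable_funN.
Qed.

Let mWp q : measurable_fun (`[0, +oo[ : set R)
  (fun y => (expR (- (q * y)) * Num.max (W y) 0)%:E).
Proof.
apply/measurable_EFinP; apply: measurable_funM.
  apply: measurable_funTS; apply: measurableT_comp => //.
  by apply: measurableT_comp => //; exact: measurable_funM.
by apply: measurable_maxr.
Qed.

Let Ip_ge0 q : (0 <= Ip q)%E.
Proof.
apply: integral_ge0 => y _.
by rewrite lee_fin mulr_ge0 ?expR_ge0// le_max lexx orbT.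
Qed.

Let In_ge0 q : (0 <= In q)%E.
Proof.
apply: integral_ge0 => y _.
by rewrite lee_fin mulr_ge0 ?expR_ge0// le_max lexx orbT.
Qed.

(** The transform is a finite nonnegative number, which forces its positive part to be finite and to
    dominate its negative part. *)
Let In_le q : 0 < q -> (In q <= Ip q)%E /\ (Ip q < +oo)%E.
Proof.
move=> q0; have := W_laplace q0; rewrite integralE.
have -> : (\int[leb]_(y in `[0%R, +oo[) (fun y => (expR (- (q * y)) * W y)%:E)^\+ y = Ip q)%E.
  apply: eq_integral => y _; rewrite funeposE -EFin_max; congr EFin.
  by rewrite -[in LHS](mulr0 (expR (- (q * y)))) maxr_pMr ?expR_ge0.
have -> : (\int[leb]_(y in `[0%R, +oo[) (fun y => (expR (- (q * y)) * W y)%:E)^\- y = In q)%E.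
  apply: eq_integral => y _; rewrite funenegE -EFinN -EFin_max; congr EFin.
  by rewrite -[in LHS](mulr0 (expR (- (q * y)))) -mulrN maxr_pMr ?expR_ge0.
have : 0 <= (psi q)^-1 by rewrite invr_ge0 psi_ge0.
have := Ip_ge0 q; have := In_ge0 q.
case: (Ip q) => [r||] //; case: (In q) => [s||] // _ _ v0.
- move=> [E]; split; last exact: ltry.
  by rewrite lee_fin -subr_ge0 E.
Qed.

(** The definition does not prescribe the sign of W at 0. If W 0 < 0, then W is negative on some
    [0, del]. As q grows, the negative part of the transform is at least of order exp (-q del / 2),
    while the positive part lives beyond del and is of order at most exp (-q del); so the transform
    would become negative. *)
Lemma scale_function0_ge0 : 0 <= W 0.
Proof.
rewrite leNgt; apply/negP => W00.
have [del del0 Wdel] : exists2 del, 0 < del & W del < 0.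
  case: HW => _ [cW _].
  have [_ cW0] := (continuous_within_itvcyP _ _).1 cW.
  have [/= e e0 H] := cvgr_lt _ cW0 _ W00.
  exists (e / 2); first by rewrite divr_gt0.
  by apply: H; rewrite ?divr_gt0// /ball_/= sub0r normrN gtr0_norm ?divr_gt0//; lra.
pose c := - W del; have c0 : 0 < c by rewrite oppr_gt0.
have [_ A1] := In_le ltr01; pose A := fine (Ip 1).
have AE : Ip 1 = A%:E by rewrite fineK// ge0_fin_numE.
have A0 : 0 <= A by rewrite -lee_fin -AE.
have up q : 1 <= q -> (Ip q <= (expR (- ((q - 1) * del)))%:E * Ip 1)%E.
  move=> q1; rewrite -ge0_integralZl//; first last.
  - by move=> y _; rewrite lee_fin mulr_ge0 ?expR_ge0// le_max lexx orbT.
  - exact: mWp.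
  apply: ge0_le_integral => //.
  - by move=> y _; rewrite lee_fin mulr_ge0 ?expR_ge0// le_max lexx orbT.
  - exact: mWp.
  - by apply: emeasurable_funM => //; exact: mWp.
  move=> y; rewrite /= in_itv/= andbT => y0; rewrite -EFinM lee_fin mulrA.
  have [yd|dy] := leP y del.
    by rewrite max_r ?mulr0// (le_trans (W_le y0 yd))// ltW.
  rewrite ler_wpM2r ?le_max ?lexx ?orbT// -expRD ler_expR.
  rewrite -subr_ge0 (_ : _ - _ = (q - 1) * (y - del)); last by ring.
  by rewrite mulr_ge0 ?subr_ge0// ltW.
have lo q : 0 < q -> ((expR (- (q * (del / 2))) * c * (del / 2))%:E <= In q)%E.
  move=> q0.
  apply: (@le_trans _ _ (\int[leb]_(y in `[0%R, (del / 2)%R]) (expR (- (q * (del / 2))) * c)%:E)%E).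
    rewrite integral_cst//= lebesgue_measure_itv/= lte_fin divr_gt0// -EFinB subr0.
    by rewrite -EFinM.
  apply: (@le_trans _ _ (\int[leb]_(y in `[0%R, (del / 2)%R])
     (expR (- (q * y)) * Num.max (- W y) 0)%:E)%E); last first.
    apply: ge0_subset_integral => //.
    - exact: mWm.
    - by move=> y _; rewrite lee_fin mulr_ge0 ?expR_ge0// le_max lexx orbT.
    - by move=> y /=; rewrite !in_itv/= => /andP[-> _].
  apply: ge0_le_integral => //.
  - by move=> y _; rewrite lee_fin mulr_ge0 ?expR_ge0// ltW.
  - apply: measurable_funS (mWm q) => //.
    by move=> y /=; rewrite !in_itv/= => /andP[-> _].
  move=> y; rewrite /= in_itv/= => /andP[y0 yd]; rewrite lee_fin.
  rewrite ler_pM ?expR_ge0// ?(ltW c0)//.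
    by rewrite ler_expR lerN2 ler_wpM2l// ltW.
  by rewrite le_max lerN2 W_le//; lra.
have key q : 1 <= q -> expR (q * (del / 2)) * (c * (del / 2)) <= expR del * A.
  move=> q1; have q0 : 0 < q by lra.
  have := le_trans (lo q q0) (le_trans (In_le q0).1 (up q q1)).
  rewrite AE -EFinM lee_fin => H.
  have := H; rewrite -(ler_pM2l (expR_gt0 (q * del))).
  have -> : expR (q * del) * (expR (- (q * (del / 2))) * c * (del / 2)) =
      expR (q * (del / 2)) * (c * (del / 2)).
    have E : expR (q * del) * expR (- (q * (del / 2))) = expR (q * (del / 2)).
      by rewrite -expRD; congr expR; field.
    by rewrite -E; ring.
  have -> // : expR (q * del) * (expR (- ((q - 1) * del)) * A) = expR del * A.
  by rewrite mulrA -expRD; congr (expR _ * _); ring.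
pose a := c * (del / 2); have a0 : 0 < a by rewrite mulr_gt0// divr_gt0.
pose B := expR del * A; have B0 : 0 <= B by rewrite mulr_ge0 ?expR_ge0.
(* Chosen so that [q * (del / 2)] exceeds [B / a], which contradicts [key] through
   [expR x >= 1 + x]. *)
pose q := 1 + B / a / (del / 2).
have d20 : 0 < del / 2 by rewrite divr_gt0.
have q1 : 1 <= q by rewrite lerDl !divr_ge0// ltW.
have := key q q1; rewrite -/a -/B leNgt => /negP; apply.
rewrite -ltr_pdivrMr// (lt_le_trans _ (expR_ge1Dx _))//.
by rewrite /q mulrDl divfK ?gt_eqF// mul1r; lra.
Qed.

Lemma scale_function_homo : {homo W : a b / a <= b}.
Proof.
move=> a b ab; have [a0|a0] := leP 0 a; first exact: W_le.
rewrite (W_lt0 a0); have [b0|b0] := ltP b 0; first by rewrite W_lt0.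
exact: (le_trans scale_function0_ge0 (W_le _ b0)).
Qed.

Lemma scale_function_ge0 x : 0 <= W x.
Proof.
have [x0|x0] := ltP x 0; first by rewrite W_lt0.
exact: (le_trans scale_function0_ge0 (scale_function_homo x0)).
Qed.

Lemma measurable_scale_function : measurable_fun setT W.
Proof. by apply: nondecreasing_measurable => //; exact: scale_function_homo. Qed.

Lemma measurable_scale_exp q : measurable_fun setT (fun y : R => (expR (- (q * y)) * W y)%:E).
Proof.
apply/measurable_EFinP; apply: measurable_funM; last exact: measurable_scale_function.
by apply: measurableT_comp => //; apply: measurableT_comp => //; exact: measurable_funM.
Qed.

(** The inverse of [psi q] is the integral of a nonnegative function that is positive on [1, 2]. A
    vanishing [psi q] would have inverse 0 by convention. *)
Lemma scale_function_psi_gt0 q : 0 < q -> 0 < psi q.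
Proof.
move=> q0; rewrite -invr_gt0 -lte_fin -(W_laplace q0).
apply: (@lt_le_trans _ _ (\int[leb]_(y in `[1%R, 2%R]) (expR (- (q * 2)) * W 1)%:E)%E).
  rewrite integral_cst//= lebesgue_measure_itv/= lte_fin ltr1n -EFinB -EFinM lte_fin.
  apply: mulr_gt0; last by lra.
  by rewrite mulr_gt0 ?expR_gt0// (le_lt_trans scale_function0_ge0)// W_incr.
apply: (@le_trans _ _ (\int[leb]_(y in `[1%R, 2%R]) (expR (- (q * y)) * W y)%:E)%E).
  apply: ge0_le_integral => //.
  - by move=> y _; rewrite lee_fin mulr_ge0 ?expR_ge0 ?scale_function_ge0.
  - by apply: measurable_funTS; exact: measurable_scale_exp.
  move=> y; rewrite /= in_itv/= => /andP[y1 y2]; rewrite lee_fin.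
  rewrite ler_pM ?expR_ge0 ?scale_function_ge0//; last exact: scale_function_homo.
  by rewrite ler_expR lerN2 ler_wpM2l// ltW.
apply: ge0_subset_integral => //.
- by apply: measurable_funTS; exact: measurable_scale_exp.
- by move=> y _; rewrite lee_fin mulr_ge0 ?expR_ge0 ?scale_function_ge0.
- by move=> y /=; rewrite !in_itv/= andbT => /andP[y1 _]; rewrite (le_trans _ y1).
Qed.

Lemma scale_laplace q : 0 < q ->
  (\int[leb]_y (expR (- (q * y)) * W y)%:E = (psi q)^-1%:E)%E.
Proof.
move=> q0; rewrite -(W_laplace q0) [RHS]integral_mkcond; apply: eq_integral => y _.
rewrite patchE; case: ifPn => //; rewrite notin_setE /= in_itv/= andbT => /negP.
by rewrite -ltNge => y0; rewrite W_lt0// mulr0.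
Qed.

Lemma scale_shift_laplace q y : 0 < q ->
  (\int[leb]_z (expR (- (q * z)) * W (z - y))%:E = (expR (- (q * y)) / psi q)%:E)%E.
Proof.
move=> q0; have e0 : (0 <= (expR (- (q * y)))%:E)%E by rewrite lee_fin expR_ge0.
rewrite [RHS]EFinM -(scale_laplace q0) -ge0_integralZl//; first last.
- by move=> z _; rewrite lee_fin mulr_ge0 ?expR_ge0 ?scale_function_ge0.
- exact: measurable_scale_exp.
rewrite -[RHS](ge0_integral_shift (- y)).
- apply: eq_integral => z _; rewrite -EFinM mulrA -expRD; congr (expR _ * _)%:E; ring.
- by apply: emeasurable_funM => //; exact: measurable_scale_exp.
- by move=> z; rewrite -EFinM lee_fin !mulr_ge0 ?expR_ge0 ?scale_function_ge0.
Qed.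

End scale_function.

(** * The density of the killed potential *)

Section potential_density.
Context {R : realType}.
Local Notation path := (rcpath R).
Local Notation pathT := (rcpathT R).
Local Notation leb := (@lebesgue_measure R).
Variables (mu : probability pathT R) (psi W : R -> R) (C : R).
Hypotheses (smu : sii mu) (lap1 : laplace_at mu psi 1)
  (psi_ge0 : forall l, 0 < l -> 0 <= psi l)
  (psi_le : forall l, 1 <= l -> psi l <= C * l ^+ 2)
  (HW : scale_function psi W).

Lemma measurable_killed_integrand y (f : R -> \bar R) : measurable_fun setT f ->
  measurable_fun setT (fun z : pathT * R =>
    ((calive y (z.1 : path) z.2)%:R%:E * f (y + (z.1 : path) z.2)%R)%E).
Proof.
move=> mf; apply: emeasurable_funM.
  apply/measurable_EFinP; apply: (@measurableT_comp _ _ _ _ _ _ (fun b : bool => b%:R : R)) => //.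
  exact: measurable_calive.
apply: measurableT_comp => //; apply: measurable_funD => //.
exact: measurable_rcpath_evalP.
Qed.

Lemma killed_integrand_ge0 y (f : R -> \bar R) (p : path) t : (forall z, (0 <= f z)%E) ->
  (0 <= (calive y p t)%:R%:E * f (y + p t)%R)%E.
Proof. by move=> f0; rewrite mule_ge0// lee_fin. Qed.

Lemma killed_occ_ge0 y (f : R -> \bar R) p : (forall z, (0 <= f z)%E) ->
  (0 <= killed_occ y f p)%E.
Proof. by move=> f0; apply: integral_ge0 => t _; exact: killed_integrand_ge0. Qed.

Lemma measurable_killed_occ y (f : R -> \bar R) : measurable_fun setT f ->
  (forall z, (0 <= f z)%E) -> measurable_fun setT (killed_occ y f).
Proof.
move=> mf f0.
have H := @measurable_fun_fubini_tonelli_F _ _ pathT (measurableTypeR R) R leb _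
  (measurable_killed_integrand y mf).
by apply: H => z; exact: killed_integrand_ge0.
Qed.

Lemma killed_potential_wint y (f : R -> \bar R) : measurable_fun setT f ->
  (forall z, (0 <= f z)%E) ->
  killed_potential mu y f = wint (mu \x leb)%E
    (fun z => (calive y (z.1 : path) z.2)%:R) (fun z => y + (z.1 : path) z.2) f.
Proof.
move=> mf f0; rewrite /wint fubini_tonelli1//; first exact: measurable_killed_integrand.
by move=> z; exact: killed_integrand_ge0.
Qed.

Lemma killed_potentialE y (f : R -> \bar R) : 0 <= y -> measurable_fun setT f ->
  (forall z, (0 <= f z)%E) ->
  killed_potential mu y f = (\int[leb]_z ((W z - W (z - y))%:E * f z))%E.
Proof.
move=> y0 mf f0; rewrite killed_potential_wint//.
have psi_gt0 := scale_function_psi_gt0 psi_ge0 HW.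
have mW := measurable_scale_function psi_ge0 HW.
have W0 := scale_function_ge0 psi_ge0 HW.
have mWy : measurable_fun setT (fun z : R => W (z - y)).
  by apply: measurableT_comp => //; exact: measurable_funB.
have Wy z : 0 <= W z - W (z - y).
  by rewrite subr_ge0 (scale_function_homo psi_ge0 HW)// gerBl.
have mer l : measurable_fun setT (fun z : R => expR (- (l * z))).
  apply: measurableT_comp => //.
  by apply: measurableT_comp => //; exact: measurable_funM.
have me l : measurable_fun setT (fun z : R => (expR (- (l * z)))%:E).
  exact/measurable_EFinP.
have mD : measurable_fun setT (fun z : R => (W z - W (z - y))%:E).
  by apply/measurable_EFinP; exact: measurable_funB.
have e0 l z : (0 <= (expR (- (l * z)) : R)%:E)%E by rewrite lee_fin expR_ge0.
have E1 l : 0 < l -> wint (mu \x leb)%E (fun z => (calive y (z.1 : path) z.2)%:R)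
    (fun z => y + (z.1 : path) z.2) (fun z => (expR (- (l * z)))%:E) =
    ((1 - expR (- (l * y))) / psi l)%:E.
  move=> l0; rewrite -killed_potential_wint//.
  exact: (killed_potential_exp smu lap1 psi_gt0 psi_le).
have E2 l : 0 < l -> wint leb (fun z => W z - W (z - y)) id
    (fun z => (expR (- (l * z)))%:E) = ((1 - expR (- (l * y))) / psi l)%:E.
  move=> l0; have sh := scale_shift_laplace psi_ge0 HW y l0.
  have := scale_laplace HW l0.
  (* W is written as a sum containing the density: the integrals stay nonnegative, and only a finite
     term is subtracted at the end. *)
  have -> : (\int[leb]_z (expR (- (l * z)) * W z)%:E =
      \int[leb]_z ((W z - W (z - y))%:E * (expR (- (l * z)))%:E +
        (expR (- (l * z)) * W (z - y))%:E))%E.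
    by apply: eq_integral => z _; rewrite -EFinM -EFinD; congr EFin; ring.
  rewrite ge0_integralD//; first last.
  - by apply/measurable_EFinP; apply: measurable_funM; [exact: mer|exact: mWy].
  - by move=> z _; rewrite lee_fin mulr_ge0 ?expR_ge0.
  - by apply: emeasurable_funM; [exact: mD|exact: me].
  - by move=> z _; rewrite -EFinM lee_fin mulr_ge0 ?expR_ge0.
  rewrite sh => /(congr1 (fun t => t - (expR (- (l * y)) / psi l)%:E)%E).
  rewrite addeK// -EFinB => H; apply: (eq_trans H); congr EFin.
  by rewrite mulrBl mul1r.
apply: (@wint_unique _ _ _ _ _ (mu \x leb)%E _ _ leb _ _) => //.
- apply: (@measurableT_comp _ _ _ _ _ _ (fun b : bool => b%:R : R)) => //.
  exact: measurable_calive.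
- by apply: measurable_funD => //; exact: measurable_rcpath_evalP.
- move=> [p t] /=; case: (boolP (calive y _ t)) => [pt _|_]; first exact: calive_ge0 pt.
  by rewrite eqxx.
- exact: measurable_funB.
(* Below 0 both terms of the density vanish, because y >= 0. *)
- move=> z; have [z0|//] := ltP z 0; case: HW => Wlt _.
  by rewrite !Wlt ?subrr ?eqxx// ltrBlDr ltr_wpDr.
- by move=> l l0; rewrite E1// E2.
- by move=> l l0; rewrite E1// ltry.
Qed.

End potential_density.

(** * The integral of a exp (-B) for a primitive B of a *)

Section exponential_primitive.
Context {R : realType}.
Local Notation leb := (@lebesgue_measure R).
Variable a : R -> R.
Hypotheses (a0 : forall s, 0 <= a s) (ma : measurable_fun setT a)
  (aneg : forall s, s < 0 -> a s = 0) (afin : (\int[leb]_s (a s)%:E < +oo)%E).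

Definition primitive (t : R) : R := (\int[leb]_(s in `[0, t]) a s)%R.
Local Notation B := primitive.

Let ia (D : set (measurableTypeR R)) : measurable D -> leb.-integrable D (EFin \o a).
Proof.
move=> mD; apply: (@integrableS _ _ _ _ setT) => //.
apply/integrableP; split; first exact/measurable_EFinP.
by under eq_integral do rewrite /= ger0_norm//.
Qed.

Lemma primitive_ge0 t : 0 <= B t.
Proof. by apply: Rintegral_ge0. Qed.

Lemma primitiveB u v : 0 <= u -> u <= v ->
  B v - B u = (\int[leb]_(s in `]u, v]) a s)%R.
Proof. by move=> u0 uv; rewrite Rintegral_itvB ?bnd_simp//; exact: ia. Qed.

Lemma primitive_homo : {homo B : u v / u <= v}.
Proof.
move=> u v uv; have [u0|u0] := leP 0 u.
  by rewrite -subr_ge0 primitiveB//; apply: Rintegral_ge0.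
rewrite {1}/primitive set_itv_ge ?Rintegral_set0 ?primitive_ge0//.
by rewrite bnd_simp -ltNge.
Qed.

Lemma measurable_primitive : measurable_fun setT B.
Proof. by apply: nondecreasing_measurable => //; exact: primitive_homo. Qed.

Let ae s := a s * expR (- B s).

Let mae : measurable_fun setT ae.
Proof.
apply: measurable_funM => //; apply: measurableT_comp => //.
by apply: measurableT_comp => //; exact: measurable_primitive.
Qed.

Let ae_ge0 s : 0 <= ae s. Proof. by rewrite mulr_ge0 ?expR_ge0. Qed.

Let iae (D : set (measurableTypeR R)) : measurable D -> leb.-integrable D (EFin \o ae).
Proof.
move=> mD; apply: le_integrable (ia mD) => //; last move=> s _.
  by apply/measurable_EFinP; exact: measurable_funTS.
rewrite /= lee_fin !ger0_norm ?ae_ge0// /ae -[leRHS]mulr1 ler_wpM2l//.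
by rewrite -[leRHS]expR0 ler_expR oppr_le0 primitive_ge0.
Qed.

Let E (t : R) : R := (\int[leb]_(s in `[0, t]) ae s)%R.

(** B is monotone, so exp (-B) lies between its values at the endpoints. *)
Let E_bounds u v : 0 <= u -> u <= v ->
  expR (- B v) * (B v - B u) <= E v - E u <= expR (- B u) * (B v - B u).
Proof.
move=> u0 uv.
have mD : measurable (`]u, v]%classic : set (measurableTypeR R)) by exact: measurable_itv.
rewrite primitiveB// /E Rintegral_itvB ?bnd_simp//; last exact: iae.
rewrite -!RintegralZl//; do ?exact: ia.
have iZ (r : R) : leb.-integrable (`]u, v]%classic : set (measurableTypeR R))
    (EFin \o (fun s => r * a s)).
  exact: (integrableZl mD r (ia mD)).
apply/andP; split; apply: le_Rintegral => //; do ?exact: iae.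
- move=> s /=; rewrite in_itv/= => /andP[us sv]; rewrite /ae mulrC ler_wpM2l//.
  by rewrite ler_expR lerN2 primitive_homo.
- move=> s /=; rewrite in_itv/= => /andP[us sv]; rewrite /ae [leRHS]mulrC ler_wpM2l//.
  by rewrite ler_expR lerN2 primitive_homo// ltW.
Qed.

(** The defect of the identity to be proved. As a is merely integrable, B need not be differentiable
    at every point; the defect is bounded by squared increments of B instead of being
    differentiated. *)
Let D t := E t - (1 - expR (- B t)).

(* Halving the increment of B (intermediate value theorem) gains a factor 1/2 each time. *)
Let D_bound n u v : 0 <= u -> u <= v -> `|D v - D u| <= (B v - B u) ^+ 2 / 2 ^+ n.
Proof.
elim: n u v => [|n ih] u v u0 uv.
  (* With x the increment of B, both E and 1 - exp (-B) increase by an amount between exp (-B v) x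
     and exp (-B u) x, and these bounds differ by at most x^2. *)
  have /andP[l1 l2] := E_bounds u0 uv.
  set x := B v - B u in l1 l2 *; have xE : x = B v - B u by [].
  clearbody x; have x0 : 0 <= x by rewrite xE subr_ge0 primitive_homo.
  have Ev : expR (- B v) = expR (- B u) * expR (- x).
    by rewrite -expRD; congr expR; rewrite xE; ring.
  have h1 : 1 - expR (- x) <= x by rewrite lerBlDl -lerBlDr; exact: expR_ge1Dx.
  have h2 : expR (- x) * x <= 1 - expR (- x).
    have ep' : 0 < expR x by exact: expR_gt0.
    have := expR_ge1Dx x; rewrite expRN => H.
    by rewrite -(ler_pM2l ep') mulrBr mulrA divff ?gt_eqF// mul1r mulr1 lerBrDl.
  have Eu1 : expR (- B u) <= 1 by rewrite -[leRHS]expR0 ler_expR oppr_le0 primitive_ge0.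
  have Eu0 : 0 <= expR (- B u) by exact: expR_ge0.
  have m1 : expR (- B u) * (expR (- x) * x) <= expR (- B u) * (1 - expR (- x)).
    by rewrite ler_wpM2l.
  have m2 : expR (- B u) * (1 - expR (- x)) <= expR (- B u) * x by rewrite ler_wpM2l.
  have m3 : expR (- B u) * ((1 - expR (- x)) * x) <= x ^+ 2.
    rewrite expr2 mulrA ler_wpM2r// (le_trans _ h1)// ler_piMl// subr_ge0.
    by rewrite -[leRHS]expR0 ler_expR oppr_le0.
  rewrite expr0 divr1 /D Ev ler_norml; rewrite Ev in l1.
  move: l1 l2 m1 m2 m3; clear.
  move: (expR (- B u)) (expR (- x)) (E v) (E u) => eu ex Ev Eu.
  rewrite !mulrA mulrBr mulr1 => l1 l2 m1 m2; rewrite mulrBl => m3.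
  by apply/andP; split; lra.
have cB : {within `[u, v], continuous B}.
  apply: (@continuous_subspaceW _ _ _ `[0, v]).
    by move=> t /=; rewrite !in_itv/= => /andP[ut ->]; rewrite (le_trans u0 ut).
  apply: (@parameterized_integral_continuous R 0 v a); first exact: le_trans uv.
  exact: ia.
have Buv := primitive_homo uv.
have [m] : exists2 m, m \in `[u, v] & B m = (B u + B v) / 2.
  by apply: IVT => //; rewrite (min_l Buv) (max_r Buv); apply/andP; split; lra.
rewrite in_itv/= => /andP[um mv] Bm.
have H1 := ih u m u0 um; have H2 := ih m v (le_trans u0 um) mv.
have -> : D v - D u = (D v - D m) + (D m - D u) by rewrite addrA subrK.
apply: (le_trans (ler_normD _ _)); apply: (le_trans (lerD H2 H1)).
rewrite Bm [2 ^+ n.+1]exprS; have := @expf_neq0 R 2 n; rewrite pnatr_eq0 => /(_ isT).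
move: (B u) (B v) (2 ^+ n) => x z w w0.
by rewrite le_eqVlt; apply/orP; left; apply/eqP; field.
Qed.

Let E_eq t : 0 <= t -> E t = 1 - expR (- B t).
Proof.
move=> t0; have D0 : D 0 = 0.
  rewrite /D /E /primitive set_itv1 !Rintegral_set1.
  by rewrite oppr0 expR0 !subrr.
apply/eqP; rewrite -subr_eq0 -/(D t) -normr_le0.
have cv : (B t - B 0) ^+ 2 / 2 ^+ n @[n --> \oo] --> (B t - B 0) ^+ 2 * 0.
  apply: cvgM; first exact: cvg_cst.
  rewrite (_ : (fun n => _) = (fun n => 2^-1 ^+ n)); last by apply/funext => n; rewrite exprVn.
  by apply: cvg_expr; rewrite gtr0_norm// invf_lt1 ?ltr1n.
rewrite -(mulr0 ((B t - B 0) ^+ 2)); apply: (ler_cvg_to (cvg_cst _) cv).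
by apply: nearW => n; have := D_bound n (lexx 0) t0; rewrite D0 subr0.
Qed.

Lemma integral_primitive t : (\int[leb]_(s in `[0%R, t]) (a s)%:E = (B t)%:E)%E.
Proof. by rewrite fineK//; apply: integrable_fin_num => //; exact: ia. Qed.

Lemma integral_exp_primitive t : 0 <= t ->
  (\int[leb]_(s in `[0%R, t]) (a s * expR (- B s))%:E = (1 - expR (- B t))%:E)%E.
Proof.
by move=> t0; rewrite -E_eq// fineK//; apply: integrable_fin_num => //; exact: iae.
Qed.

Lemma integral_exp_primitiveT :
  (\int[leb]_s (a s * expR (- B s))%:E =
   (1 - expR (- fine (\int[leb]_s (a s)%:E)%E))%:E)%E.
Proof.
have full (f : R -> R) : (forall s, s < 0 -> f s = 0) -> (forall s, 0 <= f s) ->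
    measurable_fun setT f ->
    (\int[leb]_(s in `[0%R, n%:R]) (f s)%:E)%E @[n --> \oo] --> (\int[leb]_s (f s)%:E)%E.
  move=> fneg f0 mf.
  rewrite (_ : integral _ setT _ = (\int[leb]_(s in `[0%R, +oo[) (f s)%:E)%E).
    exact: ge0_cvgn_integral.
  rewrite [RHS]integral_mkcond; apply: eq_integral => s _; rewrite patchE.
  case: ifPn => //; rewrite notin_setE /= in_itv/= andbT => /negP.
  by rewrite -ltNge => s0; rewrite fneg.
have c1 : (B n%:R)%:E @[n --> \oo] --> (\int[leb]_s (a s)%:E)%E.
  rewrite (_ : (fun n => _) = (fun n => (\int[leb]_(s in `[0%R, n%:R]) (a s)%:E)%E)).
    exact: full.
  by apply/funext => n; rewrite integral_primitive.
have c2 := full ae _ ae_ge0 mae.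
rewrite -(cvg_lim _ (c2 _))//; last by move=> s s0; rewrite /ae aneg// mul0r.
apply/cvg_lim => //.
rewrite (_ : (fun n => _) = (fun n => (1 - expR (- B n%:R))%:E)); last first.
  by apply/funext => n; rewrite integral_exp_primitive.
apply: cvg_EFin; first exact: nearW.
apply: cvgB; first exact: cvg_cst.
apply: continuous_cvg; first exact: continuous_expR.
apply: cvgN; apply: (@fine_cvg _ _ _ _ (fun n => (B n%:R)%:E)); rewrite fineK//.
by rewrite ge0_fin_numE// integral_ge0// => s _; rewrite lee_fin.
Qed.

End exponential_primitive.

(** * The Feynman-Kac identity for the killed path *)

Section feynman_kac.
Context {R : realType}.
Local Notation path := (rcpath R).
Local Notation pathT := (rcpathT R).
Local Notation leb := (@lebesgue_measure R).

Lemma calive_cat y s r (p q : path) : 0 <= s -> 0 <= r ->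
  calive y (rcpath_cat s p q : path) (s + r) = calive y p s && calive (y + p s) q r.
Proof.
move=> s0 r0; apply/caliveP/andP => [[_ H]|[/caliveP[_ Hp] /caliveP[_ Hq]]].
  split; apply/caliveP; split => // u u0 us.
  - have := H u u0; rewrite rcpath_cat_lt//; apply.
    by rewrite (le_trans us)// lerDl.
  - have := H (s + u); rewrite rcpath_cat_gt// addrA; apply.
    + by rewrite addr_ge0.
    + by rewrite lerD2l.
split; first by rewrite addr_ge0.
move=> u u0 usr; have [us|su] := leP u s; first by rewrite rcpath_cat_lt//; exact: Hp.
have us0 : 0 <= u - s by rewrite subr_ge0 ltW.
have -> : u = s + (u - s) by rewrite addrC subrK.
by rewrite rcpath_cat_gt// addrA Hq// lerBlDl.
Qed.

Lemma measurable_bool_natr d (T : measurableType d) (D : set T) (f : T -> bool) :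
  measurable_fun D f -> measurable_fun D (fun x => (f x)%:R : R).
Proof. by move=> mf; exact: (@measurableT_comp _ _ _ _ _ _ (fun b : bool => b%:R : R)). Qed.

Lemma measurable_param_integral d (T : measurableType d) (f : T -> R -> \bar R) :
  measurable_fun setT (fun z : T * R => f z.1 z.2) ->
  (forall w t, (0 <= f w t)%E) ->
  measurable_fun setT (fun w => (\int[leb]_t f w t)%E).
Proof.
move=> mf f0.
exact: (@measurable_fun_fubini_tonelli_F _ _ T (measurableTypeR R) R leb _ mf
  (fun z => f0 z.1 z.2)).
Qed.

Variables (mu : probability pathT R) (smu : sii mu).
Variables (y : R) (o v : R -> R).
Hypotheses (y0 : 0 <= y) (o0 : forall z, 0 <= o z) (mo : measurable_fun setT o)
  (v0 : forall z, 0 <= v z) (mv : measurable_fun setT v).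
Local Notation G f z := (killed_potential mu z (fun u : R => (f u)%:E)).
Hypothesis vG : forall z, 0 <= z -> ((v z)%:E + G (fun u => o u * v u) z = 1)%E.
Hypothesis ofin : (G o y < +oo)%E.

Let a (p : path) (s : R) : R := (calive y p s)%:R * o (y + p s).
Let g (p : path) (t : R) : R := (calive y p t)%:R * (o (y + p t) * v (y + p t)).
Let B (p : path) (s : R) : R := primitive (a p) s.
Let F (p : path) (s : R) : R := a p s * expR (- B p s).
(** F is the density of 1 - exp (-B), and H weights it by the part of the integral of g that lies
    after s. The mean of H at fixed s comes from the Markov property at s, its integral over s at a
    fixed path from Tonelli. *)
Let H (p : path) (s : R) : \bar R :=
  ((F p s)%:E * \int[leb]_t ((s <= t)%R%:R * g p t)%:E)%E.

Let a_ge0 p s : 0 <= a p s. Proof. by rewrite mulr_ge0. Qed.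
Let g_ge0 p s : 0 <= g p s. Proof. by rewrite !mulr_ge0. Qed.
Let F_ge0 p s : 0 <= F p s. Proof. by rewrite mulr_ge0 ?expR_ge0. Qed.
Let sg_ge0 p s t : (0 <= ((s <= t)%R%:R * g p t)%:E)%E.
Proof. by rewrite lee_fin mulr_ge0. Qed.
Let H_ge0 p s : (0 <= H p s)%E.
Proof. by rewrite mule_ge0 ?lee_fin//; apply: integral_ge0. Qed.

Let mZ : measurable_fun setT (fun z : pathT * R => y + (z.1 : path) z.2).
Proof. by apply: measurable_funD => //; exact: measurable_rcpath_evalP. Qed.

Let ma : measurable_fun setT (fun z : pathT * R => a (z.1 : path) z.2).
Proof.
apply: measurable_funM; first by apply: measurable_bool_natr; exact: measurable_calive.
exact: measurableT_comp.
Qed.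

Let mg : measurable_fun setT (fun z : pathT * R => g (z.1 : path) z.2).
Proof.
apply: measurable_funM; first by apply: measurable_bool_natr; exact: measurable_calive.
by apply: measurable_funM; exact: measurableT_comp.
Qed.

Let m1_pair d1 d2 d3 (T1 : measurableType d1) (T2 : measurableType d2)
    (T3 : measurableType d3) (f : T1 * T3 -> R) :
  measurable_fun setT f -> measurable_fun setT (fun w : T1 * T2 * T3 => f (w.1.1, w.2)).
Proof.
move=> mf; apply: (measurableT_comp mf).
apply/measurable_fun_pairP; split => /=.
  exact: (measurableT_comp measurable_fst measurable_fst).
exact: measurable_snd.
Qed.

Let mB : measurable_fun setT (fun z : pathT * R => B (z.1 : path) z.2).
Proof.
apply: (@measurableT_comp _ _ _ _ _ _ (@fine R)) => //.
pose k (z : pathT * R) (r : R) : \bar R := (((0 <= r) && (r <= z.2))%R%:R * a (z.1 : path) r)%:E.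
rewrite (_ : (fun _ => _) = (fun z : pathT * R => \int[leb]_r k z r)%E); last first.
  apply/funext => z; rewrite integral_mkcond; apply: eq_integral => r _.
  rewrite patchE /k; case: ifPn.
    by rewrite inE/= in_itv/= => ->; rewrite mul1r.
  by rewrite notin_setE/= in_itv/= => /negP/negbTE ->; rewrite mul0r.
apply: measurable_param_integral.
  apply/measurable_EFinP; apply: measurable_funM; last exact: (m1_pair ma).
  apply: measurable_bool_natr; apply: measurable_and.
    by apply: measurable_fun_ler => //; exact: measurable_snd.
  apply: measurable_fun_ler; first exact: measurable_snd.
  exact: (measurableT_comp measurable_snd measurable_fst).
by move=> z r; rewrite lee_fin mulr_ge0.
Qed.

Let mF : measurable_fun setT (fun z : pathT * R => F (z.1 : path) z.2).
Proof.
apply: measurable_funM => //; apply: measurableT_comp => //.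
by apply: measurableT_comp => //.
Qed.

Let mH : measurable_fun setT (fun z : pathT * R => H (z.1 : path) z.2).
Proof.
apply: emeasurable_funM; first exact/measurable_EFinP.
apply: (@measurable_param_integral _ (pathT * R)%type
  (fun z t => ((z.2 <= t)%R%:R * g (z.1 : path) t)%:E)) => [|z t]; last exact: sg_ge0.
apply/measurable_EFinP; apply: measurable_funM; last exact: (m1_pair mg).
apply: measurable_bool_natr; apply: measurable_fun_ler; last exact: measurable_snd.
exact: (measurableT_comp measurable_snd measurable_fst).
Qed.

Let mpath (f : path -> R -> R) : measurable_fun setT (fun z : pathT * R => f (z.1 : path) z.2) ->
  forall p, measurable_fun setT (f p).
Proof.
by move=> mf p; exact: (measurableT_comp mf (measurable_pair1 (p : pathT))).
Qed.

Let a_cat p q s r : 0 <= s -> r <= s -> a (rcpath_cat s p q : path) r = a p r.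
Proof.
move=> s0 rs; have [r0|r0] := leP 0 r; last first.
  have neg (p' : path) : calive y p' r = false.
    by apply/negP => /caliveP[]; rewrite leNgt r0.
  by rewrite /a !neg !mul0r.
rewrite /a rcpath_cat_lt//.
suff -> : calive y (rcpath_cat s p q : path) r = calive y p r by [].
apply/idP/idP => /caliveP[_ A]; apply/caliveP; split => // u u0 ur; have := A u u0 ur;
  by rewrite rcpath_cat_lt// (le_trans ur).
Qed.

Let F_cat p q s : 0 <= s -> F (rcpath_cat s p q : path) s = F p s.
Proof.
move=> s0; rewrite /F a_cat//; congr (_ * expR (- fine _)).
apply: eq_integral => r; rewrite inE/= in_itv/= => /andP[_ rs]; congr EFin.
exact: a_cat.
Qed.

Let H_cat p q s : 0 <= s ->
  H (rcpath_cat s p q : path) s =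
  ((F p s)%:E * killed_occ (y + p s) (fun u => (o u * v u)%:E) q)%E.
Proof.
move=> s0; rewrite /H F_cat//.
have [ps|nps] := boolP (calive y p s); last first.
  by rewrite /F /a (negbTE nps) !mul0r !mul0e.
congr (_ * _)%E; rewrite -[LHS](ge0_integral_shift s)//; first last.
  apply/measurable_EFinP; apply: measurable_funM; last exact: mpath mg _.
  by apply: measurable_bool_natr; apply: measurable_fun_ler.
apply: eq_integral => r _; rewrite -EFinM; congr EFin.
rewrite lerDr; have [r0|r0] := leP 0 r; last first.
  rewrite mul0r (_ : calive _ _ _ = false) ?mul0r//.
  by apply/negP => /caliveP[]; rewrite leNgt r0.
by rewrite mul1r /g (addrC r s) calive_cat// ps andTb rcpath_cat_gt// addrA.
Qed.

(** F at time s depends on the path up to s only. Given that part, the remaining integral of g is a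
    killed occupation started from y + p s, whose mean is 1 - v (y + p s) by [vG]. *)
Let markov_H s : (\int[mu]_p H (p : path) s =
  \int[mu]_p ((F (p : path) s)%:E * (1 - v (y + (p : path) s))%:E))%E.
Proof.
have [s0|s0] := leP 0 s; last first.
  have F0 (p : path) : F p s = 0.
    rewrite /F /a (_ : calive _ _ _ = false) ?mul0r//.
    by apply/negP => /caliveP[]; rewrite leNgt s0.
  by apply: eq_integral => p _; rewrite /H F0 !mul0e.
rewrite (markov_integral smu s0)//; last exact: (measurableT_comp mH (measurable_pair2 _)).
apply: eq_integral => p _.
under eq_integral do rewrite H_cat//.
have mf : measurable_fun setT (fun u => (o u * v u)%:E).
  by apply/measurable_EFinP; exact: measurable_funM.
have f0 u : (0 <= (o u * v u)%:E)%E by rewrite lee_fin mulr_ge0.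
rewrite ge0_integralZl//; first last.
- by rewrite lee_fin.
- by move=> q _; apply: killed_occ_ge0.
- exact: measurable_killed_occ.
have [ps|nps] := boolP (calive y (p : path) s); last first.
  by rewrite /F /a (negbTE nps) !mul0r !mul0e.
congr (_ * _)%E; have := vG (calive_ge0 ps); rewrite /killed_potential => E.
have /(congr1 (fun t => t - (v (y + (p : path) s))%:E)%E) := E.
by rewrite addeAC subee// add0e -EFinB.
Qed.

Let good (p : path) := (\int[leb]_s (a p s)%:E < +oo)%E.

Let killed_occ_o p : killed_occ y (fun u => (o u)%:E) p = (\int[leb]_s (a p s)%:E)%E.
Proof. by apply: eq_integral => s _; rewrite EFinM. Qed.

Let good_ae : {ae mu, forall p : pathT, good p}.
Proof.
have mk : measurable_fun setT (killed_occ y (fun u => (o u)%:E)).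
  by apply: measurable_killed_occ => [|z]; [exact/measurable_EFinP|rewrite lee_fin].
have k0 p : (0 <= killed_occ y (fun u => (o u)%:E) p)%E.
  by apply: killed_occ_ge0 => z; rewrite lee_fin.
have : mu.-integrable setT (killed_occ y (fun u => (o u)%:E)).
  apply/integrableP; split => //.
  by under eq_integral do rewrite gee0_abs//.
move=> /integrable_ae -/(_ measurableT); apply: filterS => p /(_ I).
by rewrite killed_occ_o ge0_fin_numE// -killed_occ_o.
Qed.

Let aneg p s : s < 0 -> a p s = 0.
Proof.
move=> s0; rewrite /a (_ : calive _ _ _ = false) ?mul0r//.
by apply/negP => /caliveP[]; rewrite leNgt s0.
Qed.

(** Exchanging the integrals turns that of H into the integral of g (1 - exp (-B)), and F v equals g
    exp (-B); the two exponential terms cancel. *)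
Let path_identity p : good p ->
  (\int[leb]_s (F p s * v (y + p s))%:E + \int[leb]_s H p s =
   \int[leb]_t (g p t)%:E)%E.
Proof.
move=> gp.
have -> : (\int[leb]_s H p s = \int[leb]_t (g p t * (1 - expR (- B p t)))%:E)%E.
  pose K (z : R * R) : \bar R := (F p z.1 * ((z.1 <= z.2)%R%:R * g p z.2))%:E.
  have mK : measurable_fun setT K.
    apply/measurable_EFinP; apply: measurable_funM.
      by apply: (measurableT_comp (mpath mF p)); exact: measurable_fst.
    apply: measurable_funM; last first.
      by apply: (measurableT_comp (mpath mg p)); exact: measurable_snd.
    apply: measurable_bool_natr; apply: measurable_fun_ler; first exact: measurable_fst.
    exact: measurable_snd.
  have K0 z : (0 <= K z)%E by rewrite lee_fin !mulr_ge0.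
  have := @fubini_tonelli _ _ (measurableTypeR R) (measurableTypeR R) R leb leb K mK K0.
  rewrite /K /= => E.
  transitivity (\int[leb]_s \int[leb]_t (F p s * ((s <= t)%R%:R * g p t))%:E)%E.
    apply: eq_integral => s _; rewrite /H -ge0_integralZl ?lee_fin//.
    apply/measurable_EFinP; apply: measurable_funM; last exact: mpath mg _.
    by apply: measurable_bool_natr; apply: measurable_fun_ler.
  rewrite E; apply: eq_integral => t _.
  have [t0|t0] := leP 0 t; last first.
    have g0 : g p t = 0.
      rewrite /g (_ : calive _ _ _ = false) ?mul0r//.
      by apply/negP => /caliveP[]; rewrite leNgt t0.
    by under eq_integral do rewrite g0 !mulr0; rewrite integral0 g0 mul0r.
  rewrite EFinM -(integral_exp_primitive (a_ge0 p) (mpath ma p) gp t0).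
  rewrite -ge0_integralZl ?lee_fin//; first last.
  - by move=> s _; rewrite lee_fin F_ge0.
  - by apply: measurable_funTS; apply/measurable_EFinP; exact: mpath mF p.
  rewrite [RHS]integral_mkcond; apply: eq_integral => s _; rewrite patchE.
  case: ifPn.
    rewrite inE/= in_itv/= => /andP[s0 st]; rewrite st -EFinM mul1r.
    by congr EFin; rewrite mulrC.
  rewrite notin_setE/= in_itv/= => /negP; rewrite negb_and -!ltNge => /orP[s0|ts].
    by rewrite /F aneg// !mul0r.
  by rewrite leNgt ts mul0r mulr0.
have B0 t : 0 <= B p t by exact: (primitive_ge0 (a_ge0 p)).
rewrite -ge0_integralD//.
- apply: eq_integral => t _; rewrite -EFinD; congr EFin.
  by rewrite /F /a /g; ring.
- by move=> s _; rewrite lee_fin mulr_ge0.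
- apply/measurable_EFinP; apply: measurable_funM; first exact: mpath mF p.
  apply: measurableT_comp => //.
  exact: (mpath (f := fun p s => y + p s) mZ p).
- move=> s _; rewrite lee_fin mulr_ge0// subr_ge0 -[leRHS]expR0 ler_expR.
  by rewrite oppr_le0.
- apply/measurable_EFinP; apply: measurable_funM; first exact: mpath mg p.
  apply: measurable_funB => //; apply: measurableT_comp => //.
  by apply: measurableT_comp => //; exact: mpath mB p.
Qed.

(** The mean of 1 - exp (-B oo) is the double integral of F = F v + F (1 - v). By [markov_H] the
    second term may be replaced by H, by [path_identity] the sum is the integral of g, and [vG] at y
    evaluates its mean as 1 - v y. *)
Theorem feynman_kac :
  (\int[mu]_p (expR (- fine (killed_occ y (fun u => (o u)%:E) p)))%:E = (v y)%:E)%E.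
Proof.
have mEF (f : pathT * R -> R) : measurable_fun setT f ->
    measurable_fun setT (fun z => (f z)%:E) by move=> mf; exact/measurable_EFinP.
have mvZ : measurable_fun setT (fun z : pathT * R => v (y + (z.1 : path) z.2)).
  exact: measurableT_comp.
(* On [0, oo) the equation gives v <= 1, so F (1 - v) is nonnegative and Tonelli applies to it. *)
have v1 z : 0 <= z -> v z <= 1.
  move=> z0; rewrite -lee_fin -(vG z0) leeDl// integral_ge0// => p _.
  by apply: killed_occ_ge0 => u; rewrite lee_fin mulr_ge0.
have Fv0 (p : path) s : 0 <= F p s * (1 - v (y + p s)).
  rewrite /F /a; case: (boolP (calive y p s)) => [ps|_]; last by rewrite !mul0r.
  by rewrite mulr_ge0 ?subr_ge0 ?v1 ?(calive_ge0 ps)// !mulr_ge0 ?expR_ge0.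
have mo' : measurable_fun setT (fun u : R => (o u)%:E) by exact/measurable_EFinP.
have o0' u : (0 <= (o u)%:E)%E by rewrite lee_fin.
have mk : measurable_fun setT (killed_occ y (fun u => (o u)%:E)).
  exact: measurable_killed_occ.
have k0 p : 0 <= fine (killed_occ y (fun u => (o u)%:E) p).
  by apply: fine_ge0; exact: killed_occ_ge0.
have mexp : measurable_fun setT (fun p => expR (- fine (killed_occ y (fun u => (o u)%:E) p))).
  by apply: measurableT_comp => //; apply: measurableT_comp => //; exact: measurableT_comp.
have exp1 p : expR (- fine (killed_occ y (fun u => (o u)%:E) p)) <= 1.
  by rewrite -[leRHS]expR0 ler_expR oppr_le0.
pose fF (z : pathT * R) := (F (z.1 : path) z.2)%:E.
pose fFv (z : pathT * R) := (F (z.1 : path) z.2 * v (y + (z.1 : path) z.2))%:E.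
pose fFw (z : pathT * R) := (F (z.1 : path) z.2 * (1 - v (y + (z.1 : path) z.2)))%:E.
pose fH (z : pathT * R) := H (z.1 : path) z.2.
have mfF : measurable_fun setT fF by apply: mEF.
have mfFv : measurable_fun setT fFv by apply: mEF; apply: measurable_funM.
have mfFw : measurable_fun setT fFw.
  by apply: mEF; apply: measurable_funM => //; exact: measurable_funB.
have fF0 z : (0 <= fF z)%E by rewrite lee_fin.
have fFv_ge0 z : (0 <= fFv z)%E by rewrite lee_fin mulr_ge0.
have fFw_ge0 z : (0 <= fFw z)%E by rewrite lee_fin.
have I1 : (\int[mu \x leb]_z fF z =
    \int[mu]_p (1 - expR (- fine (killed_occ y (fun u => (o u)%:E) p)))%:E)%E.
  rewrite (@fubini_tonelli1 _ _ pathT (measurableTypeR R) R mu leb fF mfF fF0).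
  apply: ge0_ae_eq_integral => //.
  - by apply: (@measurable_param_integral _ pathT (fun p s => (F (p : path) s)%:E)).
  - by apply/measurable_EFinP; exact: measurable_funB.
  - by move=> p _; apply: integral_ge0.
  - by move=> p _; rewrite lee_fin subr_ge0.
  - apply: filterS good_ae => p gp _; rewrite killed_occ_o.
    exact: (integral_exp_primitiveT (a_ge0 p) (mpath ma p) (@aneg p) gp).
have I2 : (\int[mu \x leb]_z fF z = \int[mu \x leb]_z fFv z + \int[mu \x leb]_z fFw z)%E.
  rewrite -ge0_integralD//; apply: eq_integral => z _.
  by rewrite -EFinD; congr EFin; ring.
have I3 : (\int[mu \x leb]_z fFw z = \int[mu \x leb]_z fH z)%E.
  rewrite (@fubini_tonelli2 _ _ pathT (measurableTypeR R) R mu leb fFw mfFw fFw_ge0).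
  rewrite (@fubini_tonelli2 _ _ pathT (measurableTypeR R) R mu leb fH mH (fun z => H_ge0 z.1 z.2)).
  by apply: eq_integral => s _; rewrite /fubini_G /fH markov_H.
have I4 : (\int[mu \x leb]_z fFv z + \int[mu \x leb]_z fH z =
    \int[mu]_p \int[leb]_t (g (p : path) t)%:E)%E.
  rewrite (@fubini_tonelli1 _ _ pathT (measurableTypeR R) R mu leb fFv mfFv fFv_ge0).
  rewrite (@fubini_tonelli1 _ _ pathT (measurableTypeR R) R mu leb fH mH (fun z => H_ge0 z.1 z.2)).
  rewrite /fubini_F.
  have m1 : measurable_fun setT (fun p : pathT => (\int[leb]_t fFv (p, t))%E).
    by apply: (@measurable_param_integral _ pathT (fun p s => fFv (p, s))).
  have m2 : measurable_fun setT (fun p : pathT => (\int[leb]_t fH (p, t))%E).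
    by apply: (@measurable_param_integral _ pathT (fun p s => fH (p, s))) => // p s;
      exact: H_ge0.
  rewrite -ge0_integralD//; first last.
  - by move=> p _; apply: integral_ge0 => s _; exact: H_ge0.
  - by move=> p _; apply: integral_ge0.
  apply: ge0_ae_eq_integral => //.
  - exact: emeasurable_funD.
  - apply: (@measurable_param_integral _ pathT (fun p s => (g (p : path) s)%:E)) => //.
    exact: mEF.
  - move=> p _; apply: adde_ge0; first exact: integral_ge0.
    by apply: integral_ge0 => s _; exact: H_ge0.
  - by move=> p _; apply: integral_ge0 => s _; rewrite lee_fin.
  - by apply: filterS good_ae => p gp _; exact: path_identity.
have I5 : (\int[mu]_p (1 - expR (- fine (killed_occ y (fun u => (o u)%:E) p)))%:E =
    (1 - v y)%:E)%E.
  rewrite -I1 I2 I3 I4.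
  have /(congr1 (fun t => t - (v y)%:E)%E) := vG y0.
  rewrite addeAC subee// add0e -EFinB => <-.
  by apply: eq_integral => p _; apply: eq_integral => t _; rewrite EFinM.
have : (\int[mu]_p (expR (- fine (killed_occ y (fun u => (o u)%:E) p)))%:E +
   \int[mu]_p (1 - expR (- fine (killed_occ y (fun u => (o u)%:E) p)))%:E = 1)%E.
  rewrite -ge0_integralD//.
  - rewrite -[RHS](integral_probability_cst mu 1%E); apply: eq_integral => p _.
    by rewrite -EFinD addrC subrK.
  - by apply/measurable_EFinP.
  - by move=> p _; rewrite lee_fin subr_ge0.
  - by apply/measurable_EFinP; exact: measurable_funB.
rewrite I5 => /(congr1 (fun t => t - (1 - v y)%:E)%E).
by rewrite addeK// -EFinB => ->; congr EFin; ring.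
Qed.

End feynman_kac.

(** * Nonnegativity and quadratic growth of the Laplace exponent *)

Section laplace_exponent.
Context {R : realType}.
Variables (g s : R) (pi : {measure set R -> \bar R}).
Hypothesis trip : levy_triplet g s pi.

Let Pint (l : R) : \bar R :=
  (\int[pi]_(z in `]0%R, +oo[) (expR (- (l * z)) - 1 + l * z)%:E)%E.
Let J : \bar R := (\int[pi]_(z in `]0%R, +oo[) (Num.min z (z ^+ 2))%:E)%E.

Let integrand_ge0 (l z : R) : 0 <= expR (- (l * z)) - 1 + l * z.
Proof. by have := expR_ge1Dx (- (l * z)); lra. Qed.

Lemma Psi_ge0 l : 0 < l -> 0 <= Psi g s pi l.
Proof.
case: trip => g0 [s0 _] l0; rewrite /Psi !addr_ge0//.
- by rewrite mulr_ge0// ltW.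
- by rewrite mulr_ge0 ?sqr_ge0// divr_ge0 ?sqr_ge0.
- by apply: fine_ge0; apply: integral_ge0 => z _; rewrite lee_fin.
Qed.

(** With x = l z the left side is at most min x (x^2), and l >= 1 gives l <= l^2. *)
Let integrand_le (l z : R) : 1 <= l -> 0 < z ->
  expR (- (l * z)) - 1 + l * z <= l ^+ 2 * Num.min z (z ^+ 2).
Proof.
move=> l1 z0; set x := l * z; have l0 : 0 < l by lra.
have x0 : 0 < x by rewrite mulr_gt0.
have e1 : expR (- x) <= 1 by rewrite -[leRHS]expR0 ler_expR oppr_le0 ltW.
(* exp (-x) <= 1 / (1 + x), and (1 + x)(1 - x + x^2) = 1 + x^3 >= 1. *)
have e2 : expR (- x) <= 1 - x + x ^+ 2.
  have p : 0 < 1 + x by lra.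
  rewrite expRN (@le_trans _ _ (1 + x)^-1)//.
    by rewrite lef_pV2 ?posrE ?expR_gt0// expR_ge1Dx.
  rewrite -(ler_pM2l p) divff ?gt_eqF//.
  by have : 0 <= x ^+ 3; [rewrite exprn_ge0// ltW|rewrite -subr_ge0 => h; nra].
have l2 : l <= l ^+ 2 by rewrite expr2 ler_peMl// ltW.
rewrite minr_pMr; last by rewrite sqr_ge0.
rewrite le_min; apply/andP; split; last by rewrite -exprMn -/x; lra.
rewrite (@le_trans _ _ x)//; first by lra.
by rewrite ler_wpM2r// ltW.
Qed.

Lemma Psi_le l : 1 <= l -> Psi g s pi l <= (g + s ^+ 2 / 2 + fine J) * l ^+ 2.
Proof.
case: trip => g0 [s0 Jfin] l1; have l0 : 0 < l by lra.
have m1 : measurable_fun (`]0, +oo[ : set R) (fun z => (Num.min z (z ^+ 2))%:E).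
  by apply/measurable_EFinP; apply: measurable_minr => //; exact: exprn_measurable.
have m0 z : (`]0%R, +oo[%classic : set R) z -> (0 <= (Num.min z (z ^+ 2))%:E)%E.
  by rewrite /= in_itv/= andbT => z0; rewrite lee_fin le_min sqr_ge0 ltW.
have J0 : (0 <= J)%E by apply: integral_ge0.
have PJ : (Pint l <= (l ^+ 2 * fine J)%:E)%E.
  rewrite EFinM fineK ?ge0_fin_numE// -ge0_integralZl//; last by rewrite lee_fin sqr_ge0.
  apply: ge0_le_integral => //.
  - by move=> z _; rewrite lee_fin.
  - apply/measurable_EFinP; apply: measurable_funD; first apply: measurable_funB => //.
      apply: measurable_funTS; apply: measurableT_comp => //.
      by apply: measurableT_comp => //; exact: measurable_funM.
    by apply: measurable_funM.
  - by apply: emeasurable_funM.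
  move=> z; rewrite /= in_itv/= andbT => z0; rewrite -EFinM lee_fin.
  exact: integrand_le.
have Pf : fine (Pint l) <= l ^+ 2 * fine J.
  rewrite -lee_fin fineK// ge0_fin_numE; first by rewrite (le_lt_trans PJ)// ltry.
  by apply: integral_ge0 => z _; rewrite lee_fin.
rewrite /Psi -/(Pint l) !mulrDl; apply: lerD; last by rewrite [leRHS]mulrC.
rewrite lerD2r ler_wpM2l// expr2 ler_peMl// ltW//.
Qed.

End laplace_exponent.

(** * Integrals of functions equal almost everywhere *)

Section ge0_ae_eq_integralT.
Import HBNNSimple.

(* The integral of a nonnegative function is a supremum over simple functions, so f
   needs no measurability. *)
Lemma ge0_ae_eq_integralT d (T : measurableType d) (R : realType)
    (mu : {measure set T -> \bar R}) (f g : T -> \bar R) :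
  measurable_fun setT g -> (forall x, (0 <= f x)%E) -> (forall x, (0 <= g x)%E) ->
  {ae mu, forall x, f x = g x} -> (\int[mu]_x f x = \int[mu]_x g x)%E.
Proof.
move=> mg f0 g0 [N [mN N0 fgN]].
have fg x : ~ N x -> f x = g x by move=> nN; apply: contrapT => ?; apply: nN; exact: fgN.
have mNC : measurable (~` N) by exact: measurableC.
have drop (k : T -> \bar R) : measurable_fun setT k -> (forall x, (0 <= k x)%E) ->
    (\int[mu]_x k x = \int[mu]_(x in ~` N) k x)%E.
  by move=> mk k0; rewrite (ge0_negligible_integral mN)// setTD.
apply/eqP; rewrite eq_le; apply/andP; split.
- rewrite ge0_integralTE//; apply: ge_ereal_sup => _ [h /= hf <-].
  have mh : measurable_fun setT (fun x => (h x)%:E) by exact/measurable_EFinP.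
  have h0 x : (0 <= (h x)%:E)%E by rewrite lee_fin.
  rewrite -integralT_nnsfun (drop _ mh h0) (drop g mg g0).
  apply: ge0_le_integral => //; [exact: measurable_funTS|exact: measurable_funTS|].
  by move=> x nN; rewrite -fg//; exact: hf.
- rewrite drop// integral_mkcond [leLHS]ge0_integralTE; last first.
    by move=> x; exact: erestrict_ge0.
  apply: ge_ereal_sup => _ [h /= hg <-]; rewrite ge0_integralTE//.
  apply: ereal_sup_ubound; exists h => //= x.
  apply: (le_trans (hg x)); rewrite patchE; case: ifPn => //.
  by rewrite inE => nN; rewrite fg.
Qed.

End ge0_ae_eq_integralT.

(** * The series of iterated kernels and its equation *)

Section iterated_kernel.
Context {R : realType}.
Local Notation leb := (@lebesgue_measure R).
Variables (W o : R -> R).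
Hypotheses (Wneg : forall z, z < 0 -> W z = 0) (W0 : forall z, 0 <= W z)
  (Wle : {homo W : a b / a <= b}) (o0 : forall z, 0 <= o z) (mo : measurable_fun setT o).

(** The functions [Wom] with the barrier moved to 0. Integrating over the whole line is harmless
    because W (z - y) vanishes for z < y, and it makes monotonicity in y a comparison of
    integrands. *)
Fixpoint kernel_iter (n : nat) (y : R) : \bar R :=
  if n is n'.+1 then (\int[leb]_z ((W (z - y) * o z)%:E * kernel_iter n' z))%E else 1%E.

Definition kernel_sum (y : R) : \bar R := (\sum_(0 <= n <oo) kernel_iter n y)%E.

Lemma kernel_iter_ge0 n y : (0 <= kernel_iter n y)%E.
Proof.
elim: n y => [|n ih] y //=; apply: integral_ge0 => z _.
by rewrite mule_ge0// lee_fin mulr_ge0.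
Qed.

Let mW : measurable_fun setT W. Proof. exact: nondecreasing_measurable. Qed.

Let mWo (y : R) : measurable_fun setT (fun z : R => (W (z - y) * o z)%:E).
Proof.
apply/measurable_EFinP; apply: measurable_funM => //.
by apply: measurableT_comp => //; exact: measurable_funB.
Qed.

Lemma measurable_kernel_iter n : measurable_fun setT (kernel_iter n).
Proof.
elim: n => [|n ih]; first exact: measurable_cst.
apply: (@measurable_param_integral R _ R
  (fun y z => ((W (z - y) * o z)%:E * kernel_iter n z)%E)); last first.
  by move=> y z; rewrite mule_ge0 ?kernel_iter_ge0// lee_fin mulr_ge0.
apply: emeasurable_funM; last exact: (measurableT_comp ih measurable_snd).
apply/measurable_EFinP; apply: measurable_funM.
  apply: measurableT_comp => //; apply: measurable_funB => //.
exact: (measurableT_comp mo measurable_snd).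
Qed.

Let mK n (y : R) : measurable_fun setT (fun z : R => ((W (z - y) * o z)%:E * kernel_iter n z)%E).
Proof. by apply: emeasurable_funM => //; exact: measurable_kernel_iter. Qed.

Let K0 n y z : (0 <= (W (z - y) * o z)%:E * kernel_iter n z)%E.
Proof. by rewrite mule_ge0 ?kernel_iter_ge0// lee_fin mulr_ge0. Qed.

Lemma kernel_iter_le n y z : y <= z -> (kernel_iter n z <= kernel_iter n y)%E.
Proof.
case: n => [//|n] yz; apply: ge0_le_integral => //; [exact: mK|exact: mK|move=> u _].
rewrite lee_wpmul2r ?kernel_iter_ge0// lee_fin ler_wpM2r// Wle// lerB//.
Qed.

Lemma kernel_sum_ge0 y : (0 <= kernel_sum y)%E.
Proof. by apply: nneseries_ge0 => n _ _; exact: kernel_iter_ge0. Qed.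

Lemma kernel_sum_le y z : y <= z -> (kernel_sum z <= kernel_sum y)%E.
Proof.
move=> yz; apply: lee_nneseries => [n _ _|n _]; first exact: kernel_iter_ge0.
exact: kernel_iter_le.
Qed.

Lemma measurable_kernel_sum : measurable_fun setT kernel_sum.
Proof.
apply: ge0_emeasurable_sum => [n z _ _|n _]; first exact: kernel_iter_ge0.
exact: measurable_kernel_iter.
Qed.

Lemma kernel_sumE y :
  kernel_sum y = (1 + \int[leb]_z ((W (z - y) * o z)%:E * kernel_sum z))%E.
Proof.
rewrite {1}/kernel_sum nneseries_recl//; last by move=> n _; exact: kernel_iter_ge0.
congr (_ + _)%E; rewrite -(nneseries_addn 1); last exact: (fun n => kernel_iter_ge0 n y).
transitivity (\int[leb]_z \sum_(n <oo) ((W (z - y) * o z)%:E * kernel_iter n z))%E; last first.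
  apply: eq_integral => z _.
  by rewrite nneseriesZl// => n _; exact: kernel_iter_ge0.
rewrite integral_nneseries//; first by apply: eq_eseriesr => i _; rewrite addn1.
by move=> n; exact: mK.
Qed.

Hypothesis Tfin : (kernel_sum 0 < +oo)%E.

Definition kernel_ratio (y : R) : R := fine (kernel_sum y) / fine (kernel_sum 0).
Local Notation v := kernel_ratio.

Lemma kernel_sum_fin y : 0 <= y -> kernel_sum y \is a fin_num.
Proof.
by move=> y0; rewrite ge0_fin_numE ?kernel_sum_ge0// (le_lt_trans (kernel_sum_le y0)).
Qed.

Lemma kernel_sum_ge1 : 1 <= fine (kernel_sum 0).
Proof.
rewrite -lee_fin fineK ?kernel_sum_fin// kernel_sumE leeDl//.
apply: integral_ge0 => z _; rewrite mule_ge0 ?kernel_sum_ge0// lee_fin mulr_ge0//.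
Qed.

Lemma kernel_ratio_ge0 y : 0 <= v y.
Proof. by rewrite divr_ge0 ?fine_ge0 ?kernel_sum_ge0. Qed.

Lemma measurable_kernel_ratio : measurable_fun setT v.
Proof.
apply: measurable_funM => //; apply: measurableT_comp => //.
exact: measurable_kernel_sum.
Qed.

(** [kernel_sumE] at z and at 0 have the kernels W (u - z) and W u. Their difference is the killed
    density, and division by the value at 0 normalizes the constant to 1. *)
Lemma kernel_ratioE z : 0 <= z ->
  ((v z)%:E + \int[leb]_u ((W u - W (u - z))%:E * (o u * v u)%:E) = 1)%E.
Proof.
move=> z0; set t := fine (kernel_sum 0); have t0 : 0 < t by exact: lt_le_trans kernel_sum_ge1.
have Wd u : 0 <= W u - W (u - z) by rewrite subr_ge0 Wle// gerBl.
have vE u : 0 <= u -> kernel_sum u = (t * v u)%:E.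
  by move=> u0; rewrite /v -/t mulrCA divff ?gt_eqF// mulr1 fineK// kernel_sum_fin.
have md : measurable_fun setT (fun u : R => (W u - W (u - z))%:E * (o u * v u)%:E)%E.
  apply: emeasurable_funM; apply/measurable_EFinP.
    by apply: measurable_funB => //; apply: measurableT_comp => //; exact: measurable_funB.
  by apply: measurable_funM => //; exact: measurable_kernel_ratio.
have d0 u : (0 <= (W u - W (u - z))%:E * (o u * v u)%:E)%E.
  by rewrite mule_ge0// lee_fin// mulr_ge0// kernel_ratio_ge0.
set I := (\int[leb]_u _)%E; have I0 : (0 <= I)%E by apply: integral_ge0.
(* Stated additively, before the finiteness of I is known. *)
have key : (kernel_sum z + t%:E * I = kernel_sum 0)%E.
  rewrite [in LHS]kernel_sumE [in RHS]kernel_sumE -addeA; congr (_ + _)%E.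
  rewrite -ge0_integralZl ?lee_fin ?(ltW t0)// -ge0_integralD//; first last.
  - by apply: emeasurable_funM.
  - by move=> u _; rewrite mule_ge0// lee_fin ltW.
  - by apply: emeasurable_funM; [exact: mWo|exact: measurable_kernel_sum].
  - by move=> u _; rewrite mule_ge0 ?kernel_sum_ge0// lee_fin mulr_ge0.
  apply: eq_integral => u _; rewrite subr0.
  have [u0|u0] := ltP u 0.
    have uz : u - z < 0 by rewrite (le_lt_trans _ u0)// gerBl.
    by rewrite !Wneg// subrr !mul0r !mul0e mule0 adde0.
  by rewrite vE// -!EFinM -EFinD; congr EFin; ring.
have Ifin : I \is a fin_num.
  rewrite ge0_fin_numE//; case: (I) key I0 => [r _ _|key _|//]; first exact: ltry.
  move: key; rewrite gt0_muley ?lte_fin// addey; last first.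
    by rewrite -ltNye (lt_le_trans _ (kernel_sum_ge0 z)).
  by move=> E; move: Tfin; rewrite -E ltxx.
rewrite -(fineK Ifin) -EFinD; congr EFin.
move: key; rewrite (vE z z0) (vE 0 (lexx 0)) -(fineK Ifin) -EFinM -EFinD => -[E].
have v01 : v 0 = 1 by rewrite /v divff// gt_eqF.
move: E; rewrite v01 mulr1 -mulrDr => E.
by apply: (mulfI (lt0r_neq0 t0)); rewrite mulr1.
Qed.

Lemma kernel_potential_fin y : 0 <= y ->
  (\int[leb]_z ((W z - W (z - y))%:E * (o z)%:E) < +oo)%E.
Proof.
move=> y0; apply: (@le_lt_trans _ _ (kernel_iter 1 0)).
  apply: ge0_le_integral => //.
  - by move=> z _; rewrite mule_ge0 ?lee_fin// subr_ge0 Wle// gerBl.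
  - apply: emeasurable_funM; apply/measurable_EFinP => //.
    by apply: measurable_funB => //; apply: measurableT_comp => //; exact: measurable_funB.
  - exact: (mK 0 0).
  move=> z _; rewrite mule1 -EFinM lee_fin subr0 ler_wpM2r//.
  by rewrite gerBl.
apply: (le_lt_trans _ Tfin); rewrite /kernel_sum.
(* Only the terms n = 0 and n = 1 of the series are kept. *)
have := @nneseries_lim_ge R (fun n => kernel_iter n 0) xpredT 0 2.
move=> /(_ (fun n _ _ => kernel_iter_ge0 n 0)); apply: le_trans.
by rewrite !big_nat_recr//= big_geq// add0e leeDr.
Qed.

End iterated_kernel.

(** * Matching survival with the hitting time and the rate *)

Section hitting_time.
Context {R : realType}.
Local Notation path := (rcpath R).
Local Notation pathT := (rcpathT R).
Local Notation leb := (@lebesgue_measure R).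

(** The sign of [om] is known on positive arguments only, so the rate is cut to 0 elsewhere. For b,
    z >= 0 this can change [om (b + z)] only at b = z = 0. *)
Definition shifted_rate (om : R -> R) (b z : R) : R := if 0 < b + z then om (b + z) else 0.

Lemma shifted_rate_ge0 om b z : (forall z, 0 < z -> 0 <= om z) -> 0 <= shifted_rate om b z.
Proof. by move=> om0; rewrite /shifted_rate; case: ifP => // /om0. Qed.

Lemma measurable_shifted_rate om b : measurable_fun setT om ->
  measurable_fun setT (shifted_rate om b).
Proof.
move=> mom; have ms : measurable_fun setT (fun z : R => b + z) by exact: measurable_funD.
apply: measurable_fun_ifT => //; first exact: measurable_fun_ltr.
exact: measurableT_comp.
Qed.

Lemma Wom_kernel_iter (W om : R -> R) b n y :
  (forall z, z < 0 -> W z = 0) -> (forall z, 0 <= W z) -> {homo W : a b / a <= b} ->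
  measurable_fun setT om -> (forall z, 0 < z -> 0 <= om z) -> 0 <= b -> 0 <= y ->
  Wom W om n (b + y) = kernel_iter W (shifted_rate om b) n y.
Proof.
move=> Wneg W0 Wle mom om0 b0; have o0 z := shifted_rate_ge0 b z om0.
have mo := measurable_shifted_rate b mom.
elim: n y => [//|n ih] y y0 /=.
pose F u := ((W (u - y) * shifted_rate om b u)%:E *
  kernel_iter W (shifted_rate om b) n u)%E.
have mW : measurable_fun setT W by exact: nondecreasing_measurable.
have mF : measurable_fun setT F.
  apply: emeasurable_funM; last exact: measurable_kernel_iter.
  apply/measurable_EFinP; apply: measurable_funM => //.
  by apply: measurableT_comp => //; exact: measurable_funB.
have F0 u : (0 <= F u)%E by rewrite mule_ge0 ?kernel_iter_ge0// lee_fin mulr_ge0.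
have mFb : measurable_fun setT (fun z : R => F (z - b)).
  by apply: measurableT_comp => //; exact: measurable_funB.
have FE z : b + y < z -> F (z - b) = ((W (z - (b + y)) * om z)%:E * Wom W om n z)%E.
  move=> zby; have zb : b + (z - b) = z by rewrite addrC subrK.
  rewrite /F /shifted_rate zb (le_lt_trans _ zby) ?addr_ge0//.
  rewrite -ih ?zb; last by rewrite subr_ge0 (le_trans _ (ltW zby))// lerDl.
  by rewrite opprD addrA.
(* The endpoint is dropped: when b + y = 0 the rate and its cut version may differ there. *)
rewrite -[LHS]integral_itv_obnd_cbnd; last first.
  apply: (@eq_measurable_fun _ _ _ _ _ (fun z : R => F (z - b))).
    by move=> z; rewrite inE/= in_itv/= andbT => zby; rewrite FE.
  exact: measurable_funTS.
transitivity (\int[leb]_(z in `](b + y)%R, +oo[) F (z - b)%R)%E.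
  by apply: eq_integral => z; rewrite inE/= in_itv/= andbT => zby; rewrite FE.
rewrite integral_itv_obnd_cbnd; last exact: measurable_funTS.
rewrite -/(F) -[RHS](ge0_integral_shift (- b) mF F0) integral_mkcond.
apply: eq_integral => z _; rewrite patchE; case: ifPn => //.
rewrite notin_setE/= in_itv/= andbT => /negP; rewrite -ltNge => zby.
have zy : z - b - y < 0 by lra.
by rewrite /F Wneg// mul0r mul0e.
Qed.

Lemma ae_pushforward d (T : measurableType d) (P : probability T R) (phi : T -> pathT)
    (mu : probability pathT R) (Q : pathT -> Prop) :
  measurable_fun setT phi ->
  (forall F : pathT -> \bar R, measurable_fun setT F -> (forall p, (0 <= F p)%E) ->
    (\int[P]_w F (phi w) = \int[mu]_p F p)%E) ->
  {ae mu, forall p, Q p} -> {ae P, forall w, Q (phi w)}.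
Proof.
move=> mphi trans [N [mN N0 QN]].
have mphiN : measurable (phi @^-1` N).
  by rewrite -[X in measurable X]setTI; exact: mphi.
exists (phi @^-1` N); split => //; last by move=> w nQ; exact: QN.
have mi : measurable_fun setT (fun p : pathT => (\1_N p : R)%:E).
  by apply/measurable_EFinP; exact: measurable_indic.
have i0 p : (0 <= (\1_N p : R)%:E)%E by rewrite lee_fin.
have := trans _ mi i0; rewrite [RHS]integral_indic// setIT => E.
transitivity (\int[P]_w (\1_(phi @^-1` N) w : R)%:E)%E.
  by rewrite integral_indic// setIT.
by rewrite -[LHS]/(\int[P]_w (\1_N (phi w))%:E)%E E.
Qed.

Section no_atom.
Variables (mu : probability pathT R) (psi W : R -> R) (C : R).
Hypotheses (smu : sii mu) (lap1 : laplace_at mu psi 1)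
  (psi_ge0 : forall l, 0 < l -> 0 <= psi l)
  (psi_le : forall l, 1 <= l -> psi l <= C * l ^+ 2)
  (HW : scale_function psi W).

(* The killed potential has a density, hence almost surely the time spent at the barrier
   is null. *)
Lemma killed_no_atom y : 0 <= y ->
  {ae mu, forall p : pathT, {ae leb, forall t, calive y (p : path) t ->
    y + (p : path) t != 0}}.
Proof.
move=> y0; pose f (z : R) : \bar R := (\1_[set 0 : R] z)%:E.
have mf : measurable_fun setT f by apply/measurable_EFinP; exact: measurable_indic.
have f0 z : (0 <= f z)%E by rewrite lee_fin.
have G0 : killed_potential mu y f = 0%E.
  rewrite (killed_potentialE smu lap1 psi_ge0 psi_le HW y0 mf f0).
  rewrite -[RHS](integral_set1 (fun z => (W z - W (z - y))%:E * f z)%E 0).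
  rewrite [RHS]integral_mkcond; apply: eq_integral => z _; rewrite patchE.
  case: ifPn => //; rewrite /f indicE => /negbTE ->; by rewrite mule0.
have mk := measurable_killed_occ y mf f0.
have k0 p := killed_occ_ge0 y p f0.
have : ae_eq mu setT (killed_occ y f) (cst 0%E).
  apply/ae_eq_integral_abs => //.
  by rewrite -[RHS]G0; apply: eq_integral => p _; rewrite gee0_abs.
apply: filterS => p /(_ I) /= kp.
have mp : measurable_fun setT (fun t => (calive y (p : path) t)%:R%:E * f (y + (p : path) t)%R)%E.
  exact: (measurableT_comp (measurable_killed_integrand y mf) (measurable_pair1 p)).
have : ae_eq leb setT (fun t => (calive y (p : path) t)%:R%:E * f (y + (p : path) t)%R)%E (cst 0%E).
  apply/ae_eq_integral_abs => //; rewrite -[RHS]kp; apply: eq_integral => t _.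
  by rewrite gee0_abs// killed_integrand_ge0.
apply: filterS => t /(_ I) /= E pt; apply/eqP => pt0.
move: E; rewrite pt pt0 /f indicE mem_set// mule1 => -[] /eqP.
by rewrite oner_eq0.
Qed.

End no_atom.

(** The path is alive at all times before the hitting time and dead at all times after it. The two
    integrands can then differ at the hitting time itself or at times spent at the barrier, both
    null. *)
Lemma tau_occ (om : R -> R) (p : path) (X : R -> R) (b y : R) :
  measurable_fun setT om -> (forall z, 0 < z -> 0 <= om z) -> 0 <= b -> 0 <= y ->
  (forall t, 0 <= t -> p t = X t) ->
  ~ (forall t, 0 <= t -> calive y p t) ->
  {ae leb, forall t, calive y p t -> y + p t != 0} ->
  let tau := ereal_inf (EFin @` [set t | 0 <= t /\ b + y + X t < b]) in
  (tau < +oo)%E /\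
  (\int[leb]_(s in `[0%R, fine tau[) (om (b + y + X s))%:E =
   killed_occ y (fun u => (shifted_rate om b u)%:E) p)%E.
Proof.
move=> mom om0 b0 y0 pX nforever noatom tau.
have dead q : 0 <= q -> y + p q < 0 -> (tau <= q%:E)%E.
  move=> q0 pq; apply: ereal_inf_lbound; exists q => //=; split => //.
  by rewrite -pX// -addrA gtrDl.
have [q0 q00 pq0] : exists2 q, 0 <= q & y + p q < 0.
  apply: contrapT => nq; apply: nforever => t t0; apply/caliveP; split => // q q0 _.
  by rewrite leNgt; apply/negP => pq; apply: nq; exists q.
have tau_lt : (tau < +oo)%E by rewrite (le_lt_trans (dead _ q00 pq0))// ltry.
have tau_ge0 : (0 <= tau)%E.
  by apply: le_ereal_inf_tmp => _ [t [t0 _] <-]; rewrite lee_fin.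
split=> //; set r := fine tau.
have rE : tau = r%:E by rewrite fineK// ge0_fin_numE.
have alive s : 0 <= s -> s < r -> calive y p s.
  move=> s0 sr; apply/caliveP; split => // q qq0 qs; rewrite leNgt; apply/negP => pq.
  by have := dead q qq0 pq; rewrite rE lee_fin leNgt (le_lt_trans qs).
have killed s : r < s -> calive y p s = false.
  move=> rs; apply/negP => /caliveP[s0 H].
  have : (tau < s%:E)%E by rewrite rE lte_fin.
  move=> /ereal_inf_lt[_ [t [t0 tb] <-]]; rewrite lte_fin => ts.
  have := H t t0 (ltW ts); rewrite pX// => yt; move: tb.
  by rewrite -addrA gtrDl ltNge yt.
have mp : measurable_fun setT (p : R -> R).
  exact: (measurableT_comp measurable_rcpath_evalP (measurable_pair1 (p : pathT))).
have mo := measurable_shifted_rate b mom.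
pose k s : \bar R := ((calive y p s)%:R%:E * (shifted_rate om b (y + p s))%:E)%E.
have mk : measurable_fun setT k.
  have mo' : measurable_fun setT (fun u : R => (shifted_rate om b u)%:E).
    exact/measurable_EFinP.
  exact: (measurableT_comp (measurable_killed_integrand y mo') (measurable_pair1 (p : pathT))).
transitivity (\int[leb]_(s in `[0%R, r[) (om (b + (y + p s)))%:E)%E.
  apply: eq_integral => s; rewrite inE/= in_itv/= => /andP[s0 _].
  by rewrite pX// addrA.
transitivity (\int[leb]_(s in `[0%R, r[) k s)%E.
  apply: ae_eq_integral => //.
  - apply/measurable_EFinP; apply: measurable_funTS; apply: measurableT_comp => //.
    by do 2 apply: measurable_funD => //.
  - exact: measurable_funTS.
  have [N [mN N0 sub]] := noatom; exists N; split => // s ns; apply: sub => na; apply: ns.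
  rewrite /= in_itv/= => /andP[s0 sr].
  have sal := alive s s0 sr; have ne := na sal.
  have ps : 0 < y + p s by rewrite lt_neqAle eq_sym ne (calive_ge0 sal).
  by rewrite /k sal mul1e /shifted_rate ltr_wpDl.
(* Survival at time r itself is undetermined, since the infimum need not be attained; the endpoint
   is null. *)
rewrite integral_itv_bndo_bndc; last exact: measurable_funTS.
rewrite integral_mkcond; apply: eq_integral => s _; rewrite patchE; case: ifPn => //.
rewrite notin_setE/= in_itv/= => /negP; rewrite negb_and -!ltNge => /orP[s0|rs].
  rewrite (_ : calive y p s = false) ?mul0e//.
  by apply/negP => /caliveP[]; rewrite leNgt s0.
by rewrite killed// mul0e.
Qed.

End hitting_time.

(** * Return to the original process *)

Theorem theorem2p7 (R : realType) (g s : R) (pi : {measure set R -> \bar R})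
  (d : measure_display) (T : measurableType d) (P : probability T R)
  (X : R -> T -> R) (W om : R -> R) (b : R) :
  levy_triplet g s pi ->
  levy_process P X (Psi g s pi) ->
  scale_function (Psi g s pi) W ->
  measurable_fun setT om ->
  (forall z, 0 < z -> 0 <= om z) ->
  (forall u v, 0 < u -> u <= v -> exists M : R, forall z, u <= z <= v -> om z <= M) ->
  0 <= b ->
  (\sum_(0 <= n <oo) Wom W om n b < +oo)%E ->
  forall x, b <= x ->
    killed_laplace P X om x b =
    ((\sum_(0 <= n <oo) Wom W om n x) * ((fine (\sum_(0 <= n <oo) Wom W om n b))^-1)%:E)%E.
Proof.
move=> trip lev HW mom om0 _ b0 Sfin x bx.
have psi_ge0 := Psi_ge0 trip; have psi_le := Psi_le trip.
have [phi [mu [mphi phiE trans smu lapmu]]] := levy_path_law lev.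
have lap1 : laplace_at mu (Psi g s pi) 1 by move=> l l0; rewrite mul1r lapmu.
set y := x - b; have y0 : 0 <= y by rewrite subr_ge0.
have xE : x = b + y by rewrite /y addrC subrK.
have Wneg z : z < 0 -> W z = 0 by case: HW => H _; exact: H.
have W0 := scale_function_ge0 psi_ge0 HW.
have Wle := scale_function_homo psi_ge0 HW.
set o := shifted_rate om b.
have o0 z : 0 <= o z by exact: shifted_rate_ge0.
have mo : measurable_fun setT o by exact: measurable_shifted_rate.
have SE z : 0 <= z -> (\sum_(0 <= n <oo) Wom W om n (b + z) = kernel_sum W o z)%E.
  by move=> z0; apply: eq_eseriesr => n _; exact: Wom_kernel_iter.
have SbE : (\sum_(0 <= n <oo) Wom W om n b = kernel_sum W o 0)%E.
  by rewrite -SE// addr0.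
have Tfin : (kernel_sum W o 0 < +oo)%E by rewrite -SbE.
have v0 := kernel_ratio_ge0 W0 o0; set v := kernel_ratio W o in v0.
have mv : measurable_fun setT v by exact: measurable_kernel_ratio.
have mo' : measurable_fun setT (fun u : R => (o u)%:E) by exact/measurable_EFinP.
have vG z : 0 <= z ->
    ((v z)%:E + killed_potential mu z (fun u => (o u * v u)%:E) = 1)%E.
  move=> z0; rewrite (killed_potentialE smu lap1 psi_ge0 psi_le HW)//.
  - exact: kernel_ratioE.
  - by apply/measurable_EFinP; exact: measurable_funM.
  - by move=> u; rewrite lee_fin mulr_ge0.
have ofin : (killed_potential mu y (fun u => (o u)%:E) < +oo)%E.
  rewrite (killed_potentialE smu lap1 psi_ge0 psi_le HW)//.
  exact: kernel_potential_fin.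
have FK := feynman_kac smu y0 o0 mo v0 mv vG ofin.
have k0 p : (0 <= killed_occ y (fun u => (o u)%:E) p)%E.
  by apply: killed_occ_ge0 => u; rewrite lee_fin.
have mk : measurable_fun setT (killed_occ y (fun u => (o u)%:E)).
  by apply: measurable_killed_occ => // u; rewrite lee_fin.
have rhsE : ((\sum_(0 <= n <oo) Wom W om n x) *
    ((fine (\sum_(0 <= n <oo) Wom W om n b))^-1)%:E = (v y)%:E)%E.
  rewrite SbE xE SE// /v /kernel_ratio EFinM fineK//.
  exact: kernel_sum_fin.
rewrite rhsE -FK.
have aefin : {ae mu, forall p, killed_occ y (fun u => (o u)%:E) p \is a fin_num}.
  have : mu.-integrable setT (killed_occ y (fun u => (o u)%:E)).
    by apply/integrableP; split => //; under eq_integral do rewrite gee0_abs//.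
  by move=> /integrable_ae -/(_ measurableT); apply: filterS => p /(_ I).
have aedead : {ae mu, forall p : rcpathT R, ~ (forall t, 0 <= t -> calive y (p : rcpath R) t)}.
  exists [set p : rcpathT R | forall t, 0 <= t -> calive y (p : rcpath R) t]; split.
  - exact: measurable_calive_forever.
  - exact: (calive_forever_null smu lap1 (scale_function_psi_gt0 psi_ge0 HW) psi_le).
  - by move=> p /= /contrapT.
have aeatom := killed_no_atom smu lap1 psi_ge0 psi_le HW y0.
(* Three almost sure facts are transferred: a finite exponent, so that [fine] is faithful; death in
   finite time, so that the restriction to a finite hitting time is vacuous; and null time at the
   barrier, so that the cut rate may replace [om]. *)
have aeP := ae_pushforward mphi trans (filterI aefin (filterI aedead aeatom)).
have mexp : measurable_fun setT
    (fun p => (expR (- fine (killed_occ y (fun u => (o u)%:E) p)))%:E).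
  apply/measurable_EFinP; apply: measurableT_comp => //; apply: measurableT_comp => //.
  exact: measurableT_comp.
rewrite -trans//.
rewrite /killed_laplace integral_mkcond; apply: ge0_ae_eq_integralT.
- exact: (measurableT_comp mexp mphi).
- by move=> w; apply: erestrict_ge0 => {}w _; exact: expeR_ge0.
- by move=> w; rewrite lee_fin expR_ge0.
case: aeP => N [mN N0 sub]; exists N; split => // w nw.
apply: sub => -[kfin [dead atom]]; apply: nw.
have [tl occ] := tau_occ mom om0 b0 y0 (fun t t0 => phiE w t t0) dead atom.
rewrite /= patchE mem_set; last by rewrite /= /tau_below xE.
rewrite /occ_set /tau_below {1 2}xE occ -[X in expeR (- X)%E](fineK kfin).
by [].
Qed.
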